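(* For $\alpha\in\mathbb{C}$, the spectrum of $\mathcal{W}_\alpha$ is $$\sigma(\mathcal{W}_\alpha)=\begin{cases} i\mathbb{R} & \text{if }\alpha\in\mathbb{C}\setminus\{\pm N\},\\ \overline{\mathbb{C}_+} & \text{if }\alpha=N,\\ \overline{\mathbb{C}_-} & \text{if }\alpha=-N.\end{cases}$$ Moreover: (i) for every $\alpha\in\mathbb{C}$, $i\mathbb{R}$ contains no eigenvalue and no residual spectrum of $\mathcal{W}_\alpha$; (ii) if $\alpha=\pm N$, then any $z\in\mathbb{C}_\pm$ (same sign) is an eigenvalue of $\mathcal{W}_\alpha$ of geometric multiplicity $1$ and infinite algebraic multiplicity; (iii) there exist $c_0,C>0$ such that for each choice of sign $\pm$, all $\alpha\in\mathbb{C}_\pm\setminus\{\pm N\}$ and all $z\in\mathbb{C}_\pm$ (same sign throughout), $$\max\left(\frac{1}{|\mathrm{Re}(z)|},\frac{c_0}{|z|\,|\alpha\mp N|}\right)\le\big\|(\mathcal{W}_\alpha-z)^{-1}\big\|_{\mathcal{L}(\mathscr{H})}\le\frac{C}{|\mathrm{Re}(z)|}\left(1+\frac{1}{|\alpha\mp N|}\right).$$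
   Context: Fix $N\in\mathbb{N}^*=\{1,2,\dots\}$, put $\mathcal{N}=\{1,\dots,N\}$ and $\mathbb{R}_+^*=]0,+\infty[$. The star graph $\Gamma$ consists of $N$ copies of $\mathbb{R}_+^*$ joined at a central vertex $0$. A function $u$ on $\Gamma$ is a tuple $u=(u_j)_{j\in\mathcal{N}}$ of functions on $\mathbb{R}_+^*$; derivatives are taken componentwise. Put $L^2(\Gamma)=L^2(\mathbb{R}_+^* )^N$ (complex-valued functions, natural Hilbert structure) and, for $k\in\mathbb{N}^*$, $H^k(\Gamma^* )=H^k(\mathbb{R}_+^* )^N$, $\dot H^k(\Gamma^* )=\dot H^k(\mathbb{R}_+^* )^N$, where $\dot H^k(\mathbb{R}_+^* )$ is the space of locally integrable functions whose $k$-th distributional derivative is in $L^2(\mathbb{R}_+^* )$. A function $u\in\dot H^1(\Gamma^* )$ is continuous at $0$ if $u_j(0)=u_k(0)$ for all $j,k\in\mathcal{N}$; the common value is $u(0)$. Put $\dot H^1(\Gamma)=\{u\in\dot H^1(\Gamma^* ): u \text{ continuous at } 0\}$, $H^1(\Gamma)=\{u\in H^1(\Gamma^* ): u \text{ continuous at } 0\}$, and let $\tilde H^1(\Gamma)$ be the quotient of $\dot H^1(\Gamma)$ by constant functions, a Hilbert space for $\langle u,v\rangle_{\tilde H^1(\Gamma)}=\langle u',v'\rangle_{L^2(\Gamma)}$. Functions in $\dot H^1(\Gamma)$ are identified with their classes in $\tilde H^1(\Gamma)$. Let $\mathscr{H}=\tilde H^1(\Gamma)\times L^2(\Gamma)$,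 and $\mathcal{L}(\mathscr{H})$ the bounded operators on $\mathscr{H}$. Put $\mathbb{C}_\pm=\{z\in\mathbb{C}:\pm\mathrm{Re}(z)>0\}$. For $\alpha\in\mathbb{C}$, $\mathcal{W}_\alpha$ is the unbounded operator in $\mathscr{H}$ with domain $$\mathrm{Dom}(\mathcal{W}_\alpha)=\Big\{(u,v)\in\big(\tilde H^1(\Gamma)\cap\dot H^2(\Gamma^* )\big)\times H^1(\Gamma):\ \sum_{j=1}^N u_j'(0)+\alpha v(0)=0\Big\}$$ and action $\mathcal{W}_\alpha(u,v)=(v,u'')$. For a closed operator $\mathcal{W}$, the point spectrum $\sigma_{\mathrm p}(\mathcal{W})$ is its set of eigenvalues; $\lambda\in\sigma(\mathcal{W})$ belongs to the residual spectrum if $\lambda\notin\sigma_{\mathrm p}(\mathcal{W})$ and the closure of the range of $\mathcal{W}-\lambda$ is a proper subset of $\mathscr{H}$. The geometric multiplicity of an eigenvalue $z$ is $\dim\ker(\mathcal{W}-z)$ and the algebraic multiplicity is $\dim\bigcup_{k\ge1}\ker(\mathcal{W}-z)^k$. *)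

(* Defs.v *)
From HB Require Import structures.
From mathcomp Require Import all_boot all_order all_algebra.
From mathcomp Require Import complex ring_quotient generic_quotient.
From mathcomp Require Import all_classical all_reals all_analysis measurable_realfun.
From mathcomp Require Import ring lra.
Set Implicit Arguments.
Unset Strict Implicit.
Unset Printing Implicit Defensive.
Import Order.TTheory GRing.Theory Num.Theory.
Import numFieldNormedType.Exports.
Local Open Scope classical_set_scope.
Local Open Scope ring_scope.
Local Open Scope complex_scope.

Section HalfLine.
Context {R : realType}.
Implicit Types (f g h : R -> R[i]) (phi : R -> R) (c z : R[i]).

Local Notation mu := (@lebesgue_measure R).
Local Notation Rpos := (`]0, +oo[%classic : set R).
Local Notation Re := (@complex.Re R).
Local Notation Im := (@complex.Im R).

Definition cabs z : R := Normc.normc z.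

Definition cintegral h : R[i] :=
  (\int[mu]_(x in Rpos) Re (h x)) +i* (\int[mu]_(x in Rpos) Im (h x)).

Definition ae_eq_half_line f g := ae_eq mu Rpos f g.

Definition square_integrable f :=
  [/\ measurable_fun Rpos (Re \o f), measurable_fun Rpos (Im \o f) &
      (\int[mu]_(x in Rpos) (cabs (f x) ^+ 2)%:E < +oo)%E].

Definition locally_integrable_half_line f :=
  locally_integrable Rpos (Re \o f) /\ locally_integrable Rpos (Im \o f).

(* C_c^oo(]0, +oo[), each function being extended by 0 to the whole line.
   Real-valued test functions suffice: distributions are C-linear. *)
Definition test_function phi :=
  (forall n x, derivable (phi^`(n))%classic x 1) /\
  exists K : set R, [/\ compact K, K `<=` Rpos &
                        forall x, ~ K x -> phi x = 0].

Definition is_weak_derivative (k : nat) f g :=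
  [/\ locally_integrable_half_line f, locally_integrable_half_line g &
      forall phi, test_function phi ->
        cintegral (fun x => ((phi^`(k))%classic x)%:C * f x) =
        (-1) ^+ k * cintegral (fun x => (phi x)%:C * g x)].


Definition Hdot (k : nat) f :=
  exists2 g, is_weak_derivative k f g & square_integrable g.

Definition Hsob (k : nat) f :=
  square_integrable f /\ forall i, (0 < i <= k)%N -> Hdot i f.

Definition weak_derivative (k : nat) f : R -> R[i] :=
  xget 0 [set g | is_weak_derivative k f g].

(* [c] is the value at 0 of the continuous representative of [f] on [0, +oo[. *)
Definition has_trace0 f c :=
  exists g : R -> R[i]^o, [/\ ae_eq_half_line f g,
    {within `[0, +oo[, continuous g} & g 0 = c].

Definition trace0 f : R[i] := xget 0 [set c | has_trace0 f c].

Lemma cabs_ge0 z : 0 <= cabs z.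
Proof. by case: z => a b; rewrite /cabs /= sqrtr_ge0. Qed.

Lemma cabs_sqr z : cabs z ^+ 2 = Re z ^+ 2 + Im z ^+ 2.
Proof. by case: z => a b; rewrite /cabs /= sqr_sqrtr// addr_ge0// sqr_ge0. Qed.

Lemma ReD z w : Re (z + w) = Re z + Re w. Proof. by case: z; case: w. Qed.
Lemma ImD z w : Im (z + w) = Im z + Im w. Proof. by case: z; case: w. Qed.
Lemma ReM z w : Re (z * w) = Re z * Re w - Im z * Im w.
Proof. by case: z; case: w. Qed.
Lemma ImM z w : Im (z * w) = Re z * Im w + Im z * Re w.
Proof. by case: z => a b; case: w => c d /=; rewrite addrC mulrC. Qed.

Let mRpos : measurable (Rpos : set (measurableTypeR R)).
Proof. exact: measurable_itv. Qed.

Lemma measurable_cabs_sqr f : measurable_fun Rpos (Re \o f) ->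
  measurable_fun Rpos (Im \o f) ->
  measurable_fun Rpos (EFin \o (fun x => cabs (f x) ^+ 2)).
Proof.
move=> mr mi; apply/measurable_EFinP.
rewrite (_ : (fun x => _) = (fun x => (Re \o f) x ^+ 2 + (Im \o f) x ^+ 2)).
  by apply: measurable_funD; apply: measurable_funX.
by apply/funext => x; rewrite cabs_sqr.
Qed.

Lemma measurable_Re_lin z f g : measurable_fun Rpos (Re \o f) ->
  measurable_fun Rpos (Im \o f) -> measurable_fun Rpos (Re \o g) ->
  measurable_fun Rpos (Re \o (fun x => z * f x + g x)).
Proof.
move=> mr mi mg.
rewrite (_ : _ \o _ =
  (fun x => Re z * (Re \o f) x - Im z * (Im \o f) x + (Re \o g) x)).
  by apply: measurable_funD => //; apply: measurable_funB; apply: measurable_funM.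
by apply/funext => x /=; rewrite ReD ReM.
Qed.

Lemma measurable_Im_lin z f g : measurable_fun Rpos (Re \o f) ->
  measurable_fun Rpos (Im \o f) -> measurable_fun Rpos (Im \o g) ->
  measurable_fun Rpos (Im \o (fun x => z * f x + g x)).
Proof.
move=> mr mi mg.
rewrite (_ : _ \o _ =
  (fun x => Re z * (Im \o f) x + Im z * (Re \o f) x + (Im \o g) x)).
  by apply: measurable_funD => //; apply: measurable_funD; apply: measurable_funM.
by apply/funext => x /=; rewrite ImD ImM.
Qed.

Lemma square_integrable0 : square_integrable (fun=> 0).
Proof.
split; rewrite /comp/=; [exact: measurable_cst|exact: measurable_cst|].
rewrite integral0_eq// => x _.
by rewrite /= !expr0n /= addr0 sqrtr0 expr0n.
Qed.

Lemma square_integrable_lin z f g : square_integrable f ->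
  square_integrable g -> square_integrable (fun x => z * f x + g x).
Proof.
move=> [f1 f2 f3] [g1 g2 g3].
have m1 := @measurable_Re_lin z f g f1 f2 g1.
have m2 := @measurable_Im_lin z f g f1 f2 g2.
split => //.
apply: (@le_lt_trans _ _ (\int[mu]_(x in Rpos)
   ((2 * cabs z ^+ 2)%:E * (cabs (f x) ^+ 2)%:E
    + 2%:E * (cabs (g x) ^+ 2)%:E)%E)%E).
  apply: ge0_le_integral => //.
  - by move=> x _; rewrite lee_fin exprn_ge0// cabs_ge0.
  - exact: measurable_cabs_sqr.
  - apply: emeasurable_funD; apply: emeasurable_funM => //;
      exact: measurable_cabs_sqr.
  - move=> x _; rewrite -!EFinM -EFinD lee_fin !cabs_sqr ReD ImD ReM ImM.
    move: (Re z) (Im z) (Re (f x)) (Im (f x)) (Re (g x)) (Im (g x)).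
    move=> p q a b c d; rewrite -subr_ge0.
    rewrite (_ : _ - _ = (p * a - q * b - c) ^+ 2 + (p * b + q * a - d) ^+ 2).
      by rewrite addr_ge0// sqr_ge0.
    by ring.
rewrite ge0_integralD//=; first last.
- by apply: emeasurable_funM => //; exact: measurable_cabs_sqr.
- by move=> x _; rewrite mule_ge0// lee_fin ?exprn_ge0 ?cabs_ge0.
- by apply: emeasurable_funM => //; exact: measurable_cabs_sqr.
- move=> x _; rewrite mule_ge0// lee_fin ?mulr_ge0// ?exprn_ge0 ?cabs_ge0//.
rewrite !ge0_integralZl//; first last.
- by rewrite lee_fin mulr_ge0// exprn_ge0// cabs_ge0.
- by move=> x _; rewrite lee_fin exprn_ge0// cabs_ge0.
- exact: measurable_cabs_sqr.
- by move=> x _; rewrite lee_fin exprn_ge0// cabs_ge0.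
- exact: measurable_cabs_sqr.
by rewrite lte_add_pinfty// lte_mul_pinfty// lee_fin mulr_ge0// exprn_ge0// cabs_ge0.
Qed.

Lemma locally_integrableZ (D : set R) (r : R) (f : R -> R) :
  locally_integrable D f -> locally_integrable D (fun x => r * f x).
Proof.
move=> [mf oD foo]; split => //; first exact: measurable_funM.
move=> K KD cK; have mK : measurable (K : set (measurableTypeR R)).
  exact: compact_measurable.
under eq_integral do rewrite normrM EFinM.
rewrite ge0_integralZl//; first by rewrite lte_mul_pinfty//; exact: foo.
apply/measurable_EFinP; apply: measurableT_comp => //.
by apply: measurable_funS mf => //; exact: open_measurable.
Qed.

Lemma locally_integrable_half_line0 : locally_integrable_half_line (fun=> 0).
Proof.
have H : locally_integrable Rpos (cst (0 : R)).
  split; [exact: measurable_cst|exact: interval_open|move=> K _ _].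
  by rewrite integral0_eq// => x _; rewrite normr0.
by split.
Qed.

Lemma locally_integrable_half_line_lin z f g :
  locally_integrable_half_line f -> locally_integrable_half_line g ->
  locally_integrable_half_line (fun x => z * f x + g x).
Proof.
move=> [f1 f2] [g1 g2]; split.
  rewrite (_ : _ \o _ = (fun x => Re z * (Re \o f) x) \-
     (fun x => Im z * (Im \o f) x) \+ (Re \o g)).
    apply: locally_integrableD => //.
    by apply: locally_integrableB; apply: locally_integrableZ.
  by apply/funext => x /=; rewrite ReD ReM.
rewrite (_ : _ \o _ = (fun x => Re z * (Im \o f) x) \+
     (fun x => Im z * (Re \o f) x) \+ (Im \o g)).
  apply: locally_integrableD => //.
  by apply: locally_integrableD; apply: locally_integrableZ.
by apply/funext => x /=; rewrite ImD ImM.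
Qed.

Lemma ReZ (r : R) z : Re (r%:C * z) = r * Re z.
Proof. by rewrite ReM /= mul0r subr0. Qed.
Lemma ImZ (r : R) z : Im (r%:C * z) = r * Im z.
Proof. by rewrite ImM /= mul0r addr0. Qed.

Lemma test_function_derive_supp phi : test_function phi ->
  exists K : set R, [/\ compact K, K `<=` Rpos &
    forall n x, ~ K x -> (phi^`(n))%classic x = 0].
Proof.
move=> [sphi [K [cK KR phi0]]]; exists K; split => // n.
have oK : open (~` K) by apply/closed_openC; apply: compact_closed => //; exact: Rhausdorff.
elim: n => [|n IH] x nKx; first exact: phi0.
rewrite derive1nS derive1E.
rewrite (@near_eq_derive _ _ _ _ (cst 0)) ?derive_cst//.
by apply: filterS (open_nbhs_nbhs (conj oK nKx)) => y; exact: IH.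
Qed.

Lemma integrable_test (h f : R -> R) (K : set R) : continuous h ->
  compact K -> K `<=` Rpos -> (forall x, ~ K x -> h x = 0) ->
  locally_integrable Rpos f ->
  mu.-integrable Rpos (EFin \o (fun x => h x * f x)).
Proof.
move=> ch cK KR h0 [mf _ foo].
have mK : measurable (K : set (measurableTypeR R)) by exact: compact_measurable.
have mfK : measurable_fun (K : set (measurableTypeR R)) f.
  by apply: measurable_funS mf.
have mhK : measurable_fun (K : set (measurableTypeR R)) h.
  by apply: measurable_funTS; exact: continuous_measurable_fun.
have [M hM] : exists M : R, forall x, K x -> `|h x| <= M.
  have /compact_bounded[M [_ HM]] : compact (h @` K).
    by apply: continuous_compact => //; exact: continuous_subspaceT.
  exists (M + 1) => x Kx; apply: HM; first by rewrite ltrDl.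
  by exists x.
have fK : mu.-integrable K (EFin \o f).
  apply/integrableP; split; first exact/measurable_EFinP.
  exact: foo.
have : mu.-integrable K (EFin \o (fun x => h x * f x)).
  apply: (le_integrable _ _ _ (integrableZl _ M fK)) => //.
    by apply/measurable_EFinP; exact: measurable_funM.
  move=> x Kx /=; rewrite lee_fin !normrM ler_wpM2r//.
  by rewrite (le_trans (hM _ Kx))// ler_norm.
move/(integrable_mkcond _ mK) => H; apply/integrable_mkcond => //.
apply: eq_integrable H => // x _ /=.
rewrite !patchE; case: ifPn => xK; case: ifPn => xR //.
- by move: xR; rewrite notin_setE; move: xK; rewrite inE => /KR.
- by rewrite /= h0 ?mul0r//; move: xK; rewrite notin_setE.
Qed.

Lemma cintegral_lin z h1 h2 :
  mu.-integrable Rpos (EFin \o (Re \o h1)) ->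
  mu.-integrable Rpos (EFin \o (Im \o h1)) ->
  mu.-integrable Rpos (EFin \o (Re \o h2)) ->
  mu.-integrable Rpos (EFin \o (Im \o h2)) ->
  cintegral (fun x => z * h1 x + h2 x) = z * cintegral h1 + cintegral h2.
Proof.
move=> r1 i1 r2 i2.
have I (r : R) (k : R -> R) : mu.-integrable Rpos (EFin \o k) ->
    mu.-integrable Rpos (EFin \o (fun x => r * k x)).
  by move=> ik; exact: (integrableZl _ r ik).
have D (k1 k2 : R -> R) : mu.-integrable Rpos (EFin \o k1) ->
    mu.-integrable Rpos (EFin \o k2) ->
    mu.-integrable Rpos (EFin \o (fun x => k1 x + k2 x)).
  by move=> ik1 ik2; exact: (integrableD _ ik1 ik2).
apply/eqP; rewrite eq_complex ReD ImD ReM ImM /=; apply/andP; split; apply/eqP.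
  transitivity (\int[mu]_(x in Rpos) ((Re z * (Re \o h1) x +
      (- Im z) * (Im \o h1) x) + (Re \o h2) x)).
    by apply: eq_Rintegral => x _; rewrite ReD ReM mulNr.
  rewrite RintegralD//; last by apply: D; exact: I.
  rewrite RintegralD//; [|exact: I|exact: I].
  by rewrite !RintegralZl// mulNr.
transitivity (\int[mu]_(x in Rpos) ((Re z * (Im \o h1) x +
    Im z * (Re \o h1) x) + (Im \o h2) x)).
  by apply: eq_Rintegral => x _; rewrite ImD ImM.
rewrite RintegralD//; last by apply: D; exact: I.
rewrite RintegralD//; [|exact: I|exact: I].
by rewrite !RintegralZl.
Qed.

Lemma cintegral_test_lin n phi z f g : test_function phi ->
  locally_integrable_half_line f -> locally_integrable_half_line g ->
  cintegral (fun x => ((phi^`(n))%classic x)%:C * (z * f x + g x)) =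
  z * cintegral (fun x => ((phi^`(n))%classic x)%:C * f x) +
  cintegral (fun x => ((phi^`(n))%classic x)%:C * g x).
Proof.
move=> tphi [rf imf] [rg ig].
have [K [cK KR K0]] := test_function_derive_supp tphi.
have ch : continuous (phi^`(n))%classic.
  by move=> x; apply/differentiable_continuous/derivable1_diffP; exact: tphi.1.
rewrite -cintegral_lin; first last.
- rewrite (_ : _ \o _ = fun x => (phi^`(n))%classic x * (Im \o g) x).
    exact: integrable_test (K0 n) _.
  by apply/funext => x /=; rewrite ImZ.
- rewrite (_ : _ \o _ = fun x => (phi^`(n))%classic x * (Re \o g) x).
    exact: integrable_test (K0 n) _.
  by apply/funext => x /=; rewrite ReZ.
- rewrite (_ : _ \o _ = fun x => (phi^`(n))%classic x * (Im \o f) x).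
    exact: integrable_test (K0 n) _.
  by apply/funext => x /=; rewrite ImZ.
- rewrite (_ : _ \o _ = fun x => (phi^`(n))%classic x * (Re \o f) x).
    exact: integrable_test (K0 n) _.
  by apply/funext => x /=; rewrite ReZ.
by congr cintegral; apply/funext => x; rewrite mulrDr mulrCA.
Qed.

Lemma is_weak_derivative_lin k z f1 g1 f2 g2 :
  is_weak_derivative k f1 g1 -> is_weak_derivative k f2 g2 ->
  is_weak_derivative k (fun x => z * f1 x + f2 x) (fun x => z * g1 x + g2 x).
Proof.
move=> [lf1 lg1 H1] [lf2 lg2 H2]; split.
- exact: locally_integrable_half_line_lin.
- exact: locally_integrable_half_line_lin.
move=> phi tphi; rewrite cintegral_test_lin//.
rewrite (@cintegral_test_lin 0%N)// H1// H2//= mulrDr.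
by rewrite mulrCA.
Qed.

Lemma cintegral0 : cintegral (fun=> 0) = 0.
Proof. by rewrite /cintegral /Rintegral integral0_eq. Qed.

Lemma is_weak_derivative0 k : is_weak_derivative k (fun=> 0) (fun=> 0).
Proof.
split; [exact: locally_integrable_half_line0|exact: locally_integrable_half_line0|].
move=> phi _; under [in LHS]eq_fun do rewrite mulr0.
by under [in RHS]eq_fun do rewrite mulr0; rewrite cintegral0 mulr0.
Qed.

Lemma Hdot0 k : Hdot k (fun=> 0).
Proof.
by exists (fun=> 0); [exact: is_weak_derivative0|exact: square_integrable0].
Qed.

Lemma Hdot_lin k z f g : Hdot k f -> Hdot k g -> Hdot k (fun x => z * f x + g x).
Proof.
move=> [f' wf sf] [g' wg sg]; exists (fun x => z * f' x + g' x).
  exact: is_weak_derivative_lin.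
exact: square_integrable_lin.
Qed.

Lemma ae_eq_half_line_lin z f1 f2 g1 g2 : ae_eq_half_line f1 f2 ->
  ae_eq_half_line g1 g2 ->
  ae_eq_half_line (fun x => z * f1 x + g1 x) (fun x => z * f2 x + g2 x).
Proof.
move=> Hf Hg; rewrite /ae_eq_half_line.
by apply: (filterS2 _ _ Hf Hg) => x {}Hf {}Hg xR; rewrite Hf// Hg.
Qed.

Lemma ae_eq_half_line_refl f : ae_eq_half_line f f.
Proof. exact: aeW. Qed.

Lemma has_trace0_cst c : has_trace0 (fun=> c) c.
Proof.
exists (fun=> c); split => //; first exact: ae_eq_half_line_refl.
by move=> x; exact: cvg_cst.
Qed.

Lemma has_trace0_lin z f g a b : has_trace0 f a -> has_trace0 g b ->
  has_trace0 (fun x => z * f x + g x) (z * a + b).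
Proof.
move=> [f' [ff' cf f0]] [g' [gg' cg g0]].
exists (fun x => z * f' x + g' x); split; last by rewrite f0 g0.
  exact: ae_eq_half_line_lin.
move=> x; apply: (@cvgD _ R[i]^o); last exact: cg.
by apply: (@cvgZr _ R[i]^o); exact: cf.
Qed.

End HalfLine.

Section QuotientModule.
Local Open Scope quotient_scope.
Variables (K : nzRingType) (V : lmodType K) (S : zmodClosed V).
Hypothesis S_scale : forall a v, v \in S -> a *: v \in S.
Local Notation Q := (@Quotient.quot V S).

Definition quot_scale (a : K) (x : Q) : Q := \pi_Q (a *: repr x).

Lemma pi_scale a (v : V) : quot_scale a (\pi_Q v) = \pi_Q (a *: v).
Proof.
apply/eqP; rewrite /quot_scale -Quotient.idealrBE -scalerBr S_scale//.
by rewrite Quotient.idealrBE reprK.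
Qed.

Lemma quot_scaleA a b x : quot_scale a (quot_scale b x) = quot_scale (a * b) x.
Proof. by rewrite -[x]reprK (pi_scale b) (pi_scale a) (pi_scale (a * b)) scalerA. Qed.
Lemma quot_scale1 : left_id 1 quot_scale.
Proof. by move=> x; rewrite -[x]reprK pi_scale scale1r. Qed.
Lemma quot_scaleDr : right_distributive quot_scale +%R.
Proof.
by move=> a x y; rewrite -[x]reprK -[y]reprK -raddfD !pi_scale scalerDr raddfD.
Qed.
Lemma quot_scaleDl x : {morph quot_scale^~ x : a b / a + b}.
Proof. by move=> a b; rewrite -[x]reprK !pi_scale scalerDl raddfD. Qed.

End QuotientModule.

Section StarGraph.
Context {R : realType}.
Variable N : nat.

Definition star_fun := 'I_N -> R -> R[i].
HB.instance Definition _ := GRing.Lmodule.on star_fun.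

Implicit Types (u v : star_fun) (alpha c : R[i]).

Lemma star_fun_linE (z : R[i]) u v j x : (z *: u + v) j x = z * u j x + v j x.
Proof. by []. Qed.

Definition has_vertex_value u c := forall j, has_trace0 (u j) c.

Definition vertex_value u : R[i] := xget 0 [set c | has_vertex_value u c].

Definition L2_star u := forall j, square_integrable (u j).

Definition Hdot1_star u :=
  (forall j, Hdot 1 (u j)) /\ exists c, has_vertex_value u c.

Definition H1_star u :=
  (forall j, Hsob 1 (u j)) /\ exists c, has_vertex_value u c.

Definition L2_norm u : R :=
  Num.sqrt (\sum_(j < N)
    fine (\int[lebesgue_measure]_(x in `]0%R, +oo[) (cabs (u j x) ^+ 2)%:E)%E).

Definition L2_pred : {pred star_fun} := fun u => `[< L2_star u >].

Lemma L2_pred_submod_closed : submod_closed L2_pred.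
Proof.
split; first by apply/asboolP => j; exact: square_integrable0.
move=> a u v /asboolP uL /asboolP vL; apply/asboolP => j.
exact: square_integrable_lin.
Qed.
HB.instance Definition _ :=
  GRing.isSubmodClosed.Build R[i] star_fun L2_pred L2_pred_submod_closed.

Record L2_fun := MkL2Fun { L2_val : star_fun; _ : L2_val \in L2_pred }.
HB.instance Definition _ := [isSub for L2_val].
HB.instance Definition _ := [Choice of L2_fun by <:].
HB.instance Definition _ := [SubChoice_isSubLmodule of L2_fun by <:].

Definition L2_null : {pred L2_fun} :=
  fun f => `[< forall j, ae_eq_half_line (L2_val f j) (fun=> 0) >].

Lemma L2_valD a (f g : L2_fun) :
  L2_val (a *: f + g) = (a *: L2_val f + L2_val g : star_fun).
Proof. by rewrite (_ : L2_val = val)//; exact: linearP. Qed.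

Lemma L2_val_lin a (f g : L2_fun) j x :
  L2_val (a *: f + g) j x = a * L2_val f j x + L2_val g j x.
Proof. by rewrite L2_valD star_fun_linE. Qed.

Lemma L2_null_submod_closed : submod_closed L2_null.
Proof.
split; first by apply/asboolP => j; exact: ae_eq_half_line_refl.
move=> a f g /asboolP u0 /asboolP v0; apply/asboolP => j.
rewrite (funext (L2_val_lin a f g j)).
rewrite (_ : (fun=> 0) = fun x : R => a * 0 + 0).
  by apply: ae_eq_half_line_lin; [exact: u0|exact: v0].
by apply/funext => x; rewrite mulr0 addr0.
Qed.
HB.instance Definition _ :=
  GRing.isSubmodClosed.Build R[i] L2_fun L2_null L2_null_submod_closed.

Definition L2 : Type := @Quotient.quot L2_fun L2_null.
HB.instance Definition _ := GRing.Zmodule.on L2.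

Let L2_nullZ a (f : L2_fun) : f \in L2_null -> a *: f \in L2_null. Proof. exact: rpredZ. Qed.
HB.instance Definition _ := GRing.Zmodule_isLmodule.Build R[i] L2
  (quot_scaleA L2_nullZ) (quot_scale1 L2_nullZ) (quot_scaleDr L2_nullZ) (quot_scaleDl L2_nullZ).

Definition L2_repr (V : L2) : star_fun := L2_val (repr V).
(* The class of [u], and 0 when [u] is not square integrable; similarly for
   [Htilde1_class] below. *)
Definition L2_class u : L2 := (\pi_L2 (insubd (0 : L2_fun) u))%qT.

Definition Hdot1_pred : {pred star_fun} := fun u => `[< Hdot1_star u >].

Lemma Hdot1_pred_submod_closed : submod_closed Hdot1_pred.
Proof.
split.
  apply/asboolP; split; first by move=> j; exact: Hdot0.
  by exists 0 => j; exact: has_trace0_cst.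
move=> a u v /asboolP[uH [c uc]] /asboolP[vH [d vd]]; apply/asboolP; split.
  by move=> j; exact: Hdot_lin.
by exists (a * c + d) => j; exact: has_trace0_lin.
Qed.
HB.instance Definition _ :=
  GRing.isSubmodClosed.Build R[i] star_fun Hdot1_pred Hdot1_pred_submod_closed.

Record Hdot1_fun :=
  MkHdot1Fun { Hdot1_val : star_fun; _ : Hdot1_val \in Hdot1_pred }.
HB.instance Definition _ := [isSub for Hdot1_val].
HB.instance Definition _ := [Choice of Hdot1_fun by <:].
HB.instance Definition _ := [SubChoice_isSubLmodule of Hdot1_fun by <:].

Definition Hdot1_const : {pred Hdot1_fun} :=
  fun f => `[< exists c, forall j, ae_eq_half_line (Hdot1_val f j) (fun=> c) >].

Lemma Hdot1_valD a (f g : Hdot1_fun) :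
  Hdot1_val (a *: f + g) = (a *: Hdot1_val f + Hdot1_val g : star_fun).
Proof. by rewrite (_ : Hdot1_val = val)//; exact: linearP. Qed.

Lemma Hdot1_val_lin a (f g : Hdot1_fun) j x :
  Hdot1_val (a *: f + g) j x = a * Hdot1_val f j x + Hdot1_val g j x.
Proof. by rewrite Hdot1_valD star_fun_linE. Qed.

Lemma Hdot1_const_submod_closed : submod_closed Hdot1_const.
Proof.
split; first by apply/asboolP; exists 0 => j; exact: ae_eq_half_line_refl.
move=> a f g /asboolP[c fc] /asboolP[d gd]; apply/asboolP.
exists (a * c + d) => j; rewrite (funext (Hdot1_val_lin a f g j)).
by apply: ae_eq_half_line_lin; [exact: fc|exact: gd].
Qed.
HB.instance Definition _ :=
  GRing.isSubmodClosed.Build R[i] Hdot1_fun Hdot1_const Hdot1_const_submod_closed.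

Definition Htilde1 : Type := @Quotient.quot Hdot1_fun Hdot1_const.
HB.instance Definition _ := GRing.Zmodule.on Htilde1.

Let Hdot1_constZ a (f : Hdot1_fun) : f \in Hdot1_const -> a *: f \in Hdot1_const. Proof. exact: rpredZ. Qed.
HB.instance Definition _ := GRing.Zmodule_isLmodule.Build R[i] Htilde1
  (quot_scaleA Hdot1_constZ) (quot_scale1 Hdot1_constZ) (quot_scaleDr Hdot1_constZ) (quot_scaleDl Hdot1_constZ).

Definition Htilde1_repr (U : Htilde1) : star_fun := Hdot1_val (repr U).
Definition Htilde1_class u : Htilde1 := (\pi_Htilde1 (insubd (0 : Hdot1_fun) u))%qT.

Definition star_derivative (k : nat) u : star_fun :=
  fun j => weak_derivative k (u j).

Definition energy_space : Type := (Htilde1 * L2)%type.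
HB.instance Definition _ := GRing.Lmodule.on energy_space.

(* The norm of the Hilbert direct sum; it does not depend on representatives. *)
Definition energy_norm (X : energy_space) : R :=
  Num.sqrt (L2_norm (star_derivative 1 (Htilde1_repr X.1)) ^+ 2 +
            L2_norm (L2_repr X.2) ^+ 2).

End StarGraph.

Section UnboundedOperators.
Context {R : realType} {V : lmodType R[i]}.
Variable norm : V -> R.

(* The values of [op_act] outside [op_dom] are irrelevant. *)
Record operator := MkOperator { op_dom : set V; op_act : V -> V }.

Implicit Types (T S : operator) (z : R[i]).

Definition op_id := MkOperator setT id.

Definition op_comp S T :=
  MkOperator [set x | op_dom T x /\ op_dom S (op_act T x)]
             (op_act S \o op_act T).

Definition op_pow T k := iter k (op_comp T) op_id.

Definition op_shift T z := MkOperator (op_dom T) (fun x => op_act T x - z *: x).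

Definition op_ker T := [set x | op_dom T x /\ op_act T x = 0].

Definition op_range T := op_act T @` op_dom T.

Definition op_inv T : V -> V :=
  fun y => xget 0 [set x | op_dom T x /\ op_act T x = y].

Definition op_norm (A : V -> V) : \bar R :=
  ereal_sup [set (norm (A x))%:E | x in [set x | norm x <= 1]].

Definition norm_closure (A : set V) :=
  [set x | forall e : R, 0 < e -> exists2 y, A y & norm (x - y) < e].

Definition resolvent_set T :=
  [set z | set_bij (op_dom T) setT (op_act (op_shift T z)) /\
           (op_norm (op_inv (op_shift T z)) < +oo)%E].

Definition spectrum T := ~` resolvent_set T.

Definition point_spectrum T :=
  [set z | exists2 x, x != 0 & op_ker (op_shift T z) x].

Definition residual_spectrum T :=
  [set z | [/\ spectrum T z, ~ point_spectrum T z &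
               norm_closure (op_range (op_shift T z)) <> setT]].

Definition lin_indep n (e : 'I_n -> V) :=
  forall a : 'I_n -> R[i], \sum_(i < n) a i *: e i = 0 -> forall i, a i = 0.

Definition has_dim (A : set V) (n : nat) := exists e : 'I_n -> V,
  [/\ forall i, A (e i), lin_indep e &
      forall x, A x -> exists a : 'I_n -> R[i], x = \sum_(i < n) a i *: e i].

Definition infinite_dim (A : set V) := forall n, exists e : 'I_n -> V,
  (forall i, A (e i)) /\ lin_indep e.

Definition op_eigenspace T z := op_ker (op_shift T z).

Definition op_gen_eigenspace T z :=
  \bigcup_(k in [set k | (1 <= k)%N]) op_ker (op_pow (op_shift T z) k).

End UnboundedOperators.

Section WaveOperator.
Context {R : realType}.
Variable N : nat.

(* Membership in the domain does not depend on the chosen representatives: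
   derivatives and traces are invariant under equality almost everywhere, and
   adding a constant to [u] changes neither its derivatives nor [Hdot 2]. *)
Definition wave_domain (alpha : R[i]) : set (@energy_space R N) :=
  [set X | let u := Htilde1_repr X.1 in let v := L2_repr X.2 in
    [/\ forall j, Hdot 2 (u j), H1_star v &
        \sum_(j < N) trace0 (star_derivative 1 u j) + alpha * vertex_value v = 0]].

Definition wave_action (X : @energy_space R N) : energy_space N :=
  (Htilde1_class (L2_repr X.2), L2_class (star_derivative 2 (Htilde1_repr X.1))).

Definition wave_operator (alpha : R[i]) :=
  MkOperator (wave_domain alpha) wave_action.

End WaveOperator.

Section HalfPlanes.
Context {R : realType}.

Definition imaginary_axis : set R[i] := [set z | complex.Re z = 0].

(* The open half-plane C_+ for [b = false] and C_- for [b = true]. *)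
Definition half_plane (b : bool) : set R[i] :=
  [set z | 0 < (-1) ^+ b * complex.Re z].

End HalfPlanes.

(* Main.v *)
Require Import Defs.
From mathcomp Require Import all_boot all_order all_algebra.
From mathcomp Require Import complex ring_quotient generic_quotient.
From mathcomp Require Import all_classical all_reals all_analysis measurable_realfun.
From mathcomp Require Import ring lra.
Set Implicit Arguments.
Unset Strict Implicit.
Unset Printing Implicit Defensive.
Import Order.TTheory GRing.Theory Num.Theory.
Import numFieldNormedType.Exports.
Local Open Scope classical_set_scope.
Local Open Scope ring_scope.

(** Write [p = u'] for the derivative of the first component.  For a sign [s],
    the equation [(W_alpha - z)(u, v) = (F, G)] becomes diagonal in the
    characteristic coordinates [a = v + s p] and [b = v - s p]: on each edge
    [a' = s z a + s A] and [b' = - s z b - s B], where [A] and [B] are the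
    characteristic coordinates of [(F', G)].  The boundary conditions become
    [a_j 0 + b_j 0 = 2 v 0] and [(N - s alpha) v 0 = \sum_j a_j 0].

    If [Re (s z) > 0], the square integrable solution [a] is unique and is
    computed backward from infinity.  If moreover [alpha <> s N], its traces
    determine [v 0], hence the initial values of the [b_j], which are solved
    forward.  Pairing each equation with its solution bounds the resolvent.  Its
    norm is bounded below by the response to a source that is proportional to
    [exp (- conj (s z) x)] on every edge and by the approximate eigenvectors of
    the projection of [z] to the imaginary axis.  If [alpha = s N], taking [a = 0] and
    [b = exp (- s z x)] gives an eigenvector, and solving forward again with the
    previous vector as source gives Jordan chains of every length.  On the
    imaginary axis a homogeneous solution has constant modulus on each edge, so
    there is no kernel; the range is dense because a truncated source is matched
    by damping the equation slightly, at a small cost; and the modulated waves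
    [x exp (- e x) exp (i y x)] show that no resolvent is bounded. *)

(** * Locally absolutely continuous functions on the half-line *)

Section AbsolutelyContinuous.
Context {R : realType}.
Implicit Types (f g h k : R -> R) (x T : R).
Local Notation mu := (@lebesgue_measure R).
Local Notation Rpos := (`]0, +oo[%classic : set R).

(** The statement speaks of weak derivatives, traces, representatives and inverses that are selected
    by choice. The obstacle is to reduce it to a calculus on concrete functions: [H1pair f h c] says
    that [f] is almost everywhere [c] plus the primitive of [h], and [resolvent_rel] expresses the
    equation through such pairs alone. The bridge is the lemma of du Bois-Reymond. An integrable
    function with integrable derivative vanishes at infinity, so integration by parts leaves only a
    vertex term: if [f' = y f + h], then [2 Re y |f|^2 + 2 Re <h, f> = - |f(0)|^2]. The sign of
    [Re y] decides the role of the trace: backward it is bounded by the source, forward it is a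
    datum. Joining the two at the vertex costs one division by [N - s alpha], which is how [alpha]
    enters the upper bound. If all edges carry the same data, the vertex reflects [a(0)] into [b(0)]
    with coefficient [(N + s alpha) / (N - s alpha)]; as [Re (s alpha) > 0], the numerator has
    modulus at least [N], whence the lower bound. States whose vertex values all vanish satisfy the
    vertex condition for every [alpha], which is why approximate eigenvectors and density of the
    range on the axis do not depend on it. *)

Definition locL1 h := forall T, mu.-integrable `]0, T] (EFin \o h).
Definition prim h x := \int[mu]_(t in `]0, x]) h t.
(** Absolute continuity is encoded by the primitive formula, not by a pointwise derivative: [h]
    matters only almost everywhere, [f] has a genuine value at 0, and [f] is unconstrained on
    negative arguments. *)
Definition ac f h := locL1 h /\ forall x, 0 <= x -> f x = f 0 + prim h x.

Lemma prim0 h : prim h 0 = 0.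
Proof. by rewrite /prim set_itvoc0 Rintegral_set0. Qed.

Lemma primD h k x : locL1 h -> locL1 k ->
  prim (fun t => h t + k t) x = prim h x + prim k x.
Proof. by move=> ih ik; rewrite /prim RintegralD. Qed.

Lemma primZ (r : R) h x : locL1 h -> prim (fun t => r * h t) x = r * prim h x.
Proof. by move=> ih; rewrite /prim RintegralZl. Qed.

Lemma locL1D h k : locL1 h -> locL1 k -> locL1 (fun t => h t + k t).
Proof. by move=> ih ik T; exact: (integrableD _ (ih T) (ik T)). Qed.

Lemma locL1Z (r : R) h : locL1 h -> locL1 (fun t => r * h t).
Proof. by move=> ih T; exact: (integrableZl _ r (ih T)). Qed.

Lemma locL1_0 : locL1 (fun=> 0).
Proof. by move=> T; exact: integrable0. Qed.

Lemma locL1_cst (r : R) : locL1 (cst r).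
Proof.
move=> T; have : mu.-integrable `[0, T] (EFin \o cst r).
  apply: continuous_compact_integrable; first exact: segment_compact.
  by apply: continuous_subspaceT => ?; exact: cvg_cst.
by apply: integrableS => //; apply: subset_itvr; rewrite bnd_simp.
Qed.

Lemma Rpos_bigcup : Rpos = \bigcup_n `]0, n%:R]%classic.
Proof.
apply/seteqP; split => t /=; last first.
  by move=> [n _]; rewrite /= !in_itv/= andbT => /andP[].
rewrite in_itv/= andbT => t0.
exists (Num.truncn t).+1 => //=; rewrite in_itv/= t0 /=.
by rewrite ltW// truncnS_gt.
Qed.

Lemma integrable_itv_cbnd h T : mu.-integrable `]0, T] (EFin \o h) ->
  mu.-integrable `[0, T] (EFin \o h).
Proof.
move=> /integrableP[mh ih]; apply/integrableP; split.
  exact/emeasurable_fun_itv_obnd_cbndP.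
by rewrite -integral_itv_obnd_cbnd//; exact: measurableT_comp.
Qed.

Lemma primE h : locL1 h -> prim h = fun x => parameterized_integral mu 0 x h.
Proof. by move=> ih; apply/funext => x; exact: Rintegral_itv_obnd_cbnd. Qed.

Lemma continuous_prim_itv h T : locL1 h -> 0 <= T ->
  {within `[0, T], continuous (prim h)}.
Proof.
move=> ih T0; rewrite primE//; apply: parameterized_integral_continuous => //.
exact: integrable_itv_cbnd.
Qed.

Lemma continuous_prim h : locL1 h -> {within `[0, +oo[, continuous (prim h)}.
Proof.
move=> ih; apply/continuous_within_itvcyP; split.
  move=> x; rewrite in_itv/= andbT => x0.
  have x1 : 0 < x + 1 by rewrite addr_gt0.
  have /(continuous_within_itvP _ x1)[+ _ _] := continuous_prim_itv ih (ltW x1).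
  by apply; rewrite in_itv/= x0 ltrDl ltr01.
have /(continuous_within_itvP _ ltr01)[_ + _] := continuous_prim_itv ih ler01.
by [].
Qed.

Lemma prim_bound h x T : locL1 h -> x <= T ->
  `|prim h x| <= prim (fun t => `|h t|) T.
Proof.
move=> ih xT; rewrite /prim (le_trans (le_normr_Rintegral _ _))//.
rewrite -lee_fin /Rintegral !fineK; first last.
- by apply: integrable_fin_num => //; exact: (integrable_norm (ih _)).
- by apply: integrable_fin_num => //; exact: (integrable_norm (ih _)).
apply: ge0_subset_integral => //.
  by apply: (measurable_int mu); exact: (integrable_norm (ih _)).
by apply: subset_itvl; rewrite bnd_simp.
Qed.

Lemma measurable_prim h : locL1 h -> measurable_fun Rpos (prim h).
Proof.
move=> ih; apply/measurable_fun_itv_obnd_cbndP.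
by apply: subspace_continuous_measurable_fun => //; exact: continuous_prim.
Qed.

Lemma locL1M h k : locL1 h -> measurable_fun Rpos k ->
  (forall T, exists M, forall x, 0 < x <= T -> `|k x| <= M) ->
  locL1 (fun t => h t * k t).
Proof.
move=> ih mk bk T.
apply: (@integrableMl _ _ _ mu `]0, T]%classic _ (EFin \o h) k) => //.
  by apply: measurable_funS mk => //; apply: subset_itvl; rewrite bnd_simp.
have [M kM] := bk T; exists M; split; first exact: num_real.
move=> y My x /=; rewrite in_itv/= => xT.
by rewrite (le_trans (kM _ xT))// ltW.
Qed.

Lemma locL1_prim h k : locL1 h -> locL1 k -> locL1 (fun t => h t * prim k t).
Proof.
move=> ih ik; apply: locL1M => //; first exact: measurable_prim.
by move=> T; exists (prim (fun t => `|k t|) T) => x /andP[_]; exact: prim_bound.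
Qed.

End AbsolutelyContinuous.

(** * Product rule for absolutely continuous functions *)

Section Product.
Context {R : realType}.
Implicit Types (f g h k : R -> R) (x T : R).
Local Notation mu := (@lebesgue_measure R).
Local Notation Rpos := (`]0, +oo[%classic : set R).

(* Fubini's theorem for [h s * k t] on the triangle [0 < t <= s <= x]. *)
Lemma prim_mul h k x : locL1 h -> locL1 k ->
  prim (fun t => h t * prim k t) x + prim (fun t => k t * prim h t) x =
  prim h x * prim k x.
Proof.
move=> ih ik; set D := (`]0, x]%classic : set R).
have mD : measurable (D : set (measurableTypeR R)) by exact: measurable_itv.
have ihD : mu.-integrable setT (EFin \o (h \_ D)).
  by have /(integrable_mkcond _ mD) := ih x; rewrite restrict_EFin.
have ikD : mu.-integrable setT (EFin \o (k \_ D)).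
  by have /(integrable_mkcond _ mD) := ik x; rewrite restrict_EFin.
have mhD : measurable_fun setT (h \_ D) by apply/measurable_EFinP; case/integrableP : ihD.
have mkD : measurable_fun setT (k \_ D) by apply/measurable_EFinP; case/integrableP : ikD.
pose F (p : measurableTypeR R * measurableTypeR R) :=
  (if p.2 <= p.1 then (h \_ D) p.1 * (k \_ D) p.2 else 0)%:E.
have mF : measurable_fun setT F.
  apply/measurable_EFinP; apply: measurable_fun_ifT => //.
    by apply: measurable_fun_ler; [exact: measurable_snd|exact: measurable_fst].
  apply: measurable_funM; apply: measurableT_comp => //.
have iF : (mu \x mu)%E.-integrable setT F.
  apply/integrable12ltyP => //.
  apply: (@le_lt_trans _ _ (\int[mu]_s (`|(h \_ D) s|%:E * \int[mu]_t `|(k \_ D) t|%:E))%E).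
    apply: ge0_le_integral => //.
    - by move=> s _; exact: integral_ge0.
    - apply: (@measurable_fun_fubini_tonelli_F _ _ _ _ _ mu (abse \o F)) => //.
        exact: measurableT_comp.
      by move=> p; exact: abse_ge0.
    - apply: emeasurable_funM => //; apply/measurable_EFinP.
      exact: measurableT_comp.
    move=> s _; rewrite -ge0_integralZl//; last first.
      by apply/measurable_EFinP; exact: measurableT_comp.
    apply: ge0_le_integral => //.
    - apply: measurableT_comp => //.
      exact: measurable_fun_pair2 mF.
    - apply: emeasurable_funM => //; apply/measurable_EFinP.
      exact: measurableT_comp.
    move=> t _; rewrite /F /= lee_fin; case: ifP => _; first by rewrite normrM.
    by rewrite normr0 mulr_ge0.
  rewrite ge0_integralZr//; last 2 first.
    by apply/measurable_EFinP; exact: measurableT_comp.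
    exact: integral_ge0.
  rewrite lte_mul_pinfty//; first exact: integral_ge0.
    rewrite ge0_fin_numE; last exact: integral_ge0.
    by have /integrableP[] := ihD.
  by have /integrableP[] := ikD.
have := Fubini iF.
have -> : (\int[mu]_s \int[mu]_t F (s, t) = (prim (fun t => h t * prim k t) x)%:E)%E.
  rewrite /prim /Rintegral fineK; last first.
    by apply: integrable_fin_num => //; exact: (locL1_prim ih ik).
  rewrite [RHS]integral_mkcond; apply: eq_integral => s _.
  rewrite patchE; case: ifPn => sD; last first.
    rewrite integral0_eq// => t _; rewrite /F /= (patchE _ D s) (negbTE sD) mul0r.
    by case: ifP.
  have sx : s <= x by move: sD; rewrite inE /D /= in_itv/= => /andP[].
  rewrite EFinM fineK; last by apply: integrable_fin_num => //; exact: (ik s).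
  rewrite -integralZl//.
  rewrite [RHS]integral_mkcond; apply: eq_integral => t _.
  rewrite /F /= !patchE sD !mem_setE /D /= !in_itv/=; case: (leP t s) => ts.
    rewrite andbT (le_trans ts sx) andbT; case: ifP => //; by rewrite mulr0.
  by rewrite andbF.
(* In the other order, integrating in [s] first leaves the mass of [h] on []t, x]], that is
   [prim h x - prim h t]; the term [prim h x] produces the product on the right-hand side. *)
have -> : (\int[mu]_t \int[mu]_s F (s, t) = (prim (fun t => k t * (prim h x - prim h t)) x)%:E)%E.
  have ikh : locL1 (fun t => k t * (prim h x - prim h t)).
    have := locL1D (locL1Z (prim h x) ik) (locL1Z (-1) (locL1_prim ik ih)).
    rewrite (_ : (fun t => _) = (fun t => k t * (prim h x - prim h t)))//.
    by apply/funext => t; ring.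
  rewrite /prim -/(prim _ _) /Rintegral fineK; last first.
    by apply: integrable_fin_num => //; exact: ikh.
  rewrite [RHS]integral_mkcond; apply: eq_integral => t _.
  rewrite patchE; case: ifPn => tD; last first.
    rewrite integral0_eq// => s _; rewrite /F /= (patchE _ D t) (negbTE tD) mulr0.
    by case: ifP.
  have /andP[t0 tx] : 0 < t <= x by move: tD; rewrite inE.
  rewrite -[fine _]/(prim h x) -[fine (integral _ _ _)]/(prim h t).
  rewrite (_ : prim h x - prim h t = \int[mu]_(s in `]t, x]) h s); last first.
    by rewrite /prim Rintegral_itvB// ?bnd_simp// ltW.
  have ihtx : mu.-integrable `]t, x] (EFin \o h).
    by apply: integrableS (ih x) => //; apply: subset_itvr; rewrite bnd_simp ltW.
  rewrite Rintegral_itv_obnd_cbnd//.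
  have ihtx' : mu.-integrable `[t, x] (EFin \o h).
    by apply: integrableS (ih x) => //; apply: subset_itvr; rewrite bnd_simp.
  rewrite EFinM fineK; last exact: integrable_fin_num.
  rewrite -integralZl//.
  rewrite [RHS]integral_mkcond; apply: eq_integral => s _.
  rewrite /F /= !patchE tD !mem_setE /D /= !in_itv/=; case: (leP t s) => ts /=.
    rewrite (lt_le_trans t0 ts) /=; case: ifP => //; rewrite ?mul0r// => _.
    by rewrite mulrC.
  by [].
move=> [->].
transitivity (prim (fun t => prim h x * k t) x); last by rewrite primZ.
rewrite -primD//; last exact: locL1_prim.
  by congr prim; apply/funext => t; ring.
have := locL1D (locL1Z (prim h x) ik) (locL1Z (-1) (locL1_prim ik ih)).
rewrite (_ : (fun t => _) = (fun t => k t * (prim h x - prim h t)))//.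
by apply/funext => t; ring.
Qed.

Lemma ac_locL1M f h k : ac f h -> locL1 k -> locL1 (fun t => k t * f t).
Proof.
move=> [ih fE] ik.
have := locL1D (locL1Z (f 0) ik) (locL1_prim ik ih) => H T.
apply: eq_integrable (H T) => //= t; rewrite inE/= in_itv/= => /andP[t0 _].
by rewrite [in RHS]fE ?(ltW t0)//=; congr EFin; ring.
Qed.

Lemma eq_prim h k x : (forall t, 0 < t -> h t = k t) -> prim h x = prim k x.
Proof.
by move=> hk; apply: eq_Rintegral => t; rewrite inE/= in_itv/= => /andP[/hk].
Qed.

(** Writing each factor as its value at 0 plus a primitive leaves only a product of two primitives,
    which [prim_mul] evaluates. No pointwise derivative is involved. *)
Lemma acM f g h k : ac f h -> ac g k ->
  ac (fun t => f t * g t) (fun t => h t * g t + k t * f t).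
Proof.
move=> af ag; have [ih fE] := af; have [ik gE] := ag.
split; first by apply: locL1D; apply: ac_locL1M; eassumption.
move=> x x0.
rewrite (@eq_prim _ (fun t => (g 0 * h t + f 0 * k t) +
    (h t * prim k t + k t * prim h t))); last first.
  by move=> t t0; rewrite (gE t) ?(fE t) ?ltW//; ring.
have ? := locL1_prim ih ik; have ? := locL1_prim ik ih.
have ? := locL1Z (g 0) ih; have ? := locL1Z (f 0) ik.
rewrite primD; [|exact: locL1D..].
rewrite (primD x (locL1Z (g 0) ih))// !primZ// primD// prim_mul//.
by rewrite (fE x)// (gE x)//; ring.
Qed.

Lemma ac_cst (c : R) : ac (fun=> c) (fun=> 0).
Proof.
split; first exact: locL1_0.
by move=> x x0; rewrite /prim Rintegral_cst//= mul0r addr0.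
Qed.

Lemma acD f g h k : ac f h -> ac g k ->
  ac (fun t => f t + g t) (fun t => h t + k t).
Proof.
move=> [ih fE] [ik gE]; split; first exact: locL1D.
by move=> x x0; rewrite primD// (fE x)// (gE x)//; ring.
Qed.

Lemma acZ (r : R) f h : ac f h -> ac (fun t => r * f t) (fun t => r * h t).
Proof.
move=> [ih fE]; split; first exact: locL1Z.
by move=> x x0; rewrite primZ// (fE x)//; ring.
Qed.

Lemma ac_prim (c : R) h : locL1 h -> ac (fun t => c + prim h t) h.
Proof. by move=> ih; split => // x x0; rewrite prim0 addr0. Qed.

Lemma continuous_ac f h : ac f h -> {within `[0, +oo[, continuous f}.
Proof.
move=> [ih fE].
have : {within `[0, +oo[, continuous (fun x => f 0 + prim h x)}.
  by move=> x; apply: cvgD; [exact: cvg_cst|exact: continuous_prim].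
apply: subspace_eq_continuous => x; rewrite inE/= in_itv/= andbT => x0.
by apply/esym; exact: fE.
Qed.

Lemma measurable_ac f h : ac f h -> measurable_fun Rpos f.
Proof.
move=> af; apply/measurable_fun_itv_obnd_cbndP.
by apply: subspace_continuous_measurable_fun => //; exact: continuous_ac af.
Qed.

Lemma ac_C1 f : (forall x, derivable f x 1) -> continuous (f^`())%classic -> ac f (f^`())%classic.
Proof.
move=> df cf.
have cf0 : continuous f.
  by move=> x; apply/differentiable_continuous/derivable1_diffP.
have icf T : mu.-integrable `[0, T] (EFin \o (f^`())%classic).
  apply: continuous_compact_integrable; first exact: segment_compact.
  exact: continuous_subspaceT.
split.
  move=> T; apply: integrableS (icf T) => //.
  by apply: subset_itvr; rewrite bnd_simp.
move=> x; rewrite le_eqVlt => /predU1P[<-|x0]; first by rewrite prim0 addr0.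
rewrite /prim Rintegral_itv_obnd_cbnd; last first.
  apply: integrableS (icf x) => //.
  by apply: subset_itvr; rewrite bnd_simp.
have FTC : (\int[mu]_(t in `[0%R, x]) ((f^`())%classic t)%:E = (f x)%:E - (f 0)%:E)%E.
  apply: (continuous_FTC2 x0 (continuous_subspaceT cf)); last by move=> t _.
  split; [by move=> t _|exact/cvg_at_right_filter/cf0|].
  exact/cvg_at_left_filter/cf0.
by rewrite /Rintegral FTC -EFinB /= addrCA subrr addr0.
Qed.

End Product.

(** * Test functions and the lemma of du Bois-Reymond *)

Section Bump.
Context {R : realType}.
Implicit Types (f g h k phi psi : R -> R) (x y t c d : R) (p q : {poly R}).

(* Derivatives of [exp (- 1 / t)] are polynomials in [1 / t] times itself. *)
Definition flat p t : R := if 0 < t then p.[t^-1] * expR (- t^-1) else 0.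

(** Each monomial satisfies [y ^+ i <= i! * expR y], so the absolute values of the coefficients
    weighted by factorials give [M]. *)
Lemma horner_expRN_bound p : exists M : R, forall y, 0 <= y ->
  `|p.[y]| * expR (- y) <= M.
Proof.
exists (\sum_(i < size p) `|p`_i| * (i`!)%:R) => y y0.
rewrite horner_coef expRN ler_pdivrMr ?expR_gt0// mulr_suml.
apply: (le_trans (ler_norm_sum _ _ _)); apply: ler_sum => i _.
rewrite normrM (ger0_norm (exprn_ge0 _ y0)) -mulrA ler_wpM2l//.
rewrite mulrC -ler_pdivrMr ?ltr0n ?fact_gt0//.
case: (nat_of_ord i) => [|n]; first by rewrite expr0 fact0 divr1 -expR0 ler_expR.
by apply: le_trans (expR_ge1Dxn n y0); rewrite lerDr.
Qed.

(** For [t > 0], the chain rule in [y = 1 / t] gives [- y^2 p'(y) + y^2 p(y)] in front of the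
    exponential. Only the point 0 needs an estimate. *)
Lemma is_derive_flat p t :
  is_derive t 1 (flat p) (flat ('X^2 * (p - p^`())) t).
Proof.
have [t0|t0|->] := ltrgt0P t.
- have tN0 : t != 0 by rewrite gt_eqF.
  apply: (@near_eq_is_derive _ _ _ (fun t => p.[t^-1] * expR (- t^-1))).
    near=> s; rewrite /flat ifT//.
    by near: s; exact: lt_nbhsr.
  have dV : is_derive t 1 (fun t : R => t^-1) (- t ^- 2).
    apply: is_derive_eq; first exact: is_deriveV.
    by rewrite /GRing.scale /= mulr1.
  have dp : is_derive t 1 (fun t : R => p.[t^-1]) (p^`().[t^-1] * - t ^- 2).
    exact: (@is_derive1_comp _ (horner p) (fun t : R => t^-1)).
  have de : is_derive t 1 (fun t : R => expR (- t^-1)) (expR (- t^-1) * t ^- 2).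
    have := @is_derive1_comp _ expR (fun t : R => - t^-1) t _ _
      (is_derive_expR _) (is_deriveN dV).
    by rewrite opprK.
  apply: (is_derive_eq (is_deriveM dp de)).
  rewrite /flat t0 !hornerE /GRing.scale /= !exprVn; ring.
- apply: (@near_eq_is_derive _ _ _ (cst 0)).
    near=> s; rewrite /flat ifF//; apply/negbTE; rewrite -leNgt.
    by apply: ltW; near: s; exact: lt_nbhsl.
  rewrite /flat ltNge (ltW t0) /=; exact: is_derive_cst.
rewrite [flat _ 0]/flat ltxx.
(* The extra factor ['X^2] rewrites the difference quotient [h^-1 p(h^-1) exp(- h^-1)] as [h] times
   a quantity bounded by [M]. *)
have [M HM] := horner_expRN_bound (p * 'X^2).
have M0 : 0 <= M by apply: le_trans (HM 0 (lexx _)); rewrite mulr_ge0// expR_ge0.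
have lim0 : h^-1 *: (flat p (h + 0) - flat p 0) @[h --> 0^'] --> (0 : R).
  apply/cvgr0Pnorm_le => e e0; near=> h.
  rewrite addr0 /flat ltxx subr0 /GRing.scale /=.
  case: ifPn => h0; last by rewrite mulr0 normr0 ltW.
  have hV0 : 0 <= h^-1 by rewrite invr_ge0 ltW.
  have := HM _ hV0; rewrite hornerM hornerXn normrM (ger0_norm (exprn_ge0 _ hV0)) => HMh.
  rewrite !normrM (ger0_norm hV0) (ger0_norm (expR_ge0 _)).
  rewrite (_ : _ * _ = h * (`|p.[h^-1]| * h^-1 ^+ 2 * expR (- h^-1))); last first.
    by field; rewrite gt_eqF.
  apply: (@le_trans _ _ (h * M)); first by rewrite ler_wpM2l// ltW.
  apply: (@le_trans _ _ (h * (M + 1))); first by rewrite ler_wpM2l ?lerDl// ltW.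
  rewrite -ler_pdivlMr ?ltr_wpDl//.
  have : `|h| <= e / (M + 1).
    near: h; apply: dnbhs0_le; rewrite divr_gt0// ltr_wpDl//.
  by rewrite gtr0_norm.
have H : h^-1 *: (flat p (h *: 1 + 0) - flat p 0) @[h --> 0^'] --> (0 : R).
  rewrite (_ : (fun r : R => _) = (fun r : R => r^-1 *: (flat p (r + 0) - flat p 0)))//.
  by apply/funext => r; rewrite [r *: 1]mulr1.
apply: DeriveDef; first by apply/cvg_ex; exists 0.
exact/cvg_lim.
Unshelve. all: by end_near. Qed.

Definition smooth phi := forall n x, derivable (phi^`(n))%classic x 1.

(** A class containing every bump that is needed and stable under differentiation, so that one
    derivative yields smoothness of all orders by induction. *)
Inductive flat_alg : (R -> R) -> Prop :=
| flat_base p c d : flat_alg (fun t => flat p (c * t + d))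
| flat_add f g : flat_alg f -> flat_alg g -> flat_alg (fun t => f t + g t)
| flat_scale c f : flat_alg f -> flat_alg (fun t => c * f t)
| flat_mul f g : flat_alg f -> flat_alg g -> flat_alg (fun t => f t * g t).

Lemma flat_alg_derive f : flat_alg f ->
  exists2 g, flat_alg g & forall t, is_derive t 1 f (g t).
Proof.
elim => {f} [p c d|f g _ [f' af df] _ [g' ag dg]|c f _ [f' af df]
            |f g af0 [f' af df] ag0 [g' ag dg]].
- exists (fun t => flat ('X^2 * (p - p^`())) (c * t + d) * c).
    rewrite (_ : (fun t => _) = fun t => c * flat ('X^2 * (p - p^`())) (c * t + d)).
      exact/flat_scale/flat_base.
    by apply/funext => t; rewrite mulrC.
  move=> t; apply: (@is_derive1_comp _ (flat p) (fun t => c * t + d)); first exact: is_derive_flat.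
  have := is_deriveD (is_deriveZ c (is_derive_id t (1 : R))) (is_derive_cst d t 1).
  by rewrite addr0 /GRing.scale /= mulr1.
- by exists (fun t => f' t + g' t) => [|t]; [exact: flat_add|exact: (is_deriveD (df t) (dg t))].
- by exists (fun t => c * f' t) => [|t]; [exact: flat_scale|exact: (is_deriveZ c (df t))].
- exists (fun t => f t * g' t + g t * f' t) => [|t]; last exact: (is_deriveM (df t) (dg t)).
  by apply: flat_add; exact: flat_mul.
Qed.

Lemma flat_alg_derive1 f : flat_alg f ->
  (forall t, derivable f t 1) /\ flat_alg (f^`())%classic.
Proof.
move=> /flat_alg_derive[g ag df]; split; first by move=> t; have [] := df t.
rewrite (_ : (f^`())%classic = g)//; apply/funext => t.
by rewrite derive1E; have [_] := df t.
Qed.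

Lemma flat_alg_smooth f : flat_alg f -> smooth f.
Proof.
move=> af n; elim: n f af => [|n IH] f /flat_alg_derive1[df af'] x.
  exact: df.
by rewrite derive1Sn; exact: IH.
Qed.

End Bump.

(** * Smooth bumps and test functions with zero mean *)

Section ZeroMeanTestFunctions.
Context {R : realType}.
Implicit Types (f g h k phi psi : R -> R) (x y t a b c d : R).
Local Notation mu := (@lebesgue_measure R).
Local Notation Rpos := (`]0, +oo[%classic : set R).

(** On []a, b[] this is [exp(- 1 / ((n + 1)(t - a))) exp(- 1 / ((n + 1)(b - t)))]. There is no
    plateau; instead both factors tend to 1 as [n] grows, so the bumps tend to the indicator
    function of []a, b[]. *)
Definition smooth_bump (n : nat) a b t : R :=
  flat 1 (n.+1%:R * t + - (n.+1%:R * a)) * flat 1 (- n.+1%:R * t + n.+1%:R * b).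

Lemma flat_alg_bump n a b : flat_alg (smooth_bump n a b).
Proof. by apply: flat_mul; exact: flat_base. Qed.

Lemma flat1_ge0 t : 0 <= flat 1 t.
Proof. by rewrite /flat; case: ifP => // _; rewrite hornerC mul1r expR_ge0. Qed.

Lemma flat1_le1 t : flat 1 t <= 1.
Proof.
rewrite /flat; case: ifP => // t0; rewrite hornerC mul1r expR_le1.
by rewrite oppr_le0 invr_ge0 ltW.
Qed.

Lemma bump_ge0 n a b t : 0 <= smooth_bump n a b t.
Proof. by rewrite mulr_ge0 ?flat1_ge0. Qed.

Lemma bump_le1 n a b t : smooth_bump n a b t <= 1.
Proof. by rewrite mulr_ile1 ?flat1_ge0 ?flat1_le1. Qed.

Lemma bump_out n a b t : ~ (`]a, b[%classic : set R) t -> smooth_bump n a b t = 0.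
Proof.
move=> /= /negP; rewrite in_itv/= negb_and -!leNgt /smooth_bump => /orP[ta|bt].
  rewrite /flat ifF ?mul0r//; apply/negbTE; rewrite -leNgt -mulrBr.
  by rewrite pmulr_rle0 ?subr_le0.
rewrite [X in _ * X]/flat ifF ?mulr0//; apply/negbTE; rewrite -leNgt.
by rewrite mulNr addrC -mulrBr pmulr_rle0 ?subr_le0.
Qed.

Lemma cvg_flat1 t : 0 < t -> flat 1 (n.+1%:R * t) @[n --> \oo] --> (1 : R).
Proof.
move=> t0.
have -> : (fun n : nat => flat 1 (n.+1%:R * t)) =
          (fun n : nat => expR (- (t^-1 * (n.+1%:R)^-1))).
  apply/funext => n; rewrite /flat pmulr_rgt0// t0 hornerC mul1r invfM.
  by rewrite mulrC.
rewrite -[X in _ --> X]expR0; apply: continuous_cvg; first exact: continuous_expR.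
rewrite -[X in _ --> X]oppr0; apply: cvgN; rewrite -[X in _ --> X](mulr0 t^-1).
by apply: cvgMl_tmp; exact: cvg_harmonic.
Qed.

Lemma cvg_bump a b t : a < t < b -> smooth_bump n a b t @[n --> \oo] --> (1 : R).
Proof.
move=> /andP[ta tb]; rewrite -[X in _ --> X](mulr1 1).
have -> : (fun n : nat => smooth_bump n a b t) =
    (fun n : nat => flat 1 (n.+1%:R * (t - a)) * flat 1 (n.+1%:R * (b - t))).
  by apply/funext => n; rewrite /smooth_bump; congr (flat 1 _ * flat 1 _); ring.
by apply: cvgM; apply: cvg_flat1; rewrite subr_gt0.
Qed.

Lemma smooth_continuous phi : smooth phi -> continuous phi.
Proof.
by move=> s x; apply/differentiable_continuous/derivable1_diffP; exact: (s 0%N).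
Qed.

(** The primitive from minus infinity vanishes to the left of [a] because [psi] does, and to the
    right of [b] because the mean is zero. *)
Lemma test_antiderivative psi a b : 0 < a -> a < b -> smooth psi ->
  (forall t, ~ (`]a, b[%classic : set R) t -> psi t = 0) ->
  \int[mu]_(t in Rpos) psi t = 0 ->
  exists2 phi, test_function phi & (phi^`())%classic = psi.
Proof.
move=> a0 ab spsi psi0 ipsi.
have cpsi := smooth_continuous spsi.
have iab : mu.-integrable `[a, b] (EFin \o psi).
  apply: continuous_compact_integrable; first exact: segment_compact.
  exact: continuous_subspaceT.
have iT : mu.-integrable setT (EFin \o psi).
  have : mu.-integrable setT ((EFin \o psi) \_ `[a, b]).
    by have /(@integrable_mkcond _ _ _ mu) := iab; apply; exact: measurable_itv.
  apply: eq_integrable => // t _; rewrite patchE; case: ifPn => // tab.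
  rewrite /= psi0//; move/negP: tab; apply: contra_not => /=.
  by rewrite mem_setE in_itv /= => /andP[? ?]; rewrite in_itv/= !ltW.
pose phi x := \int[mu]_(t in `]-oo, x]) psi t.
have dphi x : derivable phi x 1 /\ (phi^`())%classic x = psi x.
  apply: (@continuous_FTC1 _ psi -oo%O x (x + 1)) => //; first by rewrite ltrDl.
    by apply: integrableS iT.
    by rewrite ltNyr.
  exact: (cpsi x).
have dphi1 : (phi^`())%classic = psi by apply/funext => x; have [] := dphi x.
exists phi => //; split.
  case=> [|n] x; first by have [] := dphi x.
  by rewrite derive1Sn dphi1; exact: spsi.
exists (`[a, b]%classic : set R); split; first exact: segment_compact.
  by move=> t /=; rewrite !in_itv/= andbT => /andP[at_ _]; exact: lt_le_trans at_.
move=> x /= /negP; rewrite in_itv/= negb_and -!ltNge /phi => /orP[xa|bx].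
  rewrite /Rintegral integral0_eq// => t /=; rewrite in_itv/= => tx.
  rewrite psi0//= in_itv/= => /andP[at_ _].
  by move: (lt_trans at_ (le_lt_trans tx xa)); rewrite ltxx.
rewrite -[RHS]ipsi [in LHS]Rintegral_mkcond [in RHS]Rintegral_mkcond.
apply: eq_Rintegral => t _; rewrite !patchE !mem_setE !in_itv/= andbT.
have [atb|] := boolP (a < t < b).
  move/andP: atb => [at_ tb].
  by rewrite (ltW (lt_trans tb bx)) (lt_trans a0 at_).
move=> /negP natb; have -> : psi t = 0 by apply: psi0; rewrite /= in_itv.
by case: ifP; case: ifP.
Qed.

End ZeroMeanTestFunctions.

(** * The lemma of du Bois-Reymond *)

Section DuBoisReymond.
Context {R : realType}.
Implicit Types (f g h k phi psi : R -> R) (x y t a b c d : R).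
Local Notation mu := (@lebesgue_measure R).
Local Notation Rpos := (`]0, +oo[%classic : set R).

Lemma Rintegral_support (A D : set R) h : A `<=` D ->
  (forall t, ~ A t -> h t = 0) ->
  \int[mu]_(t in D) h t = \int[mu]_(t in A) h t.
Proof.
move=> AD h0; rewrite [in LHS]Rintegral_mkcond [in RHS]Rintegral_mkcond.
apply: eq_Rintegral => t _; rewrite !patchE.
case: ifPn => tD; case: ifPn => tA //.
  by rewrite h0//; move: tA; rewrite notin_setE.
by move: tA tD; rewrite inE notin_setE => /AD.
Qed.

Lemma locally_integrable_itv f a b : locally_integrable Rpos f -> 0 < a ->
  mu.-integrable `[a, b] (EFin \o f).
Proof.
move=> [mf _ foo] a0.
have sub : `[a, b]%classic `<=` Rpos.
  by move=> t /=; rewrite !in_itv/= andbT => /andP[+ _]; exact: lt_le_trans.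
apply/integrableP; split; first by apply/measurable_EFinP; exact: measurable_funS mf.
by apply: foo => //; exact: segment_compact.
Qed.

Lemma cvg_bump_integral f a b : locally_integrable Rpos f -> 0 < a ->
  \int[mu]_(t in Rpos) (smooth_bump n a b t * f t) @[n --> \oo] -->
  \int[mu]_(t in `]a, b[) f t.
Proof.
move=> lf a0.
have ifab : mu.-integrable `]a, b[ (EFin \o f).
  apply: integrableS (locally_integrable_itv b lf a0) => //.
  exact: subset_itv_oo_cc.
have mfab : measurable_fun `]a, b[ f.
  by apply/measurable_EFinP; case/integrableP : ifab.
have -> : (fun n => \int[mu]_(t in Rpos) (smooth_bump n a b t * f t)) =
    (fun n => \int[mu]_(t in `]a, b[) (smooth_bump n a b t * f t)).
  apply/funext => n; apply: Rintegral_support.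
    by move=> t /=; rewrite !in_itv/= andbT => /andP[+ _]; exact: lt_trans.
  by move=> t tab; rewrite bump_out// mul0r.
have mb n : measurable_fun `]a, b[ (smooth_bump n a b).
  apply: measurable_funTS; apply: continuous_measurable_fun.
  by apply: smooth_continuous; apply: flat_alg_smooth; exact: flat_alg_bump.
have [||||| _ _ H] := @dominated_convergence _ _ _ mu `]a, b[%classic (measurable_itv _)
  (fun n t => (smooth_bump n a b t * f t)%:E) (EFin \o f) (fun t => `|f t|%:E).
- by move=> n; apply/measurable_EFinP; apply: measurable_funM; [exact: mb|exact: mfab].
- exact/measurable_EFinP.
- apply: aeW => t tab; apply: cvg_EFin; first exact: nearW.
  rewrite -[X in _ --> X]mul1r; apply: cvgMr_tmp; apply: cvg_bump.
  by move: tab; rewrite /= in_itv.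
- exact: integrable_norm.
- apply: aeW => t n _ /=; rewrite lee_fin normrM ger0_norm ?bump_ge0//.
  by rewrite ler_piMl// bump_le1.
apply: fine_cvg; rewrite fineK; last exact: integrable_fin_num.
exact: H.
Qed.

Lemma locally_integrable_cst c : locally_integrable Rpos (cst c).
Proof.
split; [exact: measurable_cst|exact: interval_open|move=> K _ cK].
have mK : measurable (K : set (measurableTypeR R)) by exact: compact_measurable.
rewrite [X in (X < _)%E](_ : _ = \int[mu]_(x in K) (cst (`|c|%:E) x))%E// integral_cst//.
by rewrite lte_mul_pinfty// compact_finite_measure.
Qed.

Lemma integrable_bump f n a b : locally_integrable Rpos f -> 0 < a ->
  mu.-integrable Rpos (EFin \o (fun t => smooth_bump n a b t * f t)).
Proof.
move=> lf a0; apply: (@integrable_test _ _ _ (`[a, b]%classic)) => //.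
- by apply: smooth_continuous; apply: flat_alg_smooth; exact: flat_alg_bump.
- exact: segment_compact.
- by move=> t /=; rewrite !in_itv/= andbT => /andP[+ _]; exact: lt_le_trans.
- move=> t tab; apply: bump_out; apply: contra_not tab; exact: subset_itv_oo_cc.
Qed.

(** The primitive of [f] cut to a compact interval is constant inside that interval, while by
    Lebesgue differentiation its derivative is [f] almost everywhere. Countably many intervals []1 /
    (m + 2), m + 2[] exhaust the half-line. *)
Lemma zero_integrals_ae f : locally_integrable Rpos f ->
  (forall a b, 0 < a -> a < b -> \int[mu]_(t in `]a, b[) f t = 0) ->
  ae_eq mu Rpos f (cst 0).
Proof.
move=> lf f0.
have H (m : nat) : {ae mu, forall x, m.+2%:R^-1 < x < m.+2%:R -> f x = 0}.
  pose a : R := m.+2%:R^-1; pose b : R := m.+2%:R.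
  have a0 : 0 < a by rewrite invr_gt0.
  pose g := f \_ `[a, b].
  have iab := locally_integrable_itv b lf a0.
  have ig : mu.-integrable setT (EFin \o g).
    by rewrite -restrict_EFin; have /(@integrable_mkcond _ _ _ mu) := iab; apply; exact: measurable_itv.
  have lg : locally_integrable setT g by exact: integrable_locally.
  have iy y : mu.-integrable [set` Interval -oo%O (BRight y)] (EFin \o g).
    exact: integrableS ig.
  have := FTC1 iy lg; apply: filterS; first exact: (ae_filter_ringOfSetsType mu).
  move=> x /(_ (ltNyr _)) [_ Fx] /andP[ax xb].
  have <- : g x = f x by rewrite /g patchE mem_set//= in_itv/= !ltW.
  rewrite -Fx.
  rewrite derive1E (@near_eq_derive _ _ _ _ (cst 0)) ?derive_cst//.
  near=> y.
  have ay : a < y by near: y; exact: lt_nbhsr.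
  have yb : y < b by near: y; exact: lt_nbhsl.
  rewrite -Rintegral_mkcondr (_ : _ `&` _ = `[a, y]%classic); last first.
    apply/seteqP; split => t /=; rewrite !in_itv/=; first by case=> -> /andP[->].
    by move=> /andP[-> ty]; rewrite ty (le_trans ty (ltW yb)).
  have sub : `[a, y] `<=` `[a, b] by apply: subset_itvl; rewrite bnd_simp ltW.
  rewrite -Rintegral_itv_obnd_cbnd; last first.
    apply: integrableS iab => //; apply: subset_trans sub.
    by apply: subset_itvr; rewrite bnd_simp.
  rewrite -Rintegral_itv_bndo_bndc ?f0//.
  apply: integrableS iab => //; apply: subset_trans sub.
  exact: subset_itv_oo_cc.
apply: (filterS _ (ae_foralln H)) => x Hx /=; rewrite in_itv/= andbT => x0.
(* Bounding the sum [x + x^-1] by [m + 2] controls both ends of the interval at once. *)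
pose m := (Num.truncn (x + x^-1)).
have xm : x + x^-1 < m.+2%:R.
  by rewrite (lt_trans (truncnS_gt _))// ltr_nat.
have xV0 : 0 < x^-1 by rewrite invr_gt0.
apply: (Hx m); rewrite (lt_trans _ xm) ?ltrDl// andbT.
by rewrite invf_plt ?posrE// (lt_trans _ xm)// ltrDr.
Unshelve. all: by end_near. Qed.

(** The integral of [f] over an interval turns out proportional to its length ([key]). The interval
    []1, 2[] serves as reference since its length is 1, so the constant is the integral of [f] over
    it, and [f] minus this constant has zero integral on every bounded interval away from 0. *)
Lemma du_bois_reymond f : locally_integrable Rpos f ->
  (forall phi, test_function phi ->
     \int[mu]_(t in Rpos) ((phi^`())%classic t * f t) = 0) ->
  exists c, ae_eq mu Rpos f (cst c).
Proof.
move=> lf f0.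
have key a b : 0 < a -> a < b ->
    \int[mu]_(t in `]a, b[) f t = (b - a) * \int[mu]_(t in `]1, 2[) f t.
  move=> a0 ab.
  pose I n c d := \int[mu]_(t in Rpos) (smooth_bump n c d t * cst 1 t).
  pose J n c d := \int[mu]_(t in Rpos) (smooth_bump n c d t * f t).
  have l1 := locally_integrable_cst 1.
  have IJ n : I n 1 2 * J n a b = I n a b * J n 1 2.
    (* The combination of two bumps whose mean vanishes; it is therefore the derivative of a test
       function and the hypothesis applies to it. Letting [n] tend to infinity replaces the bumps by
       indicator functions. *)
    pose psi t := I n 1 2 * smooth_bump n a b t + - I n a b * smooth_bump n 1 2 t.
    have apsi : flat_alg psi.
      by apply: flat_add; apply: flat_scale; exact: flat_alg_bump.
    pose c := Num.min a 1; pose d := Num.max b 2.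
    have psi0 t : ~ (`]c, d[%classic : set R) t -> psi t = 0.
      move=> tcd; rewrite /psi !bump_out ?mulr0 ?addr0//.
        apply: contra_not tcd; rewrite /= !in_itv/= => /andP[t1 t2].
        by rewrite gt_min t1 orbT lt_max t2 orbT.
      apply: contra_not tcd; rewrite /= !in_itv/= => /andP[t1 t2].
      by rewrite gt_min t1 lt_max t2.
    have i1 c' d' : 0 < c' -> mu.-integrable Rpos (EFin \o smooth_bump n c' d').
      move=> c0; have := integrable_bump n d' l1 c0; apply: eq_integrable => //.
      by move=> t _ /=; rewrite mulr1.
    have lin (r s : R) g h : mu.-integrable Rpos (EFin \o g) ->
        mu.-integrable Rpos (EFin \o h) ->
        \int[mu]_(t in Rpos) (r * g t + s * h t) =
        r * \int[mu]_(t in Rpos) g t + s * \int[mu]_(t in Rpos) h t.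
      move=> ig ih; have mR : measurable (Rpos : set (measurableTypeR R)) by [].
      rewrite (RintegralD mR (integrableZl mR r ig) (integrableZl mR s ih)).
      by rewrite (RintegralZl r mR ig) (RintegralZl s mR ih).
    have I1 c' d' : I n c' d' = \int[mu]_(t in Rpos) smooth_bump n c' d' t.
      by apply: eq_Rintegral => t _; rewrite mulr1.
    have [|||||phi tphi dphi] := @test_antiderivative _ psi c d.
    - by rewrite lt_min a0 ltr01.
    - by rewrite gt_min !lt_max ab.
    - exact: flat_alg_smooth.
    - exact: psi0.
    - rewrite (lin _ _ _ _ (i1 a b a0) (i1 1 2 ltr01)) -!I1 mulrC mulNr.
      exact: subrr.
    have := f0 _ tphi; rewrite dphi.
    rewrite (_ : \int[mu]_(t in Rpos) _ = \int[mu]_(t in Rpos)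
       (I n 1 2 * (smooth_bump n a b t * f t) +
        - I n a b * (smooth_bump n 1 2 t * f t))); last first.
      by apply: eq_Rintegral => t _; rewrite /psi; ring.
    rewrite (lin _ _ _ _ (integrable_bump n b lf a0) (integrable_bump n 2 lf ltr01)).
    by move=> /eqP; rewrite mulNr subr_eq0 => /eqP.
  have vol c d : c < d -> \int[mu]_(t in `]c, d[) cst 1 t = d - c.
    move=> cd; rewrite Rintegral_cst//= lebesgue_measure_itv/= lte_fin cd.
    by rewrite -EFinD /= mul1r.
  have cI c d : 0 < c -> c < d -> I n c d @[n --> \oo] --> d - c.
    by move=> c0 cd; rewrite -vol//; exact: cvg_bump_integral.
  have cJ c d : 0 < c -> J n c d @[n --> \oo] --> \int[mu]_(t in `]c, d[) f t.
    by move=> c0; exact: cvg_bump_integral.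
  have l12 : (1 : R) < 2 by rewrite ltr1n.
  have L := cvgM (cI 1 2 ltr01 l12) (cJ a b a0).
  have L' := cvgM (cI a b a0 ab) (cJ 1 2 ltr01).
  have E : (fun n => I n 1 2) \* (fun n => J n a b) =
           (fun n => I n a b) \* (fun n => J n 1 2).
    by apply/funext => n; exact: IJ.
  rewrite E in L.
  have := cvg_unique (@Rhausdorff R) (L _) (L' _).
  by rewrite (_ : 2 - 1 = 1 :> R) ?mul1r; [exact|ring].
exists (\int[mu]_(t in `]1, 2[) f t); set c := Rintegral _ _ _ in key *.
have lfc : locally_integrable Rpos (f \- cst c).
  by apply: locally_integrableB => //; exact: locally_integrable_cst.
have f_c a b : 0 < a -> a < b -> \int[mu]_(t in `]a, b[) (f \- cst c) t = 0.
  move=> a0 ab; have sub := @subset_itv_oo_cc _ _ a b.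
  rewrite RintegralB//; first last.
  - apply: integrableS (locally_integrable_itv b (locally_integrable_cst c) a0) => //.
  - by apply: integrableS (locally_integrable_itv b lf a0).
  rewrite key// Rintegral_cst//= lebesgue_measure_itv/= lte_fin ab -EFinD/=.
  by rewrite mulrC subrr.
apply: (filterS _ (zero_integrals_ae lfc f_c)) => x H /H /eqP.
by rewrite subr_eq0 => /eqP.
Qed.

End DuBoisReymond.

(** * Vanishing at infinity *)

Section Tail.
Context {R : realType}.
Implicit Types (f g h k m : R -> R) (x y t a b c d T : R).
Local Notation mu := (@lebesgue_measure R).
Local Notation Rpos := (`]0, +oo[%classic : set R).

Lemma integrable_locL1 h : mu.-integrable Rpos (EFin \o h) -> locL1 h.
Proof.
by move=> ih T; apply: integrableS ih => //; apply: subset_itvl; rewrite bnd_simp.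
Qed.

Lemma cvg_prim h : mu.-integrable Rpos (EFin \o h) ->
  prim h n%:R @[n --> \oo] --> \int[mu]_(t in Rpos) h t.
Proof.
move=> ih.
have mh : measurable_fun Rpos h by apply/measurable_EFinP; case/integrableP : ih.
have sub n : `]0, n%:R]%classic `<=` Rpos by apply: subset_itvl; rewrite bnd_simp.
have [||||| _ _ H] := @dominated_convergence _ _ _ mu Rpos (measurable_itv _)
  (fun n => EFin \o (h \_ `]0, n%:R])) (EFin \o h) (fun t => `|h t|%:E).
- move=> n; apply/measurable_EFinP; apply/measurable_restrict => //.
  by apply: measurable_funS mh => //; exact: subIsetr.
- exact/measurable_EFinP.
- apply: aeW => t; rewrite /= in_itv/= andbT => t0; apply: cvg_near_cst.
  near=> n; rewrite /= patchE mem_set//= in_itv/= t0 /=.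
  near: n; exact: nbhs_infty_ger.
- exact: integrable_norm.
- apply: aeW => t n _ /=; rewrite lee_fin patchE; case: ifP => //.
  by rewrite normr0.
have -> : (fun n : nat => prim h n%:R) =
    fine \o (fun n : nat => integral mu Rpos (EFin \o (h \_ `]0, n%:R]))).
  apply/funext => n /=; rewrite -[RHS]/(Rintegral mu Rpos (h \_ `]0, n%:R])).
  by rewrite -Rintegral_mkcondr setIidr.
apply: fine_cvg; rewrite fineK; last exact: integrable_fin_num.
exact: H.
Unshelve. all: by end_near. Qed.

(** Since [h] is integrable, [m] has the limit [l] at infinity, and an integrable function cannot
    have a nonzero limit. *)
Lemma ac_vanish m h : ac m h -> mu.-integrable Rpos (EFin \o m) ->
  mu.-integrable Rpos (EFin \o h) -> m 0 = - \int[mu]_(t in Rpos) h t.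
Proof.
move=> am im ih; have [_ mE] := am.
pose l := m 0 + \int[mu]_(t in Rpos) h t.
suff l0 : l = 0 by apply/eqP; rewrite -addr_eq0 -/l l0.
apply/eqP/negPn/negP => l0; have {l0}l0 : 0 < `|l| by rewrite normr_gt0.
have cm : (fun n : nat => m n%:R) @ \oo --> l.
  rewrite (_ : (fun n : nat => m n%:R) = fun n : nat => m 0 + prim h n%:R).
    by apply: cvgD; [exact: cvg_cst|exact: cvg_prim].
  by apply/funext => n; rewrite mE.
have ihn := integrable_norm ih.
have cn := cvg_prim ihn.
pose I := \int[mu]_(t in Rpos) `|h t|.
have [n [n1 n2]] : exists n : nat, `|l - m n%:R| < `|l| / 4 /\
    I - prim (fun t => `|h t|) n%:R < `|l| / 4.
  have e0 : 0 < `|l| / 4 by rewrite divr_gt0.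
  near \oo => n; exists n; split; near: n; first exact: cvgr_dist_lt.
  move/cvgr_dist_lt : cn => /(_ _ e0); apply: filterS => n; exact: le_lt_trans (ler_norm _).
(* Both [m n] and the variation of [m] beyond [n] stay within [|l| / 4] of their targets, which
   leaves at least half of [|l|]. *)
have mlow x : n%:R <= x -> `|l| / 2 <= `|m x|.
  move=> nx.
  have n0 : (0 : R) <= n%:R by [].
  have x0 : 0 <= x by apply: le_trans nx.
  have ihx : mu.-integrable `]n%:R, x] (EFin \o h).
    apply: integrableS ih => //; apply: subset_trans (subset_itvr _) (subset_itvl _) => //=.
  have d1 : `|m x - m n%:R| < `|l| / 4.
    rewrite (mE x)// (mE n%:R)// opprD addrACA subrr add0r.
    have lx := integrable_locL1 ih x.
    rewrite /prim Rintegral_itvB ?bnd_simp//.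
    rewrite (le_lt_trans (le_normr_Rintegral _ _))// (le_lt_trans _ n2)//.
    rewrite /I /prim -lee_fin.
    rewrite Rintegral_itvB ?bnd_simp//.
    rewrite /Rintegral !fineK; first last.
    - apply: integrable_fin_num => //; exact: integrable_norm.
    - apply: integrable_fin_num => //; apply: integrableS ihn => //.
      by apply: subset_itvr; rewrite bnd_simp.
    apply: ge0_subset_integral => //.
      apply: (@measurable_int _ _ _ mu).
      by apply: integrableS ihn => //; apply: subset_itvr; rewrite bnd_simp.
    by apply: subset_itvl; rewrite bnd_simp.
  have d2 := ler_normD (l - m n%:R) (m n%:R - m x).
  have d3 := ler_normD (l - m x) (m x).
  rewrite subrK in d3; rewrite addrA subrK in d2; rewrite distrC in d1.
  lra.
have imn := integrable_norm im.
pose M := \int[mu]_(t in Rpos) `|m t|.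
(* An interval of length [L] on which [|m|] is at least [|l| / 2] contributes [M + 1], more than the
   whole integral [M]. *)
pose L := 2 * (M + 1) / `|l|.
have M0 : 0 <= M by apply: Rintegral_ge0.
have L0 : 0 < L by rewrite divr_gt0// mulr_gt0// ltr_wpDl.
have sub : `]n%:R, n%:R + L] `<=` Rpos.
  by apply: subset_trans (subset_itvr _) (subset_itvl _) => //=; rewrite bnd_simp.
have : \int[mu]_(t in `]n%:R, n%:R + L]) (cst (`|l| / 2) t) <= M.
  apply: (@le_trans _ _ (\int[mu]_(t in `]n%:R, n%:R + L]) `|m t|)).
    apply: le_Rintegral => //.
    - have : mu.-integrable `[n%:R, n%:R + L] (EFin \o cst (`|l| / 2)).
        apply: continuous_compact_integrable; first exact: segment_compact.
        by apply: continuous_subspaceT => ?; exact: cvg_cst.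
      by apply: integrableS => //; apply: subset_itvr; rewrite bnd_simp.
    - exact: integrableS imn.
    - by move=> t /=; rewrite in_itv/= => /andP[nt _]; apply: mlow; exact: ltW.
  rewrite -lee_fin /M /Rintegral !fineK; first last.
  - by apply: integrable_fin_num => //; exact: integrableS imn.
  - exact: integrable_fin_num.
  apply: ge0_subset_integral => //.
  by apply: (@measurable_int _ _ _ mu).
rewrite Rintegral_cst//= lebesgue_measure_itv/= lte_fin ltrDl L0 -EFinD/=.
rewrite [X in _ * X](_ : _ = L); last by ring.
rewrite /L [X in X <= _](_ : _ = M + 1); last by field; rewrite gt_eqF.
by rewrite gerDl leNgt ltr01.
Unshelve. all: by end_near. Qed.

End Tail.

Local Open Scope complex_scope.

(** * Complex-valued functions and first-order equations *)

Section ComplexHalfLine.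
Context {R : realType}.
Implicit Types (f g h k : R -> R[i]) (x t T : R) (c d z w : R[i]).
Local Notation mu := (@lebesgue_measure R).
Local Notation Rpos := (`]0, +oo[%classic : set R).
Local Notation Re := (@complex.Re R).
Local Notation Im := (@complex.Im R).

(** Real part of the complex scalar product of [L^2]; energy identities need nothing more, and all
    estimates stay in [R]. *)
Definition ip f g : R :=
  \int[mu]_(t in Rpos) (Re (f t) * Re (g t) + Im (f t) * Im (g t)).

Definition cprim h x : R[i] := prim (Re \o h) x +i* prim (Im \o h) x.

Definition cac f h := ac (Re \o f) (Re \o h) /\ ac (Im \o f) (Im \o h).

Definition clocL1 h := locL1 (Re \o h) /\ locL1 (Im \o h).

(** Bundles a function of class [H^1] with its weak derivative and its trace at 0, so that the
    choice-based [weak_derivative] and [trace0] stay out of the estimates. *)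
Definition H1pair f h c := [/\ square_integrable f, square_integrable h &
  ae_eq_half_line f (fun x => c + cprim h x)].

Lemma complex_eqP z w : Re z = Re w -> Im z = Im w -> z = w.
Proof. by move: z w => [a b] [a' b'] /= -> ->. Qed.

Lemma mRpos : measurable (Rpos : set (measurableTypeR R)).
Proof. exact: measurable_itv. Qed.

Lemma measurable_dot f g : square_integrable f -> square_integrable g ->
  measurable_fun Rpos (fun t => Re (f t) * Re (g t) + Im (f t) * Im (g t)).
Proof.
move=> [rf mf _] [rg mg _].
by apply: measurable_funD; apply: measurable_funM.
Qed.

Lemma integrable_sq f : square_integrable f ->
  mu.-integrable Rpos (EFin \o (fun t => Re (f t) ^+ 2 + Im (f t) ^+ 2)).
Proof.
move=> [rf mf fy]; apply/integrableP; split.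
  by apply/measurable_EFinP; apply: measurable_funD; apply: measurable_funX.
apply: le_lt_trans fy; rewrite le_eqVlt; apply/orP; left; apply/eqP.
apply: eq_integral => t _ /=.
by rewrite ger0_norm ?addr_ge0 ?sqr_ge0// cabs_sqr.
Qed.

Lemma integrable_dot f g : square_integrable f -> square_integrable g ->
  mu.-integrable Rpos
    (EFin \o (fun t => Re (f t) * Re (g t) + Im (f t) * Im (g t))).
Proof.
move=> sf sg.
have H := integrableD mRpos (integrable_sq sf) (integrable_sq sg).
apply: le_integrable H; [exact: mRpos|by apply/measurable_EFinP; apply: measurable_dot|].
move=> t _ /=; rewrite lee_fin.
rewrite [leRHS]ger0_norm; last by rewrite !addr_ge0 ?sqr_ge0.
move: (Re (f t)) (Im (f t)) (Re (g t)) (Im (g t)) => a b a' b'.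
have := (sqr_ge0 (a + a'), sqr_ge0 (b + b'), sqr_ge0 (a - a'), sqr_ge0 (b - b')).
have := (sqr_ge0 a, sqr_ge0 b, sqr_ge0 a', sqr_ge0 b').
move=> [[[p1 p2] p3] p4] [[[p5 p6] p7] p8].
by rewrite ler_norml; apply/andP; split; lra.
Qed.

Lemma square_integrable_of_integrable f :
  measurable_fun Rpos (Re \o f) -> measurable_fun Rpos (Im \o f) ->
  mu.-integrable Rpos (EFin \o (fun t => Re (f t) ^+ 2 + Im (f t) ^+ 2)) ->
  square_integrable f.
Proof.
move=> rf mf /integrableP[_ H]; split => //; apply: le_lt_trans H.
rewrite le_eqVlt; apply/orP; left; apply/eqP.
apply: eq_integral => t _ /=.
by rewrite ger0_norm ?addr_ge0 ?sqr_ge0// cabs_sqr.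
Qed.

Lemma ipC f g : ip f g = ip g f.
Proof. by apply: eq_Rintegral => t _; ring. Qed.

Lemma ipDl f g k : square_integrable f -> square_integrable g ->
  square_integrable k -> ip (fun t => f t + g t) k = ip f k + ip g k.
Proof.
move=> sf sg sk; rewrite /ip -RintegralD ?mRpos//; [|exact: integrable_dot..].
by apply: eq_Rintegral => t _; rewrite Defs.ReD Defs.ImD; ring.
Qed.

Lemma ipZl (r : R) f g : square_integrable f -> square_integrable g ->
  ip (fun t => r%:C * f t) g = r * ip f g.
Proof.
move=> sf sg; rewrite /ip -RintegralZl ?mRpos//; last exact: integrable_dot.
by apply: eq_Rintegral => t _; rewrite Defs.ReZ Defs.ImZ; ring.
Qed.

Lemma ip_mul_self z f : square_integrable f ->
  ip (fun t => z * f t) f = Re z * ip f f.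
Proof.
move=> sf; rewrite /ip -RintegralZl ?mRpos//; last exact: integrable_dot.
by apply: eq_Rintegral => t _; rewrite Defs.ReM Defs.ImM; ring.
Qed.

Lemma ip_mulJ z f g : ip (fun t => z * f t) g = ip f (fun t => z^* * g t).
Proof.
apply: eq_Rintegral => t _; rewrite !Defs.ReM !Defs.ImM.
by case: z => a b /=; ring.
Qed.

Lemma ip_ge0 f : 0 <= ip f f.
Proof. by apply: Rintegral_ge0 => t _; rewrite -!expr2 addr_ge0 ?sqr_ge0. Qed.

Lemma ip_normE f : ip f f = fine (\int[mu]_(x in Rpos) (cabs (f x) ^+ 2)%:E)%E.
Proof. by apply: eq_Rintegral => t _; rewrite cabs_sqr !expr2. Qed.

Lemma sqintD f g : square_integrable f -> square_integrable g ->
  square_integrable (fun t => f t + g t).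
Proof.
move=> sf sg; have := square_integrable_lin 1 sf sg.
by under eq_fun do rewrite mul1r.
Qed.

Lemma sqintZ z f : square_integrable f -> square_integrable (fun t => z * f t).
Proof.
move=> sf; have := square_integrable_lin z sf square_integrable0.
by under eq_fun do rewrite addr0.
Qed.

Lemma ip_self_mul2 z f : square_integrable f ->
  ip (fun t => z * f t) (fun t => z * f t) = cabs z ^+ 2 * ip f f.
Proof.
move=> sf; rewrite /ip -RintegralZl ?mRpos//; last exact: integrable_dot.
by apply: eq_Rintegral => t _; rewrite Defs.ReM Defs.ImM cabs_sqr; ring.
Qed.

(** Expand the square of the norm of [g - r f] and divide by [r]. *)
Lemma ip_young (r : R) f g : 0 < r -> square_integrable f ->
  square_integrable g -> 2 * ip f g <= r * ip f f + r^-1 * ip g g.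
Proof.
move=> r0 sf sg.
have := ip_ge0 (fun t => (- r)%:C * f t + g t).
have sf' := sqintZ (- r)%:C sf.
rewrite ipDl//; last exact: sqintD.
rewrite ipZl//; last exact: sqintD.
rewrite (ipC f) (ipC g) !ipDl// !ipZl// (ipC g f) => H.
rewrite -(ler_pM2l r0) mulrDr mulrA (mulrA r r^-1) mulfV ?gt_eqF//.
lra.
Qed.

Lemma ae_sqint f g : ae_eq_half_line f g -> measurable_fun Rpos (Re \o g) ->
  measurable_fun Rpos (Im \o g) -> square_integrable f -> square_integrable g.
Proof.
move=> fg rg mg [rf mf fy]; split => //; apply: le_lt_trans fy.
rewrite le_eqVlt; apply/orP; left; apply/eqP.
apply: ae_eq_integral => //; [exact: measurable_cabs_sqr..|].
by apply: filterS fg => x H Hx; rewrite H.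
Qed.

Lemma ae_ip f f' g g' : square_integrable f -> square_integrable f' ->
  square_integrable g -> square_integrable g' ->
  ae_eq_half_line f f' -> ae_eq_half_line g g' -> ip f g = ip f' g'.
Proof.
move=> sf sf' sg sg' ff' gg'; congr fine.
apply: ae_eq_integral; [exact: mRpos|by apply/measurable_EFinP; apply: measurable_dot..|].
by apply: filterS2 ff' gg' => x H1 H2 Hx; rewrite H1// H2.
Qed.

Lemma ae_sym f g : ae_eq_half_line f g -> ae_eq_half_line g f.
Proof. by apply: filterS => x H Hx; rewrite H. Qed.

Lemma ae_trans f g h : ae_eq_half_line f g -> ae_eq_half_line g h ->
  ae_eq_half_line f h.
Proof. by apply: filterS2 => x H1 H2 Hx; rewrite H1// H2. Qed.

Lemma ae_of_eq f g : (forall t, 0 < t -> f t = g t) -> ae_eq_half_line f g.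
Proof. by move=> fg; apply: aeW => t /=; rewrite in_itv/= andbT; exact: fg. Qed.

Lemma locL1_dominated (u q : R -> R) : measurable_fun Rpos u ->
  mu.-integrable Rpos (EFin \o q) -> (forall t, `|u t| <= 1 + q t) -> locL1 u.
Proof.
move=> ru iq uq T.
have sub : `]0, T] `<=` Rpos by apply: subset_itvl; rewrite bnd_simp.
have i1 := @locL1_cst R 1 T.
have i2 : mu.-integrable `]0, T] (EFin \o q) by apply: integrableS iq.
have i3 : mu.-integrable `]0, T] (fun t => (1%:E + (q t)%:E)%E).
  exact: (integrableD _ i1 i2).
apply: le_integrable i3 => //.
  by apply/measurable_EFinP; exact: measurable_funS ru.
by move=> t _ /=; rewrite lee_fin (le_trans (uq t))// ler_norm.
Qed.

Lemma sqint_clocL1 h : square_integrable h -> clocL1 h.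
Proof.
move=> sh; have [rh mh _] := sh.
have ih := integrable_sq sh.
have key (a b : R) : `|a| <= 1 + (a ^+ 2 + b ^+ 2).
  have := (sqr_ge0 (a + 1), sqr_ge0 (a - 1)).
  have := (sqr_ge0 a, sqr_ge0 b) => -[p1 p2] [p5 p6].
  by rewrite ler_norml; apply/andP; split; lra.
split; [apply: locL1_dominated rh ih _|apply: locL1_dominated mh ih _] => t //.
by rewrite [X in 1 + X]addrC.
Qed.

Lemma Re_cprim c h : Re \o (fun x => c + cprim h x) = fun x => Re c + prim (Re \o h) x.
Proof. by apply/funext => x /=; rewrite Defs.ReD. Qed.

Lemma Im_cprim c h : Im \o (fun x => c + cprim h x) = fun x => Im c + prim (Im \o h) x.
Proof. by apply/funext => x /=; rewrite Defs.ImD. Qed.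

Lemma cac_prim c h : clocL1 h -> cac (fun x => c + cprim h x) h.
Proof.
by move=> [rh mh]; split; rewrite ?Re_cprim ?Im_cprim; exact: ac_prim.
Qed.

Lemma cac_measurable f h : cac f h ->
  measurable_fun Rpos (Re \o f) /\ measurable_fun Rpos (Im \o f).
Proof. by move=> [rf mf]; split; [exact: measurable_ac rf|exact: measurable_ac mf]. Qed.

Lemma cprim0 h : cprim h 0 = 0.
Proof. by rewrite /cprim !prim0. Qed.

Lemma cacE f h : cac f h -> forall x, 0 <= x -> f x = f 0 + cprim h x.
Proof.
move=> [[_ rf] [_ mf]] x x0; apply: complex_eqP.
  by rewrite Defs.ReD /=; exact: rf.
by rewrite Defs.ImD /=; exact: mf.
Qed.

Lemma ac_dot f h g k : cac f h -> cac g k ->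
  ac (fun t => Re (f t) * Re (g t) + Im (f t) * Im (g t))
     (fun t => (Re (h t) * Re (g t) + Im (h t) * Im (g t)) +
               (Re (k t) * Re (f t) + Im (k t) * Im (f t))).
Proof.
move=> [rf mf] [rg mg]; have := acD (acM rf rg) (acM mf mg).
rewrite (_ : (fun t => _ + _ + _) = (fun t => Re (h t) * Re (g t) + Im (h t) * Im (g t) +
               (Re (k t) * Re (f t) + Im (k t) * Im (f t))))//.
by apply/funext => t /=; ring.
Qed.

Lemma H1pair_cac f h : cac f h -> square_integrable f -> square_integrable h ->
  H1pair f h (f 0).
Proof.
by move=> cf sf sh; split => //; apply: ae_of_eq => t /ltW; exact: cacE.
Qed.

Lemma H1pair_ac f h c : H1pair f h c -> exists f', [/\ cac f' h,
  square_integrable f', ae_eq_half_line f f' & f' 0 = c].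
Proof.
move=> [sf sh fE]; exists (fun x => c + cprim h x).
have cf := cac_prim c (sqint_clocL1 sh).
split => //; last by rewrite cprim0 addr0.
have [rf mf] := cac_measurable cf; exact: ae_sqint sf.
Qed.

(** The pointwise product of the continuous representatives and its derivative are both integrable,
    so [ac_vanish] removes the boundary term at infinity. *)
Lemma H1pair_ibp f h c g k d : H1pair f h c -> H1pair g k d ->
  ip h g + ip f k = - (Re c * Re d + Im c * Im d).
Proof.
move=> Hf Hg.
have [f' [cf sf' ff' <-]] := H1pair_ac Hf.
have [g' [cg sg' gg' <-]] := H1pair_ac Hg.
have [[sf sh _] [sg sk _]] := (Hf, Hg).
have idm := integrable_dot sf' sg'.
have i1 := integrable_dot sh sg'; have i2 := integrable_dot sk sf'.
rewrite (ac_vanish (ac_dot cf cg) idm); last exact: (integrableD mRpos i1 i2).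
rewrite opprK RintegralD ?mRpos//; congr (_ + _).
  by apply: ae_ip => //; exact: ae_eq_half_line_refl.
by rewrite ipC; apply: ae_ip => //; exact: ae_eq_half_line_refl.
Qed.

End ComplexHalfLine.

(** * Complex exponentials and variation of constants *)

Section Duhamel.
Context {R : realType}.
Implicit Types (f g h k A B : R -> R[i]) (x t T : R) (c d z w : R[i]).
Local Notation mu := (@lebesgue_measure R).
Local Notation Rpos := (`]0, +oo[%classic : set R).
Local Notation Re := (@complex.Re R).
Local Notation Im := (@complex.Im R).

(** The function [exp(z t)], split into real and imaginary parts so that the real calculus of [ac]
    applies. *)
Definition cexp z t : R[i] :=
  (expR (Re z * t) * cos (Im z * t)) +i* (expR (Re z * t) * sin (Im z * t)).

Lemma ac_is_derive (f g : R -> R) : (forall x, is_derive x 1 f (g x)) ->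
  continuous g -> ac f g.
Proof.
move=> df cg; have fg : (f^`())%classic = g.
  by apply/funext => x; rewrite derive1E; have [_] := df x.
rewrite -fg; apply: ac_C1; last by rewrite fg.
by move=> x; have [] := df x.
Qed.

Lemma is_derive_scale (a x : R) : is_derive x 1 (fun t : R => a * t) a.
Proof.
have := is_deriveZ a (is_derive_id x (1 : R)).
by rewrite /GRing.scale /= mulr1.
Qed.

Lemma continuous_scale (a : R) : continuous (fun t : R => a * t).
Proof. by move=> x; apply: cvgMl_tmp; exact: cvg_id. Qed.

Lemma ac_exp (a : R) : ac (fun t => expR (a * t)) (fun t => expR (a * t) * a).
Proof.
apply: ac_is_derive => [x|].
  exact: (@is_derive1_comp _ expR (fun t : R => a * t) x _ _
    (is_derive_expR _) (is_derive_scale a x)).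
move=> x; apply: cvgMr_tmp; apply: (@continuous_comp _ _ _ (fun t : R => a * t) expR).
  exact: continuous_scale.
exact: continuous_expR.
Qed.

Lemma ac_cos (a : R) : ac (fun t => cos (a * t)) (fun t => - sin (a * t) * a).
Proof.
apply: ac_is_derive => [x|].
  exact: (@is_derive1_comp _ cos (fun t : R => a * t) x _ _
    (is_derive_cos _) (is_derive_scale a x)).
move=> x; apply: cvgMr_tmp; apply: cvgN.
apply: (@continuous_comp _ _ _ (fun t : R => a * t) sin).
  exact: continuous_scale.
exact: continuous_sin.
Qed.

Lemma ac_sin (a : R) : ac (fun t => sin (a * t)) (fun t => cos (a * t) * a).
Proof.
apply: ac_is_derive => [x|].
  exact: (@is_derive1_comp _ sin (fun t : R => a * t) x _ _
    (is_derive_sin _) (is_derive_scale a x)).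
move=> x; apply: cvgMr_tmp.
apply: (@continuous_comp _ _ _ (fun t : R => a * t) cos).
  exact: continuous_scale.
exact: continuous_cos.
Qed.

Lemma eq_ac (f g h k : R -> R) : ac f h -> f =1 g -> h =1 k -> ac g k.
Proof. by move=> a /funext <- /funext <-. Qed.

Lemma cac_cexp z : cac (cexp z) (fun t => z * cexp z t).
Proof.
split.
  apply: (eq_ac (acM (ac_exp (Re z)) (ac_cos (Im z)))) => // t /=.
  by rewrite Defs.ReM /=; ring.
apply: (eq_ac (acM (ac_exp (Re z)) (ac_sin (Im z)))) => // t /=.
by rewrite Defs.ImM /=; ring.
Qed.

Lemma cexp0 z : cexp z 0 = 1.
Proof. by rewrite /cexp !mulr0 expR0 cos0 sin0 mulr1 mulr0. Qed.

Lemma cexpN z t : cexp (- z) t * cexp z t = 1.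
Proof.
apply: complex_eqP; rewrite ?Defs.ReM ?Defs.ImM /cexp; case: z => a b /=.
  rewrite !mulNr cosN sinN.
  transitivity (expR (a * t) * expR (- (a * t)) * (cos (b * t) ^+ 2 + sin (b * t) ^+ 2)).
    by ring.
  by rewrite expRxMexpNx_1 cos2Dsin2 mulr1.
by rewrite !mulNr cosN sinN; ring.
Qed.

Lemma cacM f h g k : cac f h -> cac g k ->
  cac (fun t => f t * g t) (fun t => h t * g t + k t * f t).
Proof.
move=> [rf mf] [rg mg]; split.
  apply: (eq_ac (acD (acM rf rg) (acZ (-1) (acM mf mg)))) => t /=.
    by rewrite Defs.ReM; ring.
  by rewrite Defs.ReD !Defs.ReM; ring.
apply: (eq_ac (acD (acM rf mg) (acM mf rg))) => t /=.
  by rewrite Defs.ImM; ring.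
by rewrite Defs.ImD !Defs.ImM; ring.
Qed.

Lemma eq_cac f g h k : cac f h -> f =1 g -> h =1 k -> cac g k.
Proof. by move=> a /funext <- /funext <-. Qed.

Lemma cac_clocL1M f h k : cac f h -> clocL1 k -> clocL1 (fun t => f t * k t).
Proof.
move=> [rf mf] [rk mk]; split.
  rewrite (_ : _ \o _ = fun t => (Re \o k) t * (Re \o f) t + (-1) * ((Im \o k) t * (Im \o f) t)).
    by apply: locL1D; last apply: locL1Z; apply: ac_locL1M; eassumption.
  by apply/funext => t /=; rewrite Defs.ReM; ring.
rewrite (_ : _ \o _ = fun t => (Im \o k) t * (Re \o f) t + (Re \o k) t * (Im \o f) t).
  by apply: locL1D; apply: ac_locL1M; eassumption.
by apply/funext => t /=; rewrite Defs.ImM; ring.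
Qed.

(** Variation of constants for [b' = - z b + B] with [b(0) = c]. The sign is the one of the forward
    equation; the backward equation uses [- z]. *)
Definition duhamel z c B t :=
  cexp (- z) t * (c + cprim (fun s => cexp z s * B s) t).

Lemma duhamel0 z c B : duhamel z c B 0 = c.
Proof. by rewrite /duhamel cexp0 cprim0 mul1r addr0. Qed.

Lemma cac_duhamel z c B : clocL1 B ->
  cac (duhamel z c B) (fun t => - z * duhamel z c B t + B t).
Proof.
move=> lB; have l := cac_clocL1M (cac_cexp z) lB.
apply: (eq_cac (cacM (cac_cexp (- z)) (cac_prim c l))) => // t.
by rewrite /duhamel -[in RHS](mul1r (B t)) -(cexpN z t); ring.
Qed.

Lemma le_prim (h k : R -> R) x : locL1 h -> locL1 k ->
  (forall t, 0 < t -> h t <= k t) -> prim h x <= prim k x.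
Proof.
move=> ih ik hk; apply: le_Rintegral => //.
by move=> t /=; rewrite in_itv/= => /andP[/hk].
Qed.

Lemma prim_nondecreasing (h : R -> R) x y : locL1 h ->
  (forall t, 0 < t -> 0 <= h t) -> x <= y -> prim h x <= prim h y.
Proof.
move=> ih h0 xy; rewrite -lee_fin /prim /Rintegral !fineK; first last.
- exact: integrable_fin_num.
- exact: integrable_fin_num.
have -> : (\int[mu]_(t in `]0%R, x]) (h t)%:E = \int[mu]_(t in `]0%R, x]) `|h t|%:E)%E.
  by apply: eq_integral => t; rewrite inE/= in_itv/= => /andP[t0 _]; rewrite ger0_norm ?h0.
have -> : (\int[mu]_(t in `]0%R, y]) (h t)%:E = \int[mu]_(t in `]0%R, y]) `|h t|%:E)%E.
  by apply: eq_integral => t; rewrite inE/= in_itv/= => /andP[t0 _]; rewrite ger0_norm ?h0.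
apply: ge0_subset_integral => //.
  by apply: (@measurable_int _ _ _ mu); exact: (integrable_norm (ih y)).
by apply: subset_itvl; rewrite bnd_simp.
Qed.

Lemma prim_le_Rintegral (h : R -> R) x : mu.-integrable Rpos (EFin \o h) ->
  (forall t, 0 < t -> 0 <= h t) -> prim h x <= \int[mu]_(t in Rpos) h t.
Proof.
move=> ih h0; have lh := integrable_locL1 ih.
have H := cvg_prim ih.
rewrite -(cvg_lim (@Rhausdorff R) H); apply: limr_ge.
  by apply/cvg_ex; eexists; exact: H.
near=> n; apply: prim_nondecreasing => //; near: n; exact: nbhs_infty_ger.
Unshelve. all: by end_near. Qed.

(** Monotone convergence along the intervals []0, n]]. This is how square integrability of a
    solution is deduced from an energy bound on finite intervals. *)
Lemma integrable_prim_bounded (h : R -> R) M : locL1 h ->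
  measurable_fun Rpos h -> (forall t, 0 < t -> 0 <= h t) ->
  (forall T, 0 <= T -> prim h T <= M) -> mu.-integrable Rpos (EFin \o h).
Proof.
move=> lh mh h0 hM.
apply/integrableP; split; first exact/measurable_EFinP.
have := @ge0_nondecreasing_set_cvg_integral _ _ _ (fun n => `]0, n%:R]%classic : set (measurableTypeR R))
  (fun t => `|h t|%:E) mu.
rewrite -Rpos_bigcup => H.
apply: (@le_lt_trans _ _ M%:E); last exact: ltry.
have {}H : (\int[mu]_(x in `]0%R, n%:R]) `|h x|%:E)%E @[n --> \oo] -->
    (\int[mu]_(x in Rpos) `|h x|%:E)%E.
  apply: H => //.
  - move=> i j ij; apply/subsetPset; apply: subset_itvl.
    by rewrite bnd_simp ler_nat.
  - move=> n; apply/measurable_EFinP; apply: measurableT_comp => //.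
    by apply: measurable_funS mh => //; apply: subset_itvl; rewrite bnd_simp.
rewrite -(cvg_lim (@ereal_hausdorff R) H); apply: lime_le.
  by apply/cvg_ex; eexists; exact: H.
apply: nearW => n; rewrite -[leLHS]fineK; last first.
  by apply: integrable_fin_num => //; exact: (integrable_norm (lh _)).
rewrite lee_fin; apply: le_trans (hM n%:R (ler0n _ _)).
rewrite le_eqVlt; apply/orP; left; apply/eqP; apply: eq_Rintegral => t.
by rewrite inE/= in_itv/= => /andP[t0 _]; rewrite ger0_norm// h0.
Qed.

End Duhamel.

(** * Square integrable solutions of first-order equations *)

Section Solve.
Context {R : realType}.
Implicit Types (f g h k A B : R -> R[i]) (x t T : R) (c d z w : R[i]).
Local Notation mu := (@lebesgue_measure R).
Local Notation Rpos := (`]0, +oo[%classic : set R).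
Local Notation Re := (@complex.Re R).
Local Notation Im := (@complex.Im R).

Definition cdot z w : R := Re z * Re w + Im z * Im w.

Lemma cdotDl z w c : cdot (z + w) c = cdot z c + cdot w c.
Proof. by rewrite /cdot Defs.ReD Defs.ImD; ring. Qed.

Lemma cdot_mul_self z w : cdot (z * w) w = Re z * cdot w w.
Proof. by rewrite /cdot Defs.ReM Defs.ImM; ring. Qed.

Lemma cdot_mul2 z w : cdot (z * w) (z * w) = cdot z z * cdot w w.
Proof. by rewrite /cdot Defs.ReM Defs.ImM; ring. Qed.

Lemma cdot_ge0 z : 0 <= cdot z z.
Proof. by rewrite /cdot -!expr2 addr_ge0 ?sqr_ge0. Qed.

Lemma cdot_young (r : R) z w : 0 < r ->
  2 * cdot z w <= r * cdot w w + r^-1 * cdot z z.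
Proof.
move=> r0; have -> : r^-1 * cdot z z = r * (cdot z z * r ^- 2).
  by field; rewrite gt_eqF.
rewrite -mulrDr -ler_pdivrMl// /cdot.
move: (Re z) (Im z) (Re w) (Im w) => a b a' b'; rewrite -subr_ge0.
rewrite (_ : _ - _ = (a' - a / r) ^+ 2 + (b' - b / r) ^+ 2).
  by rewrite addr_ge0 ?sqr_ge0.
by field; rewrite gt_eqF.
Qed.

Lemma cdot_youngN (r : R) z w : 0 < r ->
  - (r * cdot w w + r^-1 * cdot z z) <= 2 * cdot z w.
Proof.
move=> r0; have := @cdot_young r (- z) w r0.
by rewrite /cdot; case: z => a b /=; lra.
Qed.

Lemma ac_locL1 (f h : R -> R) : ac f h -> locL1 f.
Proof.
move=> af; have := ac_locL1M af (locL1_cst 1).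
by under eq_fun do rewrite /= mul1r.
Qed.

Lemma ac_cdot f h : cac f h ->
  ac (fun t => cdot (f t) (f t)) (fun t => 2 * cdot (h t) (f t)).
Proof.
by move=> cf; apply: (eq_ac (ac_dot cf cf)) => // t; rewrite /cdot; ring.
Qed.

Lemma sqint_of_bound f h M : cac f h ->
  (forall T, 0 <= T -> prim (fun t => cdot (f t) (f t)) T <= M) ->
  square_integrable f.
Proof.
move=> cf fM; have am := ac_cdot cf; have [rf mf] := cac_measurable cf.
have := integrable_prim_bounded (ac_locL1 am) (measurable_ac am)
  (fun t _ => cdot_ge0 (f t)) fM.
move=> H; apply: square_integrable_of_integrable => //.
Qed.

Lemma integrable_cdot B : square_integrable B ->
  mu.-integrable Rpos (EFin \o (fun t => cdot (B t) (B t))).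
Proof. by move=> sB; exact: integrable_dot. Qed.

(** With [r = Re z], Young's inequality gives [(|b|^2)' <= - r |b|^2 + |B|^2 / r]. Integrating and
    dropping [|b(T)|^2] bounds [r] times the integral of [|b|^2] on []0, T]], uniformly in [T]. *)
Lemma sqint_duhamel z c B : 0 < Re z -> square_integrable B ->
  square_integrable (duhamel z c B).
Proof.
move=> r0 sB; have lB := sqint_clocL1 sB; set b := duhamel z c B.
have cb : cac b (fun t => - z * b t + B t) := cac_duhamel z c lB.
have am := ac_cdot cb; have [lh mE] := am; have lm := ac_locL1 am.
have iq := integrable_cdot sB; have lq := integrable_locL1 iq.
pose m t := cdot (b t) (b t).
apply: (sqint_of_bound cb) => T T0.
suff : Re z * prim m T <= m 0 + (Re z)^-1 * ip B B.
  by rewrite -ler_pdivlMl//; exact.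
have l1 := locL1Z (- Re z) lm; have l2 := locL1Z (Re z)^-1 lq.
have H1 : prim (fun t => 2 * cdot (- z * b t + B t) (b t)) T <=
    prim (fun t => - Re z * m t + (Re z)^-1 * cdot (B t) (B t)) T.
  apply: le_prim => // [|t _]; first exact: locL1D.
  have := cdot_young (B t) (b t) r0.
  rewrite cdotDl cdot_mul_self (_ : Re (- z) = - Re z); last by case: (z).
  rewrite /m; move: (cdot (B t) (b t)) (cdot (B t) (B t)) (cdot (b t) (b t)).
  by move: (Re z) (Re z)^-1 => u v p q r; lra.
rewrite primD// (primZ _ _ lm) (primZ _ _ lq) in H1.
have H2 := prim_le_Rintegral T iq (fun t _ => cdot_ge0 (B t)).
have H3 : (Re z)^-1 * prim (fun t => cdot (B t) (B t)) T <= (Re z)^-1 * ip B B.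
  by rewrite ler_pM2l ?invr_gt0.
have H4 : 0 <= m 0 + prim (fun t => 2 * cdot (- z * b t + B t) (b t)) T.
  by rewrite -(mE _ T0) cdot_ge0.
move: H1 H3 H4; move: (prim _ T) (prim _ T) (prim _ T) (m 0) (ip B B) (Re z)^-1.
by move=> *; lra.
Qed.

Lemma solve_forward z c B : 0 < Re z -> square_integrable B ->
  exists b, H1pair b (fun t => - z * b t + B t) c.
Proof.
move=> r0 sB; exists (duhamel z c B); rewrite -[X in H1pair _ _ X](duhamel0 z c B).
have sb := sqint_duhamel c r0 sB.
apply: H1pair_cac => //; last exact: square_integrable_lin.
by apply: cac_duhamel; exact: sqint_clocL1.
Qed.

Lemma sqint_cexp z : Re z < 0 -> square_integrable (cexp z).
Proof.
move=> z0; have z0' : 0 < Re (- z) by case: z z0 => a b /=; rewrite oppr_gt0.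
have := sqint_duhamel 1 z0' square_integrable0.
rewrite (_ : duhamel _ _ _ = cexp z)//; apply/funext => t.
rewrite /duhamel opprK (_ : cprim _ t = 0) ?addr0 ?mulr1//.
have E : (fun s : R => cexp (- z) s * 0) = (fun=> 0) by apply/funext => s; rewrite mulr0.
rewrite E /cprim (_ : Re \o _ = cst 0)// (_ : Im \o _ = cst 0)//.
by rewrite /prim !Rintegral_cst//= mul0r.
Qed.

Lemma integrable_mul f g : square_integrable f -> square_integrable g ->
  mu.-integrable Rpos (EFin \o (Re \o (fun t => f t * g t))) /\
  mu.-integrable Rpos (EFin \o (Im \o (fun t => f t * g t))).
Proof.
move=> sf [rg mg gy].
have s1 : square_integrable (fun t => Re (g t) -i* Im (g t)).
  split => //; first exact: measurableT_comp mg.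
  by under eq_integral do rewrite cabs_sqr /= sqrrN -cabs_sqr.
have s2 : square_integrable (fun t => Im (g t) +i* Re (g t)).
  split => //.
  by under eq_integral do rewrite cabs_sqr /= addrC -cabs_sqr.
split.
  apply: eq_integrable (integrable_dot sf s1) => // t _.
  by rewrite /= Defs.ReM; congr EFin; ring.
apply: eq_integrable (integrable_dot sf s2) => // t _.
by rewrite /= Defs.ImM; congr EFin; ring.
Qed.

(** The homogeneous solutions grow, so the initial value cannot be chosen freely. Solutions that
    vanish at time [n] are bounded uniformly in [n], and their initial values converge to [- K]; the
    solution starting from [- K] inherits the bound, and the energy inequality then makes it square
    integrable. *)
Lemma solve_backward z A : 0 < Re z -> square_integrable A ->
  exists a c, H1pair a (fun t => z * a t + A t) c.
Proof.
move=> r0 sA; have lA := sqint_clocL1 sA.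
have Nz0 : Re (- z) < 0 by case: z r0 => x y /=; rewrite oppr_lt0.
pose G s := cexp (- z) s * A s.
have [iR iI] := integrable_mul (sqint_cexp Nz0) sA.
(* The integral of [exp(- z s) A(s)] over the half-line; starting from its opposite cancels the
   growing exponential. *)
pose K : R[i] := (\int[mu]_(t in Rpos) Re (G t)) +i* (\int[mu]_(t in Rpos) Im (G t)).
pose a c := duhamel (- z) c A.
have ca c : cac (a c) (fun t => z * a c t + A t).
  by apply: (eq_cac (cac_duhamel (- z) c lA)) => // t; rewrite opprK.
have iq := integrable_cdot sA; have lq := integrable_locL1 iq.
pose M := (Re z)^-1 * ip A A.
have l2 := locL1Z (Re z)^-1 lq.
(* Young's inequality: [|a|^2] plus [(Re z)^-1] times the primitive of [|A|^2] increases at least at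
   the rate [Re z |a|^2]. *)
have pw c t : 0 <= 2 * cdot (z * a c t + A t) (a c t) + (Re z)^-1 * cdot (A t) (A t)
    - Re z * cdot (a c t) (a c t).
  have := cdot_youngN (A t) (a c t) r0.
  rewrite cdotDl cdot_mul_self.
  by move: (cdot (A t) (a c t)) (cdot (A t) (A t)) (cdot (a c t) (a c t)) => p q r; lra.
(* The initial value [- cprim G n] makes the solution vanish at [n]. Comparing the nondecreasing
   quantity above at [x] and at [n] gives the bound [M]. *)
have bn (n : nat) x : 0 <= x -> x <= n%:R ->
    cdot (a (- cprim G n%:R) x) (a (- cprim G n%:R) x) <= M.
  move=> x0 xn; set b := a _.
  have am := ac_cdot (ca (- cprim G n%:R)); have [lh mE] := am.
  have bn0 : b n%:R = 0 by rewrite /b /a /duhamel addNr mulr0.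
  have n0 : 0 <= n%:R :> R by [].
  have En := mE _ n0; have Ex := mE _ x0.
  rewrite -/b bn0 [cdot 0 0](_ : _ = 0) in En; last by rewrite /cdot !mul0r addr0.
  rewrite -/b in Ex.
  have := @prim_nondecreasing _ (fun t => 2 * cdot (z * b t + A t) (b t) + (Re z)^-1 * cdot (A t) (A t)) x n%:R.
  move=> /(_ (locL1D lh l2)) H.
  have {}H := H _ xn; rewrite !primD// !(primZ _ _ lq) in H.
  have p0 := @prim_nondecreasing _ _ 0 x lq (fun t _ => cdot_ge0 (A t)) x0.
  rewrite prim0 in p0.
  have p1 := prim_le_Rintegral n%:R iq (fun t _ => cdot_ge0 (A t)).
  have p2 : (Re z)^-1 * prim (fun t => cdot (A t) (A t)) n%:R <= M.
    by rewrite ler_pM2l ?invr_gt0.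
  have p3 : 0 <= (Re z)^-1 * prim (fun t => cdot (A t) (A t)) x.
    by rewrite mulr_ge0 ?invr_ge0 ?(ltW r0).
  have {}H := H _; rewrite -/b in H.
  have H' : prim (fun t => 2 * cdot (z * b t + A t) (b t)) x +
     (Re z)^-1 * prim (fun t => cdot (A t) (A t)) x <=
     prim (fun t => 2 * cdot (z * b t + A t) (b t)) n%:R +
     (Re z)^-1 * prim (fun t => cdot (A t) (A t)) n%:R.
    apply: H => t _; have := pw (- cprim G n%:R) t; have := cdot_ge0 (b t).
    rewrite -/b => q1; have := mulr_ge0 (ltW r0) q1; lra.
  move: (prim (fun t => 2 * _) x) (prim (fun t => 2 * _) n%:R) En Ex H' => u v; lra.
(* For fixed [x] the squared modulus is a continuous function [q] of the initial value, so the bound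
   passes to the limit in [n]. *)
have bound x : 0 <= x -> cdot (a (- K) x) (a (- K) x) <= M.
  move=> x0; pose q c := cdot (cexp z x) (cexp z x) *
    ((- Re c + prim (Re \o G) x) ^+ 2 + (- Im c + prim (Im \o G) x) ^+ 2).
  have aq c : cdot (a (- c) x) (a (- c) x) = q c.
    rewrite /a /duhamel opprK cdot_mul2 /q; congr (_ * _).
    by rewrite /cdot Defs.ReD Defs.ImD -!expr2; case: c.
  have H : q (cprim G n%:R) @[n --> \oo] --> q K.
    apply: cvgMl_tmp; apply: cvgD; (apply: (@cvg_comp _ _ _ _ (fun r : R => r ^+ 2));
      last exact: exprn_continuous); apply: cvgD; try exact: cvg_cst.
      by apply: cvgN; exact: cvg_prim.
    by apply: cvgN; exact: cvg_prim.
  rewrite aq -(cvg_lim (@Rhausdorff R) H); apply: limr_le.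
    by apply/cvg_ex; eexists; exact: H.
  near=> n; rewrite -aq; apply: bn => //.
  by near: n; exact: nbhs_infty_ger.
have am := ac_cdot (ca (- K)); have [lh mE] := am; have lm := ac_locL1 am.
have sa : square_integrable (a (- K)).
  apply: (sqint_of_bound (ca (- K))) => T T0.
  (* One [M] bounds [|a(T)|^2], the other the contribution of the source. *)
  suff : Re z * prim (fun t => cdot (a (- K) t) (a (- K) t)) T <= M + M.
    by rewrite -ler_pdivlMl//; exact.
  have l3 := locL1Z (Re z) lm.
  have H : prim (fun t => Re z * cdot (a (- K) t) (a (- K) t)) T <=
     prim (fun t => 2 * cdot (z * a (- K) t + A t) (a (- K) t) + (Re z)^-1 * cdot (A t) (A t)) T.
    apply: le_prim => //; first exact: locL1D.
    by move=> t _; have := pw (- K) t; lra.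
  rewrite primD// (primZ _ _ lm) (primZ _ _ lq) in H.
  have p1 := prim_le_Rintegral T iq (fun t _ => cdot_ge0 (A t)).
  have p2 : (Re z)^-1 * prim (fun t => cdot (A t) (A t)) T <= M.
    by rewrite ler_pM2l ?invr_gt0.
  have := mE _ T0; have := bound _ T0; have := cdot_ge0 (a (- K) 0).
  move: (prim (fun t => 2 * _) T) H => u; lra.
exists (a (- K)), (a (- K) 0); apply: H1pair_cac => //.
exact: square_integrable_lin.
Unshelve. all: by end_near. Qed.

End Solve.

(** * Energy estimates and uniqueness *)

Section Estimates.
Context {R : realType}.
Implicit Types (f g h k A B : R -> R[i]) (x t T : R) (c d z w : R[i]).
Local Notation mu := (@lebesgue_measure R).
Local Notation Rpos := (`]0, +oo[%classic : set R).
Local Notation Re := (@complex.Re R).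
Local Notation Im := (@complex.Im R).

Lemma ipDr f g k : square_integrable f -> square_integrable g ->
  square_integrable k -> ip k (fun t => f t + g t) = ip k f + ip k g.
Proof. by move=> sf sg sk; rewrite ipC ipDl// !(ipC k). Qed.

Lemma ipZr (r : R) f g : square_integrable f -> square_integrable g ->
  ip g (fun t => r%:C * f t) = r * ip g f.
Proof. by move=> sf sg; rewrite ipC ipZl// ipC. Qed.

Lemma ip_youngN (r : R) f g : 0 < r -> square_integrable f ->
  square_integrable g -> - (r * ip f f + r^-1 * ip g g) <= 2 * ip f g.
Proof.
move=> r0 sf sg; have sf' := sqintZ (-1)%:C sf.
have := ip_young r0 sf' sg.
by rewrite ipZl// ipZl// ipZr//; lra.
Qed.

Lemma H1pair_energy f h c : H1pair f h c -> 2 * ip h f = - cdot c c.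
Proof.
by move=> Hf; rewrite /cdot -(H1pair_ibp Hf Hf) (ipC f); ring.
Qed.

Lemma ReN z : Re (- z) = - Re z. Proof. by case: z. Qed.

(** In [2 Re z |a|^2 + 2 <A, a> = - |c|^2] the trace has the favourable sign: Young's inequality
    absorbs half of the first term and the source controls the trace as well as the solution. *)
Lemma backward_bound z A a c : 0 < Re z -> square_integrable A ->
  H1pair a (fun t => z * a t + A t) c ->
  Re z * ip a a + cdot c c <= (Re z)^-1 * ip A A.
Proof.
move=> r0 sA Ha; have [sa _ _] := Ha; have := H1pair_energy Ha.
rewrite ipDl//; last exact: sqintZ.
rewrite ip_mul_self// (ipC A) => E; have := ip_youngN r0 sa sA; lra.
Qed.

(** The same identity with [- z]: the trace now has the unfavourable sign and stays on the right as
    a datum. *)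
Lemma forward_bound z B b c : 0 < Re z -> square_integrable B ->
  H1pair b (fun t => - z * b t + B t) c ->
  Re z * ip b b <= (Re z)^-1 * ip B B + cdot c c.
Proof.
move=> r0 sB Hb; have [sb _ _] := Hb; have := H1pair_energy Hb.
rewrite ipDl//; last exact: sqintZ.
rewrite ip_mul_self// (ipC B) ReN => E; have := ip_young r0 sb sB; lra.
Qed.

Lemma cdot_eq0 c : cdot c c = 0 -> c = 0.
Proof.
case: c => a b; rewrite /cdot /= -!expr2 => /eqP.
by rewrite paddr_eq0 ?sqr_ge0// !sqrf_eq0 => /andP[/eqP -> /eqP ->].
Qed.

Lemma ae_prim (u v : R -> R) x : measurable_fun Rpos u -> measurable_fun Rpos v ->
  ae_eq mu Rpos u v -> prim u x = prim v x.
Proof.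
move=> mu' mv uv; congr fine.
have sub : `]0, x] `<=` Rpos by apply: subset_itvl; rewrite bnd_simp.
apply: ae_eq_integral => //.
- by apply/measurable_EFinP; exact: measurable_funS mu'.
- by apply/measurable_EFinP; exact: measurable_funS mv.
by apply: filterS uv => t H /sub /H ->.
Qed.

Lemma ae_cprim f g x : square_integrable f -> square_integrable g ->
  ae_eq_half_line f g -> cprim f x = cprim g x.
Proof.
move=> [rf mf _] [rg mg _] fg; congr (_ +i* _); apply: ae_prim => //.
  by apply: filterS fg => t H /H /= ->.
by apply: filterS fg => t H /H /= ->.
Qed.

Lemma H1pair_ae f f' h h' c : H1pair f h c -> ae_eq_half_line f f' ->
  ae_eq_half_line h h' -> square_integrable f' -> square_integrable h' ->
  H1pair f' h' c.
Proof.
move=> [sf sh fE] ff' hh' sf' sh'; split => //.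
apply: ae_trans (ae_sym ff') _; apply: ae_trans fE _.
by apply: ae_of_eq => t _; rewrite (ae_cprim t sh sh').
Qed.

Lemma H1pair_lin z f h c g k d : H1pair f h c -> H1pair g k d ->
  H1pair (fun t => z * f t + g t) (fun t => z * h t + k t) (z * c + d).
Proof.
move=> Hf Hg; have [[sf sh _] [sg sk _]] := (Hf, Hg).
have [f' [cf sf' ff' <-]] := H1pair_ac Hf.
have [g' [cg sg' gg' <-]] := H1pair_ac Hg.
have cfg : cac (fun t => z * f' t + g' t) (fun t => z * h t + k t).
  have [[rf mf] [rg mg]] := (cf, cg); split.
    apply: (eq_ac (acD (acD (acZ (Re z) rf) (acZ (- Im z) mf)) rg)) => t /=;
      by rewrite Defs.ReD Defs.ReM; ring.
  apply: (eq_ac (acD (acD (acZ (Re z) mf) (acZ (Im z) rf)) mg)) => t /=;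
    by rewrite Defs.ImD Defs.ImM; ring.
have H := H1pair_cac cfg (square_integrable_lin z sf' sg') (square_integrable_lin z sh sk).
apply: (H1pair_ae H) => //.
- exact: ae_eq_half_line_lin (ae_sym ff') (ae_sym gg').
- exact: ae_eq_half_line_refl.
- exact: square_integrable_lin.
- exact: square_integrable_lin.
Qed.

Lemma H1pair0 : H1pair (fun=> 0) (fun=> 0) (0 : R[i]).
Proof.
have c0 : cac (fun=> 0 : R[i]) (fun=> 0) by split; exact: ac_cst.
by apply: H1pair_cac => //; exact: square_integrable0.
Qed.

Lemma ip_eq0 f : square_integrable f -> ip f f = 0 -> ae_eq_half_line f (fun=> 0).
Proof.
move=> sf f0.
have H : (\int[mu]_(t in Rpos) `|(cdot (f t) (f t))%:E| = 0)%E.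
  have -> : (\int[mu]_(t in Rpos) `|(cdot (f t) (f t))%:E| =
             \int[mu]_(t in Rpos) (cdot (f t) (f t))%:E)%E.
    by apply: eq_integral => t _; rewrite gee0_abs// lee_fin cdot_ge0.
  rewrite -[LHS]fineK; last by apply: integrable_fin_num => //; exact: integrable_cdot.
  by rewrite -[fine _]/(ip f f) f0.
have mf : measurable_fun Rpos (EFin \o (fun t => cdot (f t) (f t))).
  by apply/measurable_EFinP; apply: measurable_dot.
have := (ae_eq_integral_abs mu (measurable_itv _) mf).1 H.
by apply: filterS => t Ht /Ht [/cdot_eq0].
Qed.

(** With [Re z = 0] the energy identity leaves [|c|^2 = 0], and [|f|^2] has derivative zero almost
    everywhere, so it keeps the value 0. *)
Lemma imaginary_kernel z f c : Re z = 0 -> H1pair f (fun t => z * f t) c ->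
  ae_eq_half_line f (fun=> 0).
Proof.
move=> z0 Hf; have [sf _ _] := Hf.
have c0 : c = 0.
  apply: cdot_eq0; have := H1pair_energy Hf.
  by rewrite ip_mul_self// z0 mul0r mulr0 => /eqP; rewrite eq_sym oppr_eq0 => /eqP.
have [f' [cf sf' ff' f'0]] := H1pair_ac Hf.
apply: (ae_trans ff'); apply: ae_of_eq => t /ltW t0; apply: cdot_eq0.
have [_ /(_ t t0) ->] := ac_cdot cf.
rewrite f'0 c0 /cdot !mul0r !add0r.
have -> : prim (fun t => 2 * (Re (z * f t) * Re (f' t) + Im (z * f t) * Im (f' t))) t =
    prim (fun=> 0) t; last by rewrite /prim Rintegral_cst//= mul0r.
have szf := sqintZ z sf.
apply: ae_prim.
- by apply: measurable_funM => //; exact: measurable_dot.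
- exact: measurable_cst.
apply: filterS ff' => s Hs /Hs ->.
by rewrite Defs.ReM Defs.ImM z0; ring.
Qed.

End Estimates.

(** * Approximate solutions on the imaginary axis *)

Section Density.
Context {R : realType}.
Implicit Types (f g h k A B : R -> R[i]) (x t T L : R) (c d z w : R[i]).
Local Notation mu := (@lebesgue_measure R).
Local Notation Rpos := (`]0, +oo[%classic : set R).
Local Notation Re := (@complex.Re R).
Local Notation Im := (@complex.Im R).

(** Here [h] is [exp(- (e - z) x)] and [f] is [x] times [h], obtained by solving with source [h] and
    zero trace. The three relations come from integrations by parts, so no integral is computed
    explicitly. *)
Lemma weyl_pair z (e : R) : Re z = 0 -> 0 < e -> exists f h,
  [/\ H1pair f (fun t => - (e%:C - z) * f t + h t) 0, square_integrable h,
      2 * e * ip h h = 1, 2 * e * ip f h = ip h h & e * ip f f = ip f h].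
Proof.
move=> z0 e0; set y := e%:C - z.
have ry : Re y = e by rewrite Defs.ReD ReN z0 subr0.
have y0 : 0 < Re y by rewrite ry.
have [h Hh] := solve_forward 1 y0 (@square_integrable0 R).
have [sh sh' _] := Hh.
have [f Hf] := solve_forward 0 y0 sh; have [sf sf' _] := Hf.
have syh := sqintZ (- y) sh; have syf := sqintZ (- y) sf.
have E0 : (fun t : R => - y * h t + 0) = (fun t => - y * h t).
  by apply/funext => t; rewrite addr0.
rewrite E0 in Hh sh'.
exists f, h; split => //.
- have := H1pair_energy Hh.
  by rewrite ip_mul_self// ReN ry /cdot /=; lra.
- have := H1pair_ibp Hf Hh.
  rewrite ipDl// ip_mulJ addrAC -ipDr//; last exact: sqintZ.
  rewrite (_ : (fun t => _) = fun t => (- (2 * e))%:C * h t).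
    by rewrite ipZr// /=; lra.
  apply/funext => t; rewrite -mulrDl; congr (_ * _); apply: complex_eqP.
    by rewrite Defs.ReD /y; case: (z) z0 => a b /= ->; ring.
  by rewrite Defs.ImD /y; case: (z) => a b /=; ring.
- have := H1pair_energy Hf.
  rewrite ipDl// ip_mul_self// ReN ry (ipC h) /cdot /=; lra.
Qed.

Lemma norm_ReM_le z w (r : R) : `|Re z| <= r -> `|Im z| <= r ->
  `|Re (z * w)| <= r * (`|Re w| + `|Im w|).
Proof.
move=> z1 z2; rewrite Defs.ReM (le_trans (ler_normB _ _))// !normrM mulrDr.
by rewrite lerD// ler_wpM2r.
Qed.

Lemma norm_ImM_le z w (r : R) : `|Re z| <= r -> `|Im z| <= r ->
  `|Im (z * w)| <= r * (`|Re w| + `|Im w|).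
Proof.
move=> z1 z2; rewrite Defs.ImM (le_trans (ler_normD _ _))// !normrM mulrDr addrC.
by rewrite [leLHS]addrC [leRHS]addrC lerD// ler_wpM2r.
Qed.

Lemma norm_Re_cexp z t : `|Re (cexp z t)| <= expR (Re z * t).
Proof. by rewrite /= normrM (ger0_norm (expR_ge0 _)) ler_piMr ?expR_ge0 ?cos_max. Qed.

Lemma norm_Im_cexp z t : `|Im (cexp z t)| <= expR (Re z * t).
Proof. by rewrite /= normrM (ger0_norm (expR_ge0 _)) ler_piMr ?expR_ge0 ?sin_max. Qed.

Definition norm1 z : R := `|Re z| + `|Im z|.

Lemma locL1_norm1 B : clocL1 B -> locL1 (fun t => norm1 (B t)).
Proof.
move=> [rB mB] T; exact: (integrableD _ (integrable_norm (rB T)) (integrable_norm (mB T))).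
Qed.

(** For [s <= t] and [Re z >= 0] the kernel [exp(z (s - t))] has modulus at most 1, so the bound is
    uniform in [z]. Each of the two complex products costs a factor 2 in [norm1], whence 4. *)
Lemma duhamel_bound z B t : 0 <= Re z -> clocL1 B -> 0 <= t ->
  norm1 (duhamel z 0 B t) <= 4 * prim (fun s => norm1 (B s)) t.
Proof.
move=> z0 lB t0; set P := prim _ _.
have lq := locL1_norm1 lB.
have [lR lI] := cac_clocL1M (cac_cexp z) lB.
have E0 : 0 <= expR (Re z * t) by exact: expR_ge0.
have key (u : R -> R) : locL1 u ->
    (forall s, `|u s| <= expR (Re z * s) * norm1 (B s)) ->
    `|prim u t| <= expR (Re z * t) * P.
  move=> lu ub; rewrite (le_trans (le_normr_Rintegral _ _))// -(primZ _ _ lq).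
  apply: le_Rintegral => //.
  - exact: (integrable_norm (lu t)).
  - exact: (locL1Z _ lq).
  move=> s /=; rewrite in_itv/= => /andP[s0 st]; rewrite (le_trans (ub s))//.
  by rewrite ler_wpM2r ?addr_ge0// ler_expR ler_wpM2l.
have b1 : `|prim (Re \o (fun s => cexp z s * B s)) t| <= expR (Re z * t) * P.
  apply: key => // s; apply: norm_ReM_le; [exact: norm_Re_cexp|exact: norm_Im_cexp].
have b2 : `|prim (Im \o (fun s => cexp z s * B s)) t| <= expR (Re z * t) * P.
  apply: key => // s; apply: norm_ImM_le; [exact: norm_Re_cexp|exact: norm_Im_cexp].
have b : expR (Re (- z) * t) * norm1 (cprim (fun s => cexp z s * B s) t) <= 2 * P.
  apply: (@le_trans _ _ (expR (Re (- z) * t) * (2 * (expR (Re z * t) * P)))).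
    rewrite ler_wpM2l ?expR_ge0// /norm1 /=; lra.
  rewrite ReN mulNr; have := expRxMexpNx_1 (Re z * t).
  move: (expR _) (expR _) => u v uv.
  have -> : u * (2 * (v * P)) = 2 * P * (v * u) by ring.
  by rewrite uv mulr1.
rewrite /duhamel add0r /norm1.
have := norm_ReM_le (cprim (fun s => cexp z s * B s) t) (norm_Re_cexp (- z) t) (norm_Im_cexp (- z) t).
have := norm_ImM_le (cprim (fun s => cexp z s * B s) t) (norm_Re_cexp (- z) t) (norm_Im_cexp (- z) t).
rewrite -/(norm1 _); lra.
Qed.

Definition trunc L B t : R[i] := if 0 < t <= L then B t else 0.

Lemma cdot_trunc L B t : cdot (trunc L B t - B t) (trunc L B t - B t) =
  cdot (B t) (B t) - (if 0 < t <= L then cdot (B t) (B t) else 0).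
Proof.
rewrite /trunc; case: ifP => _; first by rewrite !subrr /cdot !mul0r addr0.
by rewrite sub0r subr0 /cdot; case: (B t) => a b /=; ring.
Qed.

Lemma measurable_trunc (u : R -> R) L : measurable_fun Rpos u ->
  measurable_fun Rpos (fun t => if 0 < t <= L then u t else 0).
Proof.
move=> mu'; apply: measurable_fun_if => //.
  apply: measurable_and; first exact: measurable_fun_ltr.
  exact: measurable_fun_ler.
by apply: measurable_funS mu' => //; exact: subIsetl.
Qed.

Lemma Re_trunc L B : Re \o trunc L B = fun t => if 0 < t <= L then Re (B t) else 0.
Proof. by apply/funext => t /=; rewrite /trunc; case: ifP. Qed.

Lemma Im_trunc L B : Im \o trunc L B = fun t => if 0 < t <= L then Im (B t) else 0.
Proof. by apply/funext => t /=; rewrite /trunc; case: ifP. Qed.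

Lemma sqint_trunc L B : square_integrable B -> square_integrable (trunc L B).
Proof.
move=> sB; have [rB mB By] := sB.
have rt : measurable_fun Rpos (Re \o trunc L B).
  by rewrite Re_trunc; exact: measurable_trunc.
have mt : measurable_fun Rpos (Im \o trunc L B).
  by rewrite Im_trunc; exact: measurable_trunc.
apply: square_integrable_of_integrable => //.
apply: le_integrable (integrable_sq sB) => //.
  by apply/measurable_EFinP; apply: measurable_funD; apply: measurable_funX.
move=> t _ /=; rewrite lee_fin !ger0_norm ?addr_ge0 ?sqr_ge0// /trunc.
by case: ifP => // _; rewrite /= expr0n /= addr0 addr_ge0 ?sqr_ge0.
Qed.

Lemma trunc_approx B (e : R) : square_integrable B -> 0 < e -> exists L,
  ip (fun t => trunc L B t - B t) (fun t => trunc L B t - B t) < e.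
Proof.
move=> sB e0; have iq := integrable_cdot sB.
have := cvg_prim iq => /cvgr_dist_lt /(_ _ e0) [n _ /(_ n (leqnn n))] H.
exists n%:R; apply: le_lt_trans H.
rewrite (_ : ip _ _ = \int[mu]_(t in Rpos) (cdot (B t) (B t) -
   (if 0 < t <= n%:R then cdot (B t) (B t) else 0))); last first.
  by apply: eq_Rintegral => t _; rewrite -cdot_trunc.
have sub : `]0, n%:R] `<=` Rpos by apply: subset_itvl; rewrite bnd_simp.
rewrite RintegralB//.
  have -> : \int[mu]_(t in Rpos) (if 0 < t <= n%:R then cdot (B t) (B t) else 0) =
      prim (fun t => cdot (B t) (B t)) n%:R; last exact: ler_norm.
    rewrite (Rintegral_support sub).
      by apply: eq_Rintegral => t; rewrite inE/= in_itv/= => ->.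
    by move=> t /= /negP; rewrite in_itv/= => /negbTE ->.
apply: le_integrable iq => //.
  apply/measurable_EFinP; apply: measurable_trunc; exact: measurable_dot.
move=> t _ /=; case: ifP => //; rewrite normr0 lee_fin//.
Qed.

(** A square integrable source need not be integrable; after truncation its integral is finite and
    provides a bound on the solution that does not depend on the damping. *)
Lemma integrable_trunc_norm1 L B : square_integrable B ->
  mu.-integrable Rpos (EFin \o (fun t => norm1 (trunc L B t))).
Proof.
move=> sB; have [rB mB _] := sB.
have lq := locL1_norm1 (sqint_clocL1 sB).
have mq : measurable_fun Rpos (fun t => norm1 (B t)).
  by apply: measurable_funD; apply: measurableT_comp.
have sub : `]0, L] `<=` Rpos by apply: subset_itvl; rewrite bnd_simp.
have : mu.-integrable Rpos ((EFin \o (fun t => norm1 (B t))) \_ `]0, L]).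
  by apply/integrable_restrict => //; rewrite setIidr//; exact: (lq L).
apply: eq_integrable => // t _.
rewrite patchE mem_setE in_itv/= /trunc; case: ifP => //= _.
by rewrite /norm1 /= normr0 addr0.
Qed.

(* The solution [f] of [f' = (z - e) f + trunc L B] is bounded uniformly in
   [e], hence [e ^+ 2 |f|^2 = e <trunc L B, f>] tends to 0 with [e]. *)
Lemma dense_range_imaginary z B (eta : R) : Re z = 0 -> square_integrable B ->
  0 < eta -> exists f h, H1pair f h 0 /\
  ip (fun t => h t - z * f t - B t) (fun t => h t - z * f t - B t) < eta.
Proof.
move=> z0 sB eta0.
have eta4 : 0 < eta / 4 by rewrite divr_gt0.
have [L HL] := trunc_approx sB eta4.
set BL := trunc L B; have sBL := sqint_trunc L sB; rewrite -/BL in sBL HL.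
have iN := integrable_trunc_norm1 L sB; rewrite -/BL in iN.
pose K := \int[mu]_(t in Rpos) norm1 (BL t).
have K0 : 0 <= K by apply: Rintegral_ge0 => t _; rewrite addr_ge0.
(* Chosen so that [e * (4 * K ^+ 2) < eta / 4]; the [+ 1] covers [K = 0]. The truncation error takes
   another [eta / 4], and expanding the square of the sum at most doubles the total. *)
pose e := eta / (16 * (K ^+ 2 + 1)).
have K1 : 0 < K ^+ 2 + 1 by rewrite ltr_wpDl ?sqr_ge0.
have e0 : 0 < e by rewrite divr_gt0// mulr_gt0.
set y := e%:C - z.
have ry : Re y = e by rewrite Defs.ReD ReN z0 subr0.
have y0 : 0 < Re y by rewrite ry.
pose f := duhamel y 0 BL.
have lBL := sqint_clocL1 sBL.
have sf : square_integrable f by exact: sqint_duhamel.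
have Hf : H1pair f (fun t => - y * f t + BL t) 0.
  rewrite -[X in H1pair _ _ X](duhamel0 y 0 BL); apply: H1pair_cac => //.
    exact: cac_duhamel.
  exact: square_integrable_lin.
have fb t : 0 < t -> norm1 (f t) <= 4 * K.
  move=> t0; apply: (le_trans (duhamel_bound (ltW y0) lBL (ltW t0))).
  rewrite ler_wpM2l//.
  by apply: prim_le_Rintegral => // s _; rewrite addr_ge0.
have E : e * ip f f = ip BL f.
  have := H1pair_energy Hf.
  by rewrite ipDl ?ip_mul_self ?ReN ?ry /cdot//=; [lra|exact: sqintZ].
have bd : ip BL f <= 4 * K ^+ 2.
  rewrite expr2 mulrA -RintegralZl//.
  apply: le_Rintegral => //.
  - exact: integrable_dot.
  - exact: (integrableZl _ (4 * K) iN).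
  move=> t tpos; have t0 : 0 < t by move: tpos; rewrite /= in_itv/= andbT.
  have := fb t t0; rewrite -[Re (BL t) * _ + _]/(cdot (BL t) (f t)).
  move: (f t) (BL t) => [a' b'] [a b] H; rewrite /cdot /norm1 /=.
  have H1 : `|a'| <= 4 * K by rewrite (le_trans _ H)// lerDl.
  have H2 : `|b'| <= 4 * K by rewrite (le_trans _ H)// lerDr.
  apply: (@le_trans _ _ (`|a| * (4 * K) + `|b| * (4 * K))); last first.
    by rewrite -mulrDl mulrC.
  by apply: lerD; rewrite (le_trans (ler_norm _))// normrM ler_wpM2l.
exists f, (fun t => - y * f t + BL t); split => //.
have sD : square_integrable (fun t => BL t - B t).
  by have := square_integrable_lin (-1) sB sBL; under eq_fun do rewrite mulN1r addrC.
have sE := sqintZ (- e)%:C sf.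
have -> : (fun t => - y * f t + BL t - z * f t - B t) =
          (fun t => (- e)%:C * f t + (BL t - B t)).
  by apply/funext => t; rewrite /y rmorphN; ring.
have sDE := sqintD sE sD.
rewrite (ipDl sE sD sDE) (ipDr sE sD sE) (ipDr sE sD sD) (ipC (fun t => BL t - B t) (fun t => _ * _)).
have y1 := ip_young ltr01 sE sD.
rewrite invr1 !mul1r in y1.
have F : ip (fun t => (- e)%:C * f t) (fun t => (- e)%:C * f t) < eta / 4.
  rewrite ipZl// ipZr// mulrA mulrNN -mulrA E.
  apply: (@le_lt_trans _ _ (e * (4 * K ^+ 2))); first by rewrite ler_pM2l.
  rewrite /e mulrAC ltr_pdivrMr ?mulr_gt0//.
  rewrite (_ : eta / 4 * _ = eta * (4 * (K ^+ 2 + 1))); last by field.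
  by rewrite ltr_pM2l// ltr_pM2l// ltrDl.
move: y1 F HL; rewrite -/BL; move: (ip _ _) (ip _ _) (ip _ _) => u v w; lra.
Qed.

End Density.

(** * Weak derivatives and traces *)

Section WeakDerivatives.
Context {R : realType}.
Implicit Types (f g h p : R -> R[i]) (x t T : R) (c d z w : R[i]).
Implicit Types (phi u v : R -> R) (k : nat).
Local Notation mu := (@lebesgue_measure R).
Local Notation Rpos := (`]0, +oo[%classic : set R).
Local Notation Re := (@complex.Re R).
Local Notation Im := (@complex.Im R).

Lemma locL1_locally_integrable u : locL1 u -> locally_integrable Rpos u.
Proof.
move=> lu; split.
- rewrite Rpos_bigcup; apply/measurable_fun_bigcup => // n.
  by apply/measurable_EFinP; case/integrableP : (lu n%:R).
- exact: interval_open.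
move=> K KR cK.
have mK : measurable (K : set (measurableTypeR R)) by exact: compact_measurable.
have /compact_bounded[M [_ HM]] := cK.
have KM : K `<=` `]0, M + 1].
  move=> t Kt /=; rewrite in_itv/=; have := KR _ Kt; rewrite /= in_itv/= andbT => ->/=.
  by rewrite (le_trans (ler_norm _))//; apply: HM => //; rewrite ltrDl.
have : mu.-integrable K (EFin \o u) by apply: integrableS (lu (M + 1)).
by case/integrableP.
Qed.

Lemma test_continuous phi : test_function phi -> continuous phi.
Proof.
by move=> [s _] x; apply/differentiable_continuous/derivable1_diffP; exact: (s 0%N).
Qed.

Lemma test_derive phi : test_function phi -> test_function (phi^`())%classic.
Proof.
move=> tphi; have [K [cK KR K0]] := test_function_derive_supp tphi.
split; first by move=> n x; rewrite -derive1Sn; exact: tphi.1.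
by exists K; split => // x /(K0 1%N).
Qed.

Lemma ac_test phi : test_function phi -> ac phi (phi^`())%classic.
Proof.
move=> tphi; apply: ac_C1; first by move=> x; exact: (tphi.1 0%N).
exact: test_continuous (test_derive tphi).
Qed.

Lemma integrable_test_mul phi u : test_function phi -> locally_integrable Rpos u ->
  mu.-integrable Rpos (EFin \o (fun t => phi t * u t)).
Proof.
move=> tphi lu; have [K [cK KR K0]] := tphi.2.
exact: (integrable_test (test_continuous tphi) cK KR K0 lu).
Qed.

(** The product [phi u] has compact support in the open half-line, so it vanishes at 0 and
    [ac_vanish] applies to it. *)
Lemma test_ibp phi u v : test_function phi -> ac u v ->
  \int[mu]_(t in Rpos) ((phi^`())%classic t * u t) =
  - \int[mu]_(t in Rpos) (phi t * v t).
Proof.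
move=> tphi au; have tphi' := test_derive tphi.
have [K [cK KR K0]] := tphi.2.
have lu := locL1_locally_integrable (ac_locL1 au).
have lv := locL1_locally_integrable au.1.
have i0 := integrable_test_mul tphi lu.
have i1 := integrable_test_mul tphi' lu.
have i2 := integrable_test_mul tphi lv.
have E : (fun t => (phi^`())%classic t * u t + v t * phi t) =
         (fun t => (phi^`())%classic t * u t + phi t * v t).
  by apply/funext => t; rewrite (mulrC (v t)).
have am := acM (ac_test tphi) au; rewrite E in am.
have := ac_vanish am i0 (integrableD (@mRpos R) i1 i2).
rewrite RintegralD// K0 ?mul0r; last by move=> /KR /=; rewrite in_itv/= ltxx.
by move=> /esym/eqP; rewrite oppr_eq0 addr_eq0 => /eqP.
Qed.

(** Testing against derivatives only shows that [u] is a constant; testing against bumps on []1,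
    2[], whose integrals tend to 1, shows that the constant is 0. *)
Lemma ae_zero_test u : locally_integrable Rpos u ->
  (forall phi, test_function phi -> \int[mu]_(t in Rpos) (phi t * u t) = 0) ->
  ae_eq mu Rpos u (cst 0).
Proof.
move=> lu u0.
have [c uc] := du_bois_reymond lu (fun phi tphi => u0 _ (test_derive tphi)).
suff c0 : c = 0 by move: uc; rewrite c0.
have l1 := locally_integrable_cst (1 : R).
have tb n : test_function (smooth_bump n 1 2 : R -> R).
  split; first exact/flat_alg_smooth/flat_alg_bump.
  exists (`[1, 2]%classic : set R); split; first exact: segment_compact.
    by move=> t /=; rewrite !in_itv/= andbT => /andP[+ _]; apply: lt_le_trans.
  by move=> t tb; apply: bump_out; apply: contra_not tb; exact: subset_itv_oo_cc.
have key (n : nat) : c * \int[mu]_(t in Rpos) (smooth_bump n 1 2 t * cst 1 t) = 0.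
  rewrite -RintegralZl//; last exact: integrable_bump.
  transitivity (\int[mu]_(t in Rpos) (smooth_bump n 1 2 t * u t)); last exact: u0.
  congr fine; apply: ae_eq_integral => //.
  - apply/measurable_EFinP; apply: measurable_funM => //.
    by case/integrableP : (@integrable_bump _ _ n 1 2 l1 ltr01) => /measurable_EFinP.
  - by case/integrableP : (integrable_test_mul (tb n) lu).
  by apply: filterS uc => t H /H -> /=; rewrite mulr1 mulrC.
have H := @cvg_bump_integral _ _ 1 2 l1 ltr01.
have vol : \int[mu]_(t in `]1, 2[) cst 1 t = (1 : R).
  rewrite Rintegral_cst//= lebesgue_measure_itv/= lte_fin ltr1n -EFinD /= mul1r.
  by ring.
rewrite vol in H.
have H' : c * \int[mu]_(t in Rpos) (smooth_bump n 1 2 t * cst 1 t) @[n --> \oo] --> c * 1.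
  exact: cvgMl_tmp.
have E : (fun n => c * \int[mu]_(t in Rpos) (smooth_bump n 1 2 t * cst 1 t)) = cst 0.
  by apply/funext => n; rewrite key.
rewrite E in H'.
have H0 : (cst 0 : nat -> R) @ \oo --> (0 : R) by exact: cvg_cst.
by have := cvg_unique (@Rhausdorff R) H' H0; rewrite mulr1; apply.
Qed.

Lemma cintegral_test phi f : cintegral (fun t => (phi t)%:C * f t) =
  (\int[mu]_(t in Rpos) (phi t * Re (f t))) +i* (\int[mu]_(t in Rpos) (phi t * Im (f t))).
Proof.
by rewrite /cintegral; congr (_ +i* _); apply: eq_Rintegral => t _; rewrite ?Defs.ReZ ?Defs.ImZ.
Qed.

Lemma signM (b : nat) (x y : R) : (-1) ^+ b * (x +i* y) = ((-1) ^+ b * x) +i* ((-1) ^+ b * y).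
Proof.
elim: b x y => [|b IH] x y; first by rewrite !expr0 !mul1r.
by rewrite !exprSr -!mulrA !mulN1r -IH.
Qed.

Lemma weak_derivativeP k f g : is_weak_derivative k f g <->
  [/\ locally_integrable_half_line f, locally_integrable_half_line g &
   forall phi, test_function phi ->
    \int[mu]_(t in Rpos) ((phi^`(k))%classic t * Re (f t)) =
      (-1) ^+ k * \int[mu]_(t in Rpos) (phi t * Re (g t)) /\
    \int[mu]_(t in Rpos) ((phi^`(k))%classic t * Im (f t)) =
      (-1) ^+ k * \int[mu]_(t in Rpos) (phi t * Im (g t))].
Proof.
split=> -[lf lg H]; split => // phi tphi.
  by have := H phi tphi; rewrite !cintegral_test signM => -[].
by rewrite !cintegral_test signM; have [-> ->] := H phi tphi.
Qed.

Lemma weak_derivative_unique k f g g' : is_weak_derivative k f g ->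
  is_weak_derivative k f g' -> ae_eq_half_line g g'.
Proof.
move=> /weak_derivativeP[lf [rg mg] H] /weak_derivativeP[_ [rg' mg'] H'].
have n1 : ((-1) ^+ k : R) != 0 by rewrite signr_eq0.
have key (u v : R -> R) : locally_integrable Rpos u -> locally_integrable Rpos v ->
   (forall phi, test_function phi ->
      \int[mu]_(t in Rpos) (phi t * u t) = \int[mu]_(t in Rpos) (phi t * v t)) ->
   ae_eq mu Rpos u v.
  move=> lu lv uv; have := ae_zero_test (locally_integrableB lu lv) _.
  move=> Z; have {}Z : ae_eq mu Rpos (u \- v) (cst 0).
    apply: Z => phi tphi; have iu := integrable_test_mul tphi lu.
    have iv := integrable_test_mul tphi lv.
    rewrite -[RHS](subrr (\int[mu]_(t in Rpos) (phi t * v t))) -{1}(uv _ tphi).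
    by rewrite -RintegralB//; apply: eq_Rintegral => t _; rewrite mulrBr.
  by apply: filterS Z => t Zt /Zt /eqP; rewrite subr_eq0 => /eqP.
have e1 : ae_eq mu Rpos (Re \o g) (Re \o g').
  apply: key => // phi tphi; have [E _] := H _ tphi; have [E' _] := H' _ tphi.
  by apply: (mulfI n1); rewrite -E -E'.
have e2 : ae_eq mu Rpos (Im \o g) (Im \o g').
  apply: key => // phi tphi; have [_ E] := H _ tphi; have [_ E'] := H' _ tphi.
  by apply: (mulfI n1); rewrite -E -E'.
by apply: filterS2 e1 e2 => t h1 h2 Rt; apply: complex_eqP; [exact: h1|exact: h2].
Qed.

(** The difference between [f] and the primitive of [h] has zero weak derivative, hence is constant.
    Integrability of [h] up to 0 is what allows the primitive to start at 0 and the constant to be a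
    trace. *)
Lemma weak_derivative_primitive f h : is_weak_derivative 1 f h -> clocL1 h ->
  exists c, ae_eq_half_line f (fun t => c + cprim h t).
Proof.
move=> /weak_derivativeP[[rf mf] [rh mh] H] [lr lm].
have key (u v : R -> R) : locally_integrable Rpos u -> locL1 v ->
    (forall phi, test_function phi -> \int[mu]_(t in Rpos) ((phi^`())%classic t * u t) =
       - \int[mu]_(t in Rpos) (phi t * v t)) ->
    exists a : R, ae_eq mu Rpos u (fun t => a + prim v t).
  move=> lu lv uv.
  have ap : ac (prim v) v by split => // x _; rewrite prim0 add0r.
  have lp := locL1_locally_integrable (ac_locL1 ap).
  have [|c Hc] := @du_bois_reymond _ _ (locally_integrableB lu lp).
    move=> phi tphi; have tphi' := test_derive tphi.
    rewrite -[RHS](subrr (\int[mu]_(t in Rpos) ((phi^`())%classic t * prim v t))).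
    rewrite {1}(test_ibp tphi ap) -uv//.
    have iu := integrable_test_mul tphi' lu.
    have ip := integrable_test_mul tphi' lp.
    by rewrite -RintegralB//; apply: eq_Rintegral => t _; rewrite mulrBr.
  exists c; apply: filterS Hc => t Ht /Ht /= <-; by rewrite subrK.
have [a Ha] : exists a, ae_eq mu Rpos (Re \o f) (fun t => a + prim (Re \o h) t).
  by apply: key => // phi tphi; have [E _] := H _ tphi; rewrite -mulN1r -E.
have [b Hb] : exists b, ae_eq mu Rpos (Im \o f) (fun t => b + prim (Im \o h) t).
  by apply: key => // phi tphi; have [_ E] := H _ tphi; rewrite -mulN1r -E.
exists (a +i* b); apply: filterS2 Ha Hb => t h1 h2 Rt; apply: complex_eqP.
  by rewrite Defs.ReD /=; exact: h1.
by rewrite Defs.ImD /=; exact: h2.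
Qed.

Lemma cac_weak_derivative f h : cac f h -> is_weak_derivative 1 f h.
Proof.
move=> [rf mf]; apply/weak_derivativeP; split.
- by split; apply: locL1_locally_integrable; apply: ac_locL1; eassumption.
- by split; apply: locL1_locally_integrable; [case: rf|case: mf].
move=> phi tphi; rewrite expr1 !mulN1r; split.
  exact: (test_ibp tphi rf).
exact: (test_ibp tphi mf).
Qed.

Lemma sqint_locally_integrable f : square_integrable f ->
  locally_integrable_half_line f.
Proof.
by move=> /sqint_clocL1[rf mf]; split; exact: locL1_locally_integrable.
Qed.

Lemma ae_weak_derivative k f f' g : ae_eq_half_line f f' ->
  locally_integrable_half_line f' ->
  is_weak_derivative k f g -> is_weak_derivative k f' g.
Proof.
move=> ff' [rf' mf'] /weak_derivativeP[[rf mf] lg H]; apply/weak_derivativeP; split => //.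
move=> phi tphi; have [<- <-] := H _ tphi.
have tk : test_function (phi^`(k))%classic.
  by elim: (k) => [|j IH] //; rewrite derive1nS; exact: test_derive.
split; congr fine; apply: ae_eq_integral => //.
- by case/integrableP : (integrable_test_mul tk rf').
- by case/integrableP : (integrable_test_mul tk rf).
- by apply: filterS ff' => t E /E ->.
- by case/integrableP : (integrable_test_mul tk mf').
- by case/integrableP : (integrable_test_mul tk mf).
- by apply: filterS ff' => t E /E ->.
Qed.

(** The derivative of a test function is again one, so it may be inserted in the first relation.
    This lets [Hdot 2] of the first component be read on the gradient alone, which ignores the
    additive constant of the class. *)
Lemma weak_derivative_SS f p g : is_weak_derivative 1 f p ->
  is_weak_derivative 1 p g <->
  (is_weak_derivative 2 f g /\ locally_integrable_half_line g).
Proof.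
move=> /weak_derivativeP[lf lp H].
have D phi : test_function phi -> (phi^`(2))%classic = ((phi^`())%classic^`(1))%classic.
  by rewrite derive1Sn.
split=> [/weak_derivativeP[_ lg H']|[/weak_derivativeP[_ lg H'] _]].
  split => //; apply/weak_derivativeP; split => // phi tphi.
  have [E1 E2] := H _ (test_derive tphi); have [E3 E4] := H' _ tphi.
  by rewrite D// E1 E2 -derive1n1 E3 E4 expr1 !mulN1r !opprK sqrrN expr1n !mul1r.
apply/weak_derivativeP; split => // phi tphi.
have [E1 E2] := H _ (test_derive tphi); have [E3 E4] := H' _ tphi.
rewrite D// E1 -derive1n1 sqrrN expr1n !mul1r expr1 !mulN1r in E3.
rewrite D// E2 -derive1n1 sqrrN expr1n !mul1r expr1 !mulN1r in E4.
by rewrite expr1 !mulN1r -E3 -E4 !opprK.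
Qed.

End WeakDerivatives.

(** * Uniqueness and computation of traces *)

Section Traces.
Context {R : realType}.
Implicit Types (f g h p : R -> R[i]) (x t T : R) (c d z w : R[i]).
Local Notation mu := (@lebesgue_measure R).
Local Notation Rpos := (`]0, +oo[%classic : set R).
Local Notation Re := (@complex.Re R).
Local Notation Im := (@complex.Im R).

Lemma complex_norm_le z : `|z| <= (`|Re z| + `|Im z|)%:C.
Proof.
case: z => a b; rewrite normc_def lecR /=.
rewrite -[leRHS]ger0_norm ?addr_ge0// -sqrtr_sqr ler_wsqrtr//.
rewrite sqrrD !real_normK ?num_real//.
by rewrite addrAC lerDl mulrn_wge0// mulr_ge0.
Qed.

Lemma within_continuous_complex (D : set R) (u v : R -> R) :
  {within D, continuous u} -> {within D, continuous v} ->
  {within D, continuous ((fun x => u x +i* v x) : R -> R[i]^o)}.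
Proof.
move=> cu cv x; apply/cvgrPdist_lt => e.
rewrite ltcE /= => /andP[/eqP Ime e0].
have e2 : 0 < Re e / 2 by rewrite divr_gt0.
have /cvgrPdist_lt /(_ _ e2) Hu := cu x.
have /cvgrPdist_lt /(_ _ e2) Hv := cv x.
near=> y; apply: (le_lt_trans (complex_norm_le _)) => /=.
rewrite ltcE /= Ime eqxx /=.
have h1 : `|u x - u y| < Re e / 2 by near: y.
have h2 : `|v x - v y| < Re e / 2 by near: y.
lra.
Unshelve. all: by end_near. Qed.

Lemma cac_has_trace0 f h : cac f h -> has_trace0 f (f 0).
Proof.
move=> [rf mf]; exists f; split => //; first exact: ae_eq_half_line_refl.
have := within_continuous_complex (continuous_ac rf) (continuous_ac mf).
rewrite (_ : (fun x => _) = (f : R -> R[i]^o))//.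
by apply/funext => x /=; case: (f x).
Qed.

Lemma has_trace0_ae f g c : ae_eq_half_line f g -> has_trace0 f c -> has_trace0 g c.
Proof.
move=> fg [f' [ff' cf f0]]; exists f'; split => //.
exact: ae_trans (ae_sym fg) ff'.
Qed.

(** Two representatives continuous at 0 with different values there would differ on some []0, e[],
    which has positive measure. *)
Lemma has_trace0_unique f c d : has_trace0 f c -> has_trace0 f d -> c = d.
Proof.
move=> [g [fg cg g0]] [k [fk ck k0]]; apply/eqP/negPn/negP => cd.
have x0 : `[0, +oo[%classic (0 : R) by rewrite /= in_itv/= lexx.
have H : (fun x => g x - k x) x @[x --> within `[0, +oo[%classic (nbhs (0 : R))] --> (c - d : R[i]^o).
  rewrite -g0 -k0; apply: cvgB.
    by have := cg 0; rewrite /continuous_at nbhs_subspace_in.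
  by have := ck 0; rewrite /continuous_at nbhs_subspace_in.
have cd0 : (c - d : R[i]^o) != 0 by rewrite subr_eq0.
have := cvgr_neq0 _ H cd0.
move=> -[e /= e0 He].
have [N [mN N0 HN]] := filterI fg fk.
have : `]0, e[ `<=` N.
  move=> t /=; rewrite in_itv/= => /andP[t0 te]; apply: HN => /= -[h1 h2].
  have tR : Rpos t by rewrite /= in_itv/= t0.
  suff : g t - k t != 0 by rewrite -h1// -h2// subrr eqxx.
  apply: He; last by rewrite /= in_itv/= ltW.
  by rewrite /ball/= sub0r normrN gtr0_norm.
move=> sub; have : (mu `]0%R, e[%classic <= mu N)%E.
  by apply: le_measure => //; rewrite inE//; exact: measurable_itv.
have -> : mu N = 0%E by exact: N0.
rewrite lebesgue_measure_itv/= lte_fin e0 -EFinD subr0 lee_fin leNgt.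
by rewrite e0.
Qed.

Lemma H1pair_trace f h c : H1pair f h c -> has_trace0 f c.
Proof.
move=> Hf; have [f' [cf _ ff' <-]] := H1pair_ac Hf.
exact: has_trace0_ae (ae_sym ff') (cac_has_trace0 cf).
Qed.

Lemma trace0E f h c : H1pair f h c -> trace0 f = c.
Proof.
move=> Hf; apply: (has_trace0_unique (xgetPex 0 (ex_intro _ c (H1pair_trace Hf)))).
exact: H1pair_trace Hf.
Qed.

Lemma H1pair_weak f h c : H1pair f h c -> is_weak_derivative 1 f h.
Proof.
move=> Hf; have [f' [cf _ ff' _]] := H1pair_ac Hf; have [sf _ _] := Hf.
apply: (ae_weak_derivative (ae_sym ff')); first exact: sqint_locally_integrable.
exact: cac_weak_derivative.
Qed.

Lemma weak_H1pair f h : square_integrable f -> square_integrable h ->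
  is_weak_derivative 1 f h -> exists c, H1pair f h c.
Proof.
move=> sf sh wfh.
by have [c Hc] := weak_derivative_primitive wfh (sqint_clocL1 sh); exists c.
Qed.

Lemma weak_derivativeE k f g : is_weak_derivative k f g ->
  is_weak_derivative k f (weak_derivative k f) /\
  ae_eq_half_line (weak_derivative k f) g.
Proof.
move=> wf; have H : is_weak_derivative k f (weak_derivative k f).
  exact: (@xgetPex _ _ [set g | is_weak_derivative k f g] (ex_intro _ g wf)).
by split => //; exact: weak_derivative_unique H wf.
Qed.

End Traces.

(** * The wave operator in characteristic coordinates *)

Section EnergySpace.
Context {R : realType} (N : nat).
Local Notation mu := (@lebesgue_measure R).
Local Notation Rpos := (`]0, +oo[%classic : set R).
Local Notation Re := (@complex.Re R).
Local Notation Im := (@complex.Im R).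
Local Notation sfun := (@star_fun R N).
Implicit Types (u v F G : sfun) (X Y : @energy_space R N) (j : 'I_N) (c d z : R[i]).

(** The representative is known only up to a constant, but its derivative is determined almost
    everywhere; from here on a state is seen only through [grad] and [vel]. *)
Definition grad (X : @energy_space R N) : sfun := star_derivative 1 (Htilde1_repr X.1).
Definition vel (X : @energy_space R N) : sfun := L2_repr X.2.

Lemma L2_repr_pi (f : @L2_fun R N) j :
  ae_eq_half_line (L2_repr (\pi_(@L2 R N) f)%qT j) (L2_val f j).
Proof.
have : repr (\pi_(@L2 R N) f)%qT - f \in @L2_null R N.
  by rewrite Quotient.idealrBE reprK.
move=> /asboolP /(_ j).
rewrite (_ : _ - f = (-1) *: f + repr (\pi_(@L2 R N) f)%qT); last by rewrite scaleN1r addrC.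
rewrite (funext (L2_val_lin _ _ _ j)); apply: filterS => t H /H.
by rewrite mulN1r addrC => /eqP; rewrite subr_eq0 => /eqP.
Qed.

Lemma Htilde1_repr_pi (f : @Hdot1_fun R N) : exists c, forall j,
  ae_eq_half_line (Htilde1_repr (\pi_(@Htilde1 R N) f)%qT j) (fun t => Hdot1_val f j t + c).
Proof.
have : repr (\pi_(@Htilde1 R N) f)%qT - f \in @Hdot1_const R N.
  by rewrite Quotient.idealrBE reprK.
move=> /asboolP[c Hc]; exists c => j; move: (Hc j).
rewrite (_ : _ - f = (-1) *: f + repr (\pi_(@Htilde1 R N) f)%qT); last by rewrite scaleN1r addrC.
rewrite (funext (Hdot1_val_lin _ _ _ j)); apply: filterS => t H /H.
by rewrite mulN1r => <-; rewrite addrA subrr add0r.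
Qed.

Lemma L2_repr_star (V : @L2 R N) : L2_star (L2_repr V).
Proof. by have := valP (repr V) => /asboolP. Qed.

Lemma Htilde1_repr_star (U : @Htilde1 R N) : Hdot1_star (Htilde1_repr U).
Proof. by have := valP (repr U) => /asboolP. Qed.

Lemma sqint_vel X j : square_integrable (vel X j).
Proof. exact: L2_repr_star. Qed.

Lemma grad_weak X j : is_weak_derivative 1 (Htilde1_repr X.1 j) (grad X j) /\
  square_integrable (grad X j).
Proof.
have [/(_ j) [g wg sg] _] := Htilde1_repr_star X.1.
have [H E] := weak_derivativeE wg; split => //.
have [_ [[rm _ _] [im _ _]] _] := H.
exact: ae_sqint (ae_sym E) _ _ sg.
Qed.

Lemma sqint_grad X j : square_integrable (grad X j).
Proof. by have [] := grad_weak X j. Qed.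

Lemma cprim_eq0 t : cprim (fun=> 0 : R[i]) t = 0.
Proof.
by rewrite /cprim (_ : Re \o _ = cst 0)// (_ : Im \o _ = cst 0)// /prim
  !Rintegral_cst//= mul0r.
Qed.

Lemma weak_derivative_aer k (f g g' : R -> R[i]) : ae_eq_half_line g g' ->
  locally_integrable_half_line g' ->
  is_weak_derivative k f g -> is_weak_derivative k f g'.
Proof.
move=> gg' lg' /weak_derivativeP[lf lg H]; apply/weak_derivativeP; split => //.
move=> phi tphi; have [-> ->] := H _ tphi.
have [[rg mg] [rg' mg']] := (lg, lg').
split; congr (_ * _); congr fine; apply: ae_eq_integral => //.
- by case/integrableP : (integrable_test_mul tphi rg).
- by case/integrableP : (integrable_test_mul tphi rg').
- by apply: filterS gg' => t E /E ->.
- by case/integrableP : (integrable_test_mul tphi mg).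
- by case/integrableP : (integrable_test_mul tphi mg').
- by apply: filterS gg' => t E /E ->.
Qed.

Lemma weak_derivative_addc (f g : R -> R[i]) c : is_weak_derivative 1 f g ->
  is_weak_derivative 1 (fun t => f t + c) g.
Proof.
move=> wf; have cc : cac (fun=> c) (fun=> 0) by split; exact: ac_cst.
have := is_weak_derivative_lin 1 wf (cac_weak_derivative cc).
by under eq_fun do rewrite mul1r; under [X in is_weak_derivative _ _ X]eq_fun do rewrite mul1r addr0.
Qed.

Lemma grad_pi (f : @Hdot1_fun R N) (V : @L2 R N) (g : sfun) j :
  is_weak_derivative 1 (Hdot1_val f j) (g j) ->
  ae_eq_half_line (grad ((\pi_(@Htilde1 R N) f)%qT, V) j) (g j).
Proof.
move=> wf; have [c Hc] := Htilde1_repr_pi f.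
have [H _] := grad_weak ((\pi_(@Htilde1 R N) f)%qT, V) j.
apply: (weak_derivative_unique H).
apply: (ae_weak_derivative (ae_sym (Hc j)) _ (weak_derivative_addc c wf)).
by case: H.
Qed.

Lemma pi_L2_lin (a : R[i]) (V V' : @L2 R N) :
  a *: V + V' = (\pi_(@L2 R N) (a *: repr V + repr V'))%qT.
Proof.
rewrite -{1}[V]reprK -{1}[V']reprK raddfD; congr (_ + _).
by apply: pi_scale => b v; exact: rpredZ.
Qed.

Lemma pi_Htilde1_lin (a : R[i]) (U U' : @Htilde1 R N) :
  a *: U + U' = (\pi_(@Htilde1 R N) (a *: repr U + repr U'))%qT.
Proof.
rewrite -{1}[U]reprK -{1}[U']reprK raddfD; congr (_ + _).
by apply: pi_scale => b v; exact: rpredZ.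
Qed.

Lemma vel_lin (a : R[i]) X Y j :
  ae_eq_half_line (vel (a *: X + Y) j) (fun t => a * vel X j t + vel Y j t).
Proof.
rewrite /vel (_ : (a *: X + Y).2 = a *: X.2 + Y.2)// pi_L2_lin.
apply: (ae_trans (L2_repr_pi _ j)); rewrite (funext (L2_val_lin _ _ _ j)).
exact: ae_eq_half_line_refl.
Qed.

Lemma grad_lin (a : R[i]) X Y j :
  ae_eq_half_line (grad (a *: X + Y) j) (fun t => a * grad X j t + grad Y j t).
Proof.
have [wX _] := grad_weak X j; have [wY _] := grad_weak Y j.
have -> : a *: X + Y = ((\pi_(@Htilde1 R N) (a *: repr X.1 + repr Y.1))%qT, a *: X.2 + Y.2).
  by rewrite -pi_Htilde1_lin; case: X {wX}; case: Y {wY}.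
apply: (@grad_pi _ _ (fun j t => a * grad X j t + grad Y j t)).
have w := is_weak_derivative_lin a wX wY; rewrite /Htilde1_repr in w.
rewrite (funext (Hdot1_val_lin _ _ _ j)); exact w.
Qed.

(** On each edge the first components differ by a constant, and continuity at the vertex makes these
    constants equal, so the classes modulo constants coincide. *)
Lemma energy_eq X Y : (forall j, ae_eq_half_line (grad X j) (grad Y j)) ->
  (forall j, ae_eq_half_line (vel X j) (vel Y j)) -> X = Y.
Proof.
move=> gXY vXY.
have e2 : X.2 = Y.2.
  rewrite -[X.2]reprK -[Y.2]reprK; apply/eqP; rewrite -Quotient.idealrBE.
  apply/asboolP => j.
  rewrite (_ : _ - _ = (-1) *: repr Y.2 + repr X.2); last by rewrite scaleN1r addrC.
  rewrite (funext (L2_val_lin _ _ _ j)); apply: filterS (vXY j) => t H /H H'.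
  by rewrite -[L2_val (repr X.2) j t]/(vel X j t) H' mulN1r addNr.
have e1 : X.1 = Y.1.
  rewrite -[X.1]reprK -[Y.1]reprK; apply/eqP; rewrite -Quotient.idealrBE.
  apply/asboolP.
  have [_ [c cX]] := Htilde1_repr_star X.1; have [_ [d dY]] := Htilde1_repr_star Y.1.
  (* The difference of the two vertex values, hence the same number for all edges. *)
  exists (-1 * d + c) => j.
  rewrite (_ : _ - _ = (-1) *: repr Y.1 + repr X.1); last by rewrite scaleN1r addrC.
  rewrite (funext (Hdot1_val_lin _ _ _ j)).
  have tr := has_trace0_lin (-1) (dY j) (cX j).
  have [wX _] := grad_weak X j; have [wY _] := grad_weak Y j.
  have w := is_weak_derivative_lin (-1) wY wX.
  have [_ lg _] := w.
  have z0 : ae_eq_half_line (fun t => -1 * grad Y j t + grad X j t) (fun=> 0).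
    by apply: filterS (gXY j) => t H /H ->; rewrite mulN1r addNr.
  have lz : clocL1 (fun=> 0 : R[i]) by split; exact: locL1_0.
  have w0 : is_weak_derivative 1 (fun t => -1 * Htilde1_repr Y.1 j t + Htilde1_repr X.1 j t) (fun=> 0).
    by apply: weak_derivative_aer z0 _ w; exact: locally_integrable_half_line0.
  have [b Hb] := weak_derivative_primitive w0 lz.
  have Hb' : ae_eq_half_line (fun t => -1 * Htilde1_repr Y.1 j t + Htilde1_repr X.1 j t) (fun=> b).
    by apply: filterS Hb => t H /H ->; rewrite cprim_eq0 addr0.
  have <- : b = -1 * d + c; last exact: Hb'.
  exact: has_trace0_unique (has_trace0_ae (ae_sym Hb') (has_trace0_cst b)) tr.
by move: X Y e1 e2 {gXY vXY} => [? ?] [? ?] /= -> ->.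
Qed.

End EnergySpace.

(** * The resolvent equation as a first-order system *)

Section WaveCharacterization.
Context {R : realType} (N : nat).
Local Notation mu := (@lebesgue_measure R).
Local Notation Rpos := (`]0, +oo[%classic : set R).
Local Notation Re := (@complex.Re R).
Local Notation Im := (@complex.Im R).
Local Notation sfun := (@star_fun R N).
Implicit Types (u v F G : sfun) (X Y : @energy_space R N) (j : 'I_N) (c d z alpha : R[i]).

Lemma Htilde1_class_pi u : Hdot1_star u -> exists2 f : @Hdot1_fun R N,
  Htilde1_class u = (\pi_(@Htilde1 R N) f)%qT & Hdot1_val f = u.
Proof.
move=> Hu; exists (insubd (0 : @Hdot1_fun R N) u) => //.
by rewrite (_ : Hdot1_val _ = val (insubd (0 : @Hdot1_fun R N) u))// insubdK//; exact/asboolP.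
Qed.

Lemma L2_class_pi u : L2_star u -> exists2 f : @L2_fun R N,
  L2_class u = (\pi_(@L2 R N) f)%qT & L2_val f = u.
Proof.
move=> Hu; exists (insubd (0 : @L2_fun R N) u) => //.
by rewrite (_ : L2_val _ = val (insubd (0 : @L2_fun R N) u))// insubdK//; exact/asboolP.
Qed.

Lemma energy_class u F G : Hdot1_star u -> (forall j, is_weak_derivative 1 (u j) (F j)) ->
  L2_star G -> (forall j, ae_eq_half_line (grad (Htilde1_class u, L2_class G) j) (F j)) /\
  (forall j, ae_eq_half_line (vel (Htilde1_class u, L2_class G) j) (G j)).
Proof.
move=> Hu wu HG; have [f -> fu] := Htilde1_class_pi Hu.
have [g -> gG] := L2_class_pi HG; split => j.
  by apply: grad_pi; rewrite fu.
by rewrite -gG; exact: L2_repr_pi.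
Qed.

(** Primitives that vanish at 0 are automatically continuous at the vertex. Thus [grad] and [vel]
    identify the energy space with two copies of [L^2], and solving the equation becomes a problem
    on each edge. *)
Lemma energy_exists F G : L2_star F -> L2_star G -> exists X,
  (forall j, ae_eq_half_line (grad X j) (F j)) /\
  (forall j, ae_eq_half_line (vel X j) (G j)).
Proof.
move=> HF HG; pose u : sfun := fun j => cprim (F j).
have cu j : cac (u j) (F j).
  apply: (eq_cac (cac_prim 0 (sqint_clocL1 (HF j)))) => // t.
  by rewrite add0r.
exists (Htilde1_class u, L2_class G); apply: energy_class => //.
  split; first by move=> j; exists (F j) => //; exact: cac_weak_derivative.
  exists 0 => j; rewrite -[0](cprim0 (F j)); exact: cac_has_trace0 (cu j).
by move=> j; exact: cac_weak_derivative.
Qed.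

Lemma L2_norm_sqr u : L2_norm u ^+ 2 = \sum_j ip (u j) (u j).
Proof.
rewrite /L2_norm; under [in LHS]eq_bigr do rewrite -ip_normE.
by rewrite sqr_sqrtr// sumr_ge0// => j _; exact: ip_ge0.
Qed.

Lemma energy_norm_ge0 X : 0 <= energy_norm X.
Proof. exact: sqrtr_ge0. Qed.

Lemma energy_norm_sqr X : energy_norm X ^+ 2 =
  \sum_j (ip (vel X j) (vel X j) + ip (grad X j) (grad X j)).
Proof.
rewrite /energy_norm sqr_sqrtr; last by rewrite addr_ge0 ?sqr_ge0.
by rewrite !L2_norm_sqr big_split/= addrC.
Qed.

(** Membership in the domain with its data exposed: [p'] and [w'] are the derivatives of the
    gradient and of the velocity, [p0] the traces of the gradient, and a single [c] for all edges
    expresses continuity of the velocity. *)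
Definition wave_rel alpha X (p' w' : sfun) (p0 : 'I_N -> R[i]) c :=
  [/\ forall j, H1pair (grad X j) (p' j) (p0 j),
      forall j, H1pair (vel X j) (w' j) c & \sum_j p0 j + alpha * c = 0].

Lemma vertex_valueE v c : (0 < N)%N -> has_vertex_value v c -> vertex_value v = c.
Proof.
move=> N0 vc; apply: (has_trace0_unique _ (vc (Ordinal N0))).
exact: (@xgetPex _ 0 [set c | has_vertex_value v c] (ex_intro _ c vc)).
Qed.

Lemma wave_domainP alpha X : (0 < N)%N -> wave_domain alpha X <->
  exists p' w' p0 c, wave_rel alpha X p' w' p0 c.
Proof.
move=> N0; split.
  move=> [H2 [Hv [c Hc]] bc].
  have /choice[p'0 Hp'] j : exists gc : (R -> R[i]) * R[i],
      H1pair (grad X j) gc.1 gc.2.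
    have [g wg sg] := H2 j; have [w1 s1] := grad_weak X j.
    have lg : locally_integrable_half_line g by case: wg.
    have w2 := (weak_derivative_SS g w1).2 (conj wg lg).
    by have [d Hd] := weak_H1pair s1 sg w2; exists (g, d).
  have /choice[w'0 Hw'] j : exists h : R -> R[i], H1pair (vel X j) h c.
    have [sv /(_ 1%N isT) [h wh sh]] := Hv j.
    have [d Hd] := weak_H1pair sv sh wh.
    exists h; rewrite (has_trace0_unique (Hc j) (H1pair_trace Hd)).
    exact: Hd.
  exists (fun j => (p'0 j).1), w'0, (fun j => (p'0 j).2), c; split => //.
  rewrite (vertex_valueE N0 Hc) in bc; rewrite -[RHS]bc; congr (_ + _).
  by apply: eq_bigr => j _; rewrite -(trace0E (Hp' j)).
move=> [p' [w' [p0 [c [Hp Hw bc]]]]].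
have Hc : has_vertex_value (vel X) c by move=> j; exact: H1pair_trace (Hw j).
split.
- move=> j; have [w1 s1] := grad_weak X j.
  exists (p' j); last by case: (Hp j).
  exact: ((weak_derivative_SS (p' j) w1).1 (H1pair_weak (Hp j))).1.
- split; last by exists c.
  move=> j; split; first exact: sqint_vel.
  case=> [//|[|//]] _; exists (w' j); first exact: H1pair_weak (Hw j).
  by case: (Hw j).
rewrite (vertex_valueE N0 Hc) -[RHS]bc; congr (_ + _).
by apply: eq_bigr => j _; rewrite -(trace0E (Hp j)).
Qed.

(** On the domain the arguments of [Htilde1_class] and [L2_class] are admissible, so these maps do
    not fall back on the class of 0. *)
Lemma wave_actionP alpha X p' w' p0 c : wave_rel alpha X p' w' p0 c ->
  (forall j, ae_eq_half_line (grad (wave_action X) j) (w' j)) /\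
  (forall j, ae_eq_half_line (vel (wave_action X) j) (p' j)).
Proof.
move=> [Hp Hw _].
have w2 j : is_weak_derivative 2 (Htilde1_repr X.1 j) (p' j).
  have [w1 s1] := grad_weak X j.
  exact: ((weak_derivative_SS (p' j) w1).1 (H1pair_weak (Hp j))).1.
have E j : ae_eq_half_line (star_derivative 2 (Htilde1_repr X.1) j) (p' j).
  by have [] := weak_derivativeE (w2 j).
have sq2 : L2_star (star_derivative 2 (Htilde1_repr X.1)).
  move=> j; have [H _] := weak_derivativeE (w2 j).
  have [_ [[rm _ _] [im _ _]] _] := H.
  by have [_ sp _] := Hp j; exact: ae_sqint (ae_sym (E j)) rm im sp.
have H1 : Hdot1_star (L2_repr X.2).
  split; last by exists c => j; exact: H1pair_trace (Hw j).
  move=> j; exists (w' j); first exact: H1pair_weak (Hw j).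
  by case: (Hw j).
have [A B] := energy_class H1 (fun j => H1pair_weak (Hw j)) sq2.
by split => // j; exact: ae_trans (B j) (E j).
Qed.

Lemma ae_wave_rel alpha X (p' w' : sfun) p0 c (p1 w1 : sfun) : wave_rel alpha X p' w' p0 c ->
  (forall j, ae_eq_half_line (p' j) (p1 j)) -> (forall j, ae_eq_half_line (w' j) (w1 j)) ->
  L2_star p1 -> L2_star w1 -> wave_rel alpha X p1 w1 p0 c.
Proof.
move=> [Hp Hw bc] ep ew sp sw; split => // j.
  by apply: H1pair_ae (Hp j) _ _ _ _ => //; [exact: ae_eq_half_line_refl|exact: sqint_grad].
by apply: H1pair_ae (Hw j) _ _ _ _ => //; [exact: ae_eq_half_line_refl|exact: sqint_vel].
Qed.

(** The equation [(W_alpha - z) X = Y] after differentiating its first component: [v' = z p + F']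
    and [p' = z v + G]. *)
Definition resolvent_rel alpha z X Y := exists p0 c,
  wave_rel alpha X (fun j t => z * vel X j t + vel Y j t)
                   (fun j t => z * grad X j t + grad Y j t) p0 c.

Lemma op_shift_wave alpha z X Y : (0 < N)%N ->
  (op_dom (op_shift (wave_operator N alpha) z) X /\
   op_act (op_shift (wave_operator N alpha) z) X = Y) <-> resolvent_rel alpha z X Y.
Proof.
move=> N0 /=; split.
  move=> [/(wave_domainP _ _ N0)[p' [w' [p0 [c Hr]]]] XY].
  have [A B] := wave_actionP Hr.
  have E : wave_action X = z *: X + Y by rewrite -XY addrC subrK.
  rewrite E in A B; exists p0, c; apply: (ae_wave_rel Hr).
  - by move=> j; exact: ae_trans (ae_sym (B j)) (vel_lin z X Y j).
  - by move=> j; exact: ae_trans (ae_sym (A j)) (grad_lin z X Y j).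
  - by move=> j; apply: square_integrable_lin; exact: sqint_vel.
  - by move=> j; apply: square_integrable_lin; exact: sqint_grad.
move=> [p0 [c Hr]]; split; first by apply/(wave_domainP _ _ N0); do 4 eexists; exact: Hr.
have [A B] := wave_actionP Hr.
have -> : wave_action X = z *: X + Y; last by rewrite addrC addKr.
apply: energy_eq => j.
  exact: ae_trans (A j) (ae_sym (grad_lin z X Y j)).
exact: ae_trans (B j) (ae_sym (vel_lin z X Y j)).
Qed.

End WaveCharacterization.

(** * Characteristic coordinates and vertex conditions *)

Section Characteristics.
Context {R : realType} (N : nat).
Local Notation Re := (@complex.Re R).
Local Notation Im := (@complex.Im R).
Local Notation sfun := (@star_fun R N).
Implicit Types (u v F G A B : sfun) (X Y : @energy_space R N) (j : 'I_N) (c d z alpha : R[i]).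
Implicit Types (b : bool) (f g h : R -> R[i]).

Definition sg b : R[i] := (-1) ^+ b.

Lemma sgP b : sg b = 1 \/ sg b = -1.
Proof. by case: b; [right; rewrite /sg expr1|left; rewrite /sg expr0]. Qed.

Definition chi (s : R[i]) X j : R -> R[i] := fun t => s * grad X j t + vel X j t.

Lemma sqint_chi s X j : square_integrable (chi s X j).
Proof. by apply: square_integrable_lin; [exact: sqint_grad|exact: sqint_vel]. Qed.

Lemma eq_H1pair f f' h h' c c' : H1pair f h c -> f =1 f' -> h =1 h' -> c = c' ->
  H1pair f' h' c'.
Proof. by move=> H /funext <- /funext <- <-. Qed.

Lemma H1pairZ z f h c : H1pair f h c ->
  H1pair (fun t => z * f t) (fun t => z * h t) (z * c).
Proof.
move=> Hf; apply: (eq_H1pair (H1pair_lin z Hf (@H1pair0 R))) => [t|t|]; exact: addr0.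
Qed.

Lemma ip_parallelogram b f g : square_integrable f -> square_integrable g ->
  ip (fun t => sg b * f t + g t) (fun t => sg b * f t + g t) +
  ip (fun t => - sg b * f t + g t) (fun t => - sg b * f t + g t) =
  2 * (ip g g + ip f f).
Proof.
move=> sf sg'.
have sp := square_integrable_lin (sg b) sf sg'.
have sm := square_integrable_lin (- sg b) sf sg'.
rewrite /ip -!RintegralD ?mRpos//; try exact: integrable_dot.
rewrite -RintegralZl ?mRpos//; last first.
  exact: (integrableD (@mRpos R) (integrable_dot sg' sg') (integrable_dot sf sf)).
apply: eq_Rintegral => t _; rewrite !Defs.ReD !Defs.ImD !Defs.ReM !Defs.ImM.
by case: (sgP b) => -> /=; ring.
Qed.

Lemma energy_norm_chi b X : energy_norm X ^+ 2 = 2^-1 *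
  \sum_j (ip (chi (sg b) X j) (chi (sg b) X j) + ip (chi (- sg b) X j) (chi (- sg b) X j)).
Proof.
rewrite energy_norm_sqr mulr_sumr; apply: eq_bigr => j _.
rewrite (ip_parallelogram b (sqint_grad X j) (sqint_vel X j)) mulKf//.
Qed.

(* [P0 j], [Q0 j] and [c] are the values at the vertex of the two
   characteristics on the edge [j] and of the velocity. *)
Definition chi_rel b alpha z X Y (P0 Q0 : 'I_N -> R[i]) c :=
  [/\ forall j, H1pair (chi (sg b) X j)
        (fun t => sg b * z * chi (sg b) X j t + sg b * chi (sg b) Y j t) (P0 j),
      forall j, H1pair (chi (- sg b) X j)
        (fun t => - (sg b * z) * chi (- sg b) X j t + - sg b * chi (- sg b) Y j t) (Q0 j),
      forall j, P0 j + Q0 j = 2 * c &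
      (N%:R - sg b * alpha) * c = \sum_j P0 j].

(** The change of unknowns is invertible since [s^2 = 1]. With [P0 j = s p0 j + c], summing over the
    edges and using that the traces of the gradient sum to [- alpha c] gives the last condition of
    [chi_rel]. *)
Lemma resolvent_relP b alpha z X Y : resolvent_rel alpha z X Y <->
  exists P0 Q0 c, chi_rel b alpha z X Y P0 Q0 c.
Proof.
split.
  move=> [p0 [c [Hp Hv bc]]].
  exists (fun j => sg b * p0 j + c), (fun j => - sg b * p0 j + c), c; split.
  - move=> j; apply: (eq_H1pair (H1pair_lin (sg b) (Hp j) (Hv j))) => // t.
    by rewrite /chi; case: (sgP b) => ->; ring.
  - move=> j; apply: (eq_H1pair (H1pair_lin (- sg b) (Hp j) (Hv j))) => // t.
    by rewrite /chi; case: (sgP b) => ->; ring.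
  - by move=> j; ring.
  - rewrite big_split/= -mulr_sumr sumr_const card_ord -mulr_natl.
    have -> : \sum_j p0 j = - (alpha * c) by apply/eqP; rewrite -addr_eq0 bc.
    by ring.
move=> [P0 [Q0 [c [HP HQ PQ bc]]]].
have half2 : 2^-1 * 2 = 1 :> R[i] by rewrite mulVf// pnatr_eq0.
(* [D] recovers the gradient from the half difference of the characteristics, and [S] below recovers
   the velocity from their half sum. *)
have D (x y : R[i]) : sg b * (2^-1 * (x + sg b * y - (x - sg b * y))) = y.
  transitivity ((2^-1 * 2) * y); first by case: (sgP b) => ->; ring.
  by rewrite half2 mul1r.
have S (x y : R[i]) : 2^-1 * (x + sg b * y + (x - sg b * y)) = x.
  transitivity ((2^-1 * 2) * x); first by ring.
  by rewrite half2 mul1r.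
exists (fun j => sg b * (2^-1 * (P0 j - Q0 j))), c; split.
- move=> j.
  have H := H1pairZ (sg b * 2^-1) (H1pair_lin (-1) (HQ j) (HP j)).
  apply: (eq_H1pair H) => [t|t|].
  + by rewrite -[RHS](D (vel X j t)) /chi; ring.
  + rewrite -[RHS](S _ (sg b * z * grad X j t + sg b * grad Y j t)) /chi.
    by case: (sgP b) => ->; ring.
  + by ring.
- move=> j.
  have H := H1pairZ 2^-1 (H1pair_lin 1 (HQ j) (HP j)).
  apply: (eq_H1pair H) => [t|t|].
  + by rewrite -[RHS](S _ (grad X j t)) /chi; ring.
  + rewrite -[RHS](S _ (sg b * z * vel X j t + sg b * vel Y j t)) /chi.
    by case: (sgP b) => ->; ring.
  + by rewrite mul1r addrC PQ mulKf// pnatr_eq0.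
have -> : \sum_(j < N) sg b * (2^-1 * (P0 j - Q0 j)) = \sum_j sg b * (P0 j - c).
  apply: eq_bigr => j _; congr (_ * _).
  have -> : Q0 j = 2 * c - P0 j by rewrite -(PQ j); ring.
  transitivity ((2^-1 * 2) * (P0 j - c)); first by ring.
  by rewrite half2 mul1r.
rewrite -mulr_sumr big_split/= -bc sumr_const card_ord -mulr_natl.
by case: (sgP b) => ->; ring.
Qed.

Lemma chi_exists b A B : L2_star A -> L2_star B -> exists X, forall j,
  ae_eq_half_line (chi (sg b) X j) (A j) /\ ae_eq_half_line (chi (- sg b) X j) (B j).
Proof.
move=> sA sB.
have half2 : 2^-1 * 2 = 1 :> R[i] by rewrite mulVf// pnatr_eq0.
pose F : sfun := fun j t => - (sg b * 2^-1) * B j t + (sg b * 2^-1) * A j t.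
pose G : sfun := fun j t => 2^-1 * B j t + 2^-1 * A j t.
have [||X [HF HG]] := @energy_exists R N F G.
- by move=> j; apply: square_integrable_lin => //; exact: sqintZ.
- by move=> j; apply: square_integrable_lin => //; exact: sqintZ.
exists X => j; split.
  apply: ae_trans (ae_eq_half_line_lin (sg b) (HF j) (HG j)) _.
  apply: ae_of_eq => t _; rewrite /F /G.
  transitivity ((2^-1 * 2) * A j t); first by case: (sgP b) => ->; ring.
  by rewrite half2 mul1r.
apply: ae_trans (ae_eq_half_line_lin (- sg b) (HF j) (HG j)) _.
apply: ae_of_eq => t _; rewrite /F /G.
transitivity ((2^-1 * 2) * B j t); first by case: (sgP b) => ->; ring.
by rewrite half2 mul1r.
Qed.

Lemma energy_norm_ae b X A B : L2_star A -> L2_star B -> (forall j,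
  ae_eq_half_line (chi (sg b) X j) (A j) /\ ae_eq_half_line (chi (- sg b) X j) (B j)) ->
  energy_norm X ^+ 2 = 2^-1 * \sum_j (ip (A j) (A j) + ip (B j) (B j)).
Proof.
move=> sA sB H; rewrite (energy_norm_chi b); congr (_ * _).
apply: eq_bigr => j _; have [hA hB] := H j.
by congr (_ + _); apply: ae_ip => //; exact: sqint_chi.
Qed.

Lemma chi_rel_of_solution b alpha z X Y (a q : sfun) A B a0 q0 c :
  (forall j, H1pair (a j) (fun t => sg b * z * a j t + A j t) (a0 j)) ->
  (forall j, H1pair (q j) (fun t => - (sg b * z) * q j t + B j t) (q0 j)) ->
  (forall j, a0 j + q0 j = 2 * c) -> (N%:R - sg b * alpha) * c = \sum_j a0 j ->
  (forall j, ae_eq_half_line (chi (sg b) X j) (a j) /\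
             ae_eq_half_line (chi (- sg b) X j) (q j)) ->
  (forall j, ae_eq_half_line (fun t => sg b * chi (sg b) Y j t) (A j) /\
             ae_eq_half_line (fun t => - sg b * chi (- sg b) Y j t) (B j)) ->
  chi_rel b alpha z X Y a0 q0 c.
Proof.
move=> Ha Hq aq bc HX HY; split => // j.
  have [ha _] := HX j; have [hA _] := HY j.
  apply: (H1pair_ae (Ha j)).
  - exact: ae_sym.
  - exact: ae_eq_half_line_lin (ae_sym ha) (ae_sym hA).
  - exact: sqint_chi.
  - by apply: square_integrable_lin; [exact: sqint_chi|apply: sqintZ; exact: sqint_chi].
have [_ hq] := HX j; have [_ hB] := HY j.
apply: (H1pair_ae (Hq j)).
- exact: ae_sym.
- exact: ae_eq_half_line_lin (ae_sym hq) (ae_sym hB).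
- exact: sqint_chi.
- by apply: square_integrable_lin; [exact: sqint_chi|apply: sqintZ; exact: sqint_chi].
Qed.

Lemma cabs_sg b : cabs (sg b) = 1.
Proof.
by case: (sgP b) => ->; rewrite /cabs /= ?oppr0 ?sqrrN expr1n expr0n addr0 sqrtr1.
Qed.

(** Turns functions prescribed edge by edge into a state and its source, both norms being read on
    the characteristics. The approximate eigenvectors and the vectors for the lower bound are built
    this way. *)
Lemma resolvent_exists b alpha z (a q : sfun) A B a0 q0 c :
  (forall j, H1pair (a j) (fun t => sg b * z * a j t + A j t) (a0 j)) ->
  (forall j, H1pair (q j) (fun t => - (sg b * z) * q j t + B j t) (q0 j)) ->
  (forall j, a0 j + q0 j = 2 * c) -> (N%:R - sg b * alpha) * c = \sum_j a0 j ->
  L2_star A -> L2_star B ->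
  exists X Y, [/\ resolvent_rel alpha z X Y,
    energy_norm X ^+ 2 = 2^-1 * \sum_j (ip (a j) (a j) + ip (q j) (q j)) &
    energy_norm Y ^+ 2 = 2^-1 * \sum_j (ip (A j) (A j) + ip (B j) (B j))].
Proof.
move=> Ha Hq aq bc sA sB.
have sa : L2_star a by move=> j; case: (Ha j).
have sq : L2_star q by move=> j; case: (Hq j).
have sA' : L2_star (fun j t => sg b * A j t) by move=> j; exact: sqintZ.
have sB' : L2_star (fun j t => - sg b * B j t) by move=> j; exact: sqintZ.
have [X HX] := chi_exists b sa sq.
have [Y HY] := chi_exists b sA' sB'.
exists X, Y; split.
- apply/(resolvent_relP b); exists a0, q0, c.
  apply: (chi_rel_of_solution Ha Hq) => // j; have [h1 h2] := HY j; split.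
    by apply: filterS h1 => t H /H ->; case: (sgP b) => ->; ring.
  by apply: filterS h2 => t H /H ->; case: (sgP b) => ->; ring.
- exact: energy_norm_ae HX.
rewrite (energy_norm_ae sA' sB' HY); congr (_ * _); apply: eq_bigr => j _.
have cabsN : cabs (- sg b) = 1.
  by case: (sgP b) => ->; rewrite /cabs /= ?oppr0 ?opprK ?sqrrN expr1n expr0n addr0 sqrtr1.
by rewrite !ip_self_mul2// cabsN cabs_sg expr1n !mul1r.
Qed.

End Characteristics.

(** * Resolvent estimates *)

Section Resolvent.
Context {R : realType} (N : nat).
Local Notation Re := (@complex.Re R).
Local Notation Im := (@complex.Im R).
Local Notation sfun := (@star_fun R N).
Implicit Types (u v F G A B : sfun) (X Y : @energy_space R N) (j : 'I_N) (c d z alpha s : R[i]).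
Implicit Types (b : bool) (f g h : R -> R[i]).

Lemma chi_lin s (a : R[i]) X Y j :
  ae_eq_half_line (chi s (a *: X + Y) j) (fun t => a * chi s X j t + chi s Y j t).
Proof.
apply: (ae_trans (ae_eq_half_line_lin s (grad_lin a X Y j) (vel_lin a X Y j))).
by apply: ae_of_eq => t _; rewrite /chi; ring.
Qed.

Lemma chi0 s j : ae_eq_half_line (chi s (0 : @energy_space R N) j) (fun=> 0).
Proof.
have := @chi_lin s (-1) 0 0 j; rewrite scaler0 addr0 => H.
by apply: (ae_trans H); apply: ae_of_eq => t _; rewrite mulN1r addNr.
Qed.

Lemma sqint_scaled_chi s s' X j : square_integrable (fun t => s' * chi s X j t).
Proof. by apply: sqintZ; exact: sqint_chi. Qed.

Lemma energy_norm_source b X :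
  energy_norm X ^+ 2 = 2^-1 * \sum_j
    (ip (fun t => sg b * chi (sg b) X j t) (fun t => sg b * chi (sg b) X j t) +
     ip (fun t => - sg b * chi (- sg b) X j t) (fun t => - sg b * chi (- sg b) X j t)).
Proof.
rewrite (energy_norm_chi b); congr (_ * _); apply: eq_bigr => j _.
have cabsN : cabs (- sg b : R[i]) = 1.
  by case: (@sgP R b) => ->; rewrite /cabs /= ?oppr0 ?opprK ?sqrrN expr1n expr0n addr0 sqrtr1.
rewrite !ip_self_mul2; [|exact: sqint_chi..].
by rewrite cabsN cabs_sg expr1n !mul1r.
Qed.

Lemma ip00 : ip (fun=> 0 : R[i]) (fun=> 0) = 0.
Proof.
transitivity (\int[@lebesgue_measure R]_(t in `]0, +oo[) cst (0 : R) t).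
  by apply: eq_Rintegral => t _; rewrite /= mul0r addr0.
by rewrite Rintegral_cst//= mul0r.
Qed.

Lemma energy_norm0 : energy_norm (0 : @energy_space R N) = 0.
Proof.
apply/eqP; rewrite -sqrf_eq0 (energy_norm_chi false) big1 ?mulr0// => j _.
have z0 (s : R[i]) : ip (chi s (0 : @energy_space R N) j) (chi s (0 : @energy_space R N) j) = 0.
  rewrite (ae_ip (sqint_chi s 0 j) (@square_integrable0 R) (sqint_chi s 0 j)
    (@square_integrable0 R) (chi0 s j) (chi0 s j)).
  exact: ip00.
by rewrite !z0 addr0.
Qed.

Lemma energy_norm_eq0 X : energy_norm X = 0 -> X = 0.
Proof.
move=> X0; have := energy_norm_sqr X; rewrite X0 expr0n => /esym/eqP.
rewrite psumr_eq0 => [|j _]; last by rewrite addr_ge0 ?ip_ge0.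
move=> /allP H.
have H' j : ip (vel X j) (vel X j) = 0 /\ ip (grad X j) (grad X j) = 0.
  have := H j (mem_index_enum _); rewrite /= paddr_eq0 ?ip_ge0//.
  by move=> /andP[/eqP -> /eqP ->].
have g0 j : ae_eq_half_line (grad (0 : @energy_space R N) j) (fun=> 0).
  have := grad_lin (-1) 0 (0 : @energy_space R N) j; rewrite scaler0 addr0 => E.
  by apply: (ae_trans E); apply: ae_of_eq => t _; rewrite mulN1r addNr.
have v0 j : ae_eq_half_line (vel (0 : @energy_space R N) j) (fun=> 0).
  have := vel_lin (-1) 0 (0 : @energy_space R N) j; rewrite scaler0 addr0 => E.
  by apply: (ae_trans E); apply: ae_of_eq => t _; rewrite mulN1r addNr.
apply: energy_eq => j; have [h1 h2] := H' j.
  exact: ae_trans (ip_eq0 (sqint_grad X j) h2) (ae_sym (g0 j)).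
exact: ae_trans (ip_eq0 (sqint_vel X j) h1) (ae_sym (v0 j)).
Qed.

Lemma energy_normZ (a : R[i]) X : energy_norm (a *: X) = cabs a * energy_norm X.
Proof.
apply/eqP; rewrite -(@eqrXn2 _ 2)//; [|exact: energy_norm_ge0|].
  rewrite exprMn !energy_norm_sqr mulr_sumr; apply/eqP; apply: eq_bigr => j _.
  have g1 : ae_eq_half_line (grad (a *: X) j) (fun t => a * grad X j t).
    have := grad_lin (a - 1) X X j; rewrite scalerBl scale1r subrK => E.
    by apply: (ae_trans E); apply: ae_of_eq => t _; ring.
  have v1 : ae_eq_half_line (vel (a *: X) j) (fun t => a * vel X j t).
    have := vel_lin (a - 1) X X j; rewrite scalerBl scale1r subrK => E.
    by apply: (ae_trans E); apply: ae_of_eq => t _; ring.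
  have sg1 := sqintZ a (sqint_grad X j); have sv := sqintZ a (sqint_vel X j).
  rewrite (ae_ip (sqint_vel _ j) sv (sqint_vel _ j) sv v1 v1).
  rewrite (ae_ip (sqint_grad _ j) sg1 (sqint_grad _ j) sg1 g1 g1).
  rewrite !ip_self_mul2; [by rewrite mulrDr|exact: sqint_grad|exact: sqint_vel].
by rewrite mulr_ge0 ?cabs_ge0 ?energy_norm_ge0.
Qed.

Lemma chi_eq b X Y :
  (forall j, ae_eq_half_line (chi (sg b) X j) (chi (sg b) Y j) /\
             ae_eq_half_line (chi (- sg b) X j) (chi (- sg b) Y j)) -> X = Y.
Proof.
move=> H; apply/eqP; rewrite -subr_eq0; apply/eqP/energy_norm_eq0/eqP.
rewrite -sqrf_eq0 (_ : X - Y = (-1) *: Y + X); last by rewrite scaleN1r addrC.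
have s0 : L2_star (fun (_ : 'I_N) (_ : R) => 0 : R[i]) by move=> j; exact: square_integrable0.
rewrite (energy_norm_ae (b := b) s0 s0) => [|j].
  by rewrite -(energy_norm_ae (b := b) (X := 0) s0 s0) ?energy_norm0 ?expr0n// => j; split; exact: chi0.
have [h1 h2] := H j; split.
  apply: (ae_trans (chi_lin _ _ _ _ _)).
  by apply: filterS h1 => t E /E ->; rewrite mulN1r addNr.
apply: (ae_trans (chi_lin _ _ _ _ _)).
by apply: filterS h2 => t E /E ->; rewrite mulN1r addNr.
Qed.

Lemma resolvent_rel_lin (a : R[i]) alpha z X Y X' Y' :
  resolvent_rel alpha z X Y -> resolvent_rel alpha z X' Y' ->
  resolvent_rel alpha z (a *: X + X') (a *: Y + Y').
Proof.
move=> [p0 [c [Hp Hv bc]]] [p0' [c' [Hp' Hv' bc']]].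
exists (fun j => a * p0 j + p0' j), (a * c + c'); split.
- move=> j; apply: (H1pair_ae (H1pair_lin a (Hp j) (Hp' j))).
  + exact: ae_sym (grad_lin _ _ _ _).
  + apply: ae_sym; apply: (ae_trans (ae_eq_half_line_lin z (vel_lin a X X' j) (vel_lin a Y Y' j))).
    by apply: ae_of_eq => t _; ring.
  + exact: sqint_grad.
  + by apply: square_integrable_lin; exact: sqint_vel.
- move=> j; apply: (H1pair_ae (H1pair_lin a (Hv j) (Hv' j))).
  + exact: ae_sym (vel_lin _ _ _ _).
  + apply: ae_sym; apply: (ae_trans (ae_eq_half_line_lin z (grad_lin a X X' j) (grad_lin a Y Y' j))).
    by apply: ae_of_eq => t _; ring.
  + exact: sqint_vel.
  + by apply: square_integrable_lin; exact: sqint_grad.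
rewrite big_split/= -mulr_sumr.
transitivity (a * (\sum_j p0 j + alpha * c) + (\sum_j p0' j + alpha * c')); first by ring.
by rewrite bc bc' mulr0 addr0.
Qed.

Lemma Re_sgM b z : Re (sg b * z) = (-1) ^+ b * Re z.
Proof.
case: z => x y; case: b; rewrite /sg ?expr1 ?expr0 ?mulN1r ?mul1r//.
Qed.

Lemma resolvent_surjective b alpha z Y : 0 < Re (sg b * z) ->
  N%:R - sg b * alpha != 0 -> exists X, resolvent_rel alpha z X Y.
Proof.
move=> z0 aN.
pose A : sfun := fun j t => sg b * chi (sg b) Y j t.
pose B : sfun := fun j t => - sg b * chi (- sg b) Y j t.
have sA : L2_star A by move=> j; exact: sqint_scaled_chi.
have sB : L2_star B by move=> j; exact: sqint_scaled_chi.
have /choice[ac Hac] j : exists ac : (R -> R[i]) * R[i],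
    H1pair ac.1 (fun t => sg b * z * ac.1 t + A j t) ac.2.
  by have [a [c Hc]] := solve_backward z0 (sA j); exists (a, c).
pose c := (N%:R - sg b * alpha)^-1 * \sum_j (ac j).2.
have /choice[q Hq] j : exists q : R -> R[i],
    H1pair q (fun t => - (sg b * z) * q t + B j t) (2 * c - (ac j).2).
  exact: solve_forward z0 (sB j).
have sa : L2_star (fun j => (ac j).1) by move=> j; case: (Hac j).
have sq : L2_star q by move=> j; case: (Hq j).
have [X HX] := chi_exists b sa sq.
exists X; apply/(resolvent_relP b).
exists (fun j => (ac j).2), (fun j => 2 * c - (ac j).2), c.
apply: (chi_rel_of_solution Hac Hq) => //.
- by move=> j; rewrite addrC subrK.
- by rewrite /c mulVKf.
- by move=> j; split; exact: ae_eq_half_line_refl.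
Qed.

(** Induction on [|S + r|^2 <= 2 |S|^2 + 2 |r|^2]; any factor depending only on the number of edges
    suffices. *)
Lemma cdot_sum_le n (x : 'I_n -> R[i]) :
  cdot (\sum_j x j) (\sum_j x j) <= 2 ^+ n * \sum_j cdot (x j) (x j).
Proof.
elim: n x => [|n IH] x; first by rewrite !big_ord0 /cdot !mul0r addr0 mulr0.
rewrite !big_ord_recr /=; set S := \sum_(i < n) x _; set r := x ord_max.
have h1 : cdot (S + r) (S + r) <= 2 * cdot S S + 2 * cdot r r.
  have := @cdot_young _ 1 S r ltr01; rewrite invr1 !mul1r => H.
  by rewrite cdotDl /cdot Defs.ReD Defs.ImD; move: H; rewrite /cdot; lra.
have h2 := IH (fun i => x (widen_ord (leqnSn n) i)); rewrite -/S in h2.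
have h3 : cdot r r <= 2 ^+ n * cdot r r.
  by rewrite ler_peMl ?cdot_ge0// exprn_ege1// ler1n.
rewrite exprS; move: h1 h2 h3; move: (cdot (S + r) _) (\sum_(i < n) _) (cdot S S) (cdot r r) (2 ^+ n).
move=> *; lra.
Qed.

(** The estimate as plain arithmetic, with sums over the edges: [a], [q] are squared norms of the
    characteristics, [A], [B] those of their sources, [p], [w] the squared traces, [cc] the squared
    vertex velocity, and [D] the square of [|N - s alpha|]. The chain is
    [w <= (2 + L) p <= (2 + L) A / r]. *)
Lemma resolvent_arith (r D K M a q A B p w cc : R) : 0 < r -> 0 < D -> 0 <= K ->
  0 <= M -> 0 <= a -> 0 <= A -> 0 <= B -> 0 <= p ->
  r * a + p <= r^-1 * A -> r * q <= r^-1 * B + w -> w <= 2 * p + K * cc ->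
  D * cc <= M * p ->
  r ^+ 2 * (2^-1 * (a + q)) <= (3 + K * M / D) * (2^-1 * (A + B)).
Proof.
move=> r0 D0 K0 M0 a0 A0 B0 p0 sA sB sw hc.
set L := K * M / D.
have L0 : 0 <= L by rewrite !mulr_ge0 ?invr_ge0// ltW.
have hcc : K * cc <= L * p.
  have -> : L * p = K * (D^-1 * (M * p)) by rewrite /L; ring.
  by rewrite ler_wpM2l// ler_pdivlMl.
have pA : p <= r^-1 * A by have := mulr_ge0 (ltW r0) a0; lra.
have rr : r * r^-1 = 1 by rewrite mulfV// gt_eqF.
have pLA : L * p <= L * (r^-1 * A) by rewrite ler_wpM2l.
have B' : 0 <= r^-1 * B by rewrite mulr_ge0 ?invr_ge0 ?(ltW r0).
have h : r * (a + q) <= r^-1 * ((3 + L) * A + B).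
  have -> : r^-1 * ((3 + L) * A + B) = 3 * (r^-1 * A) + L * (r^-1 * A) + r^-1 * B by ring.
  rewrite mulrDr; lra.
have h2 : r * (r * (a + q)) <= r * (r^-1 * ((3 + L) * A + B)) by rewrite ler_pM2l.
rewrite (mulrA r r^-1) rr mul1r in h2.
have LB := mulr_ge0 L0 B0.
have -> : r ^+ 2 * (2^-1 * (a + q)) = 2^-1 * (r * (r * (a + q))) by ring.
have -> : (3 + L) * (2^-1 * (A + B)) = 2^-1 * ((3 + L) * (A + B)) by ring.
rewrite ler_wpM2l ?invr_ge0//; rewrite (le_trans h2)// [leRHS]mulrDr lerD2l.
by rewrite ler_peMl//; lra.
Qed.

(** [backward_bound] controls the traces [P0], the vertex condition passes from them to [c] at the
    price of [1 / |N - s alpha|], and [Q0 = 2 c - P0] is the datum of [forward_bound]. *)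
Lemma resolvent_bound_sqr b alpha z X Y : 0 < Re (sg b * z) ->
  N%:R - sg b * alpha != 0 -> resolvent_rel alpha z X Y ->
  Re (sg b * z) ^+ 2 * energy_norm X ^+ 2 <=
  (3 + 8 * N%:R * 2 ^+ N / cdot (N%:R - sg b * alpha) (N%:R - sg b * alpha)) *
    energy_norm Y ^+ 2.
Proof.
move=> z0 aN /(resolvent_relP b)[P0 [Q0 [c [HP HQ PQ bc]]]].
set r := Re (sg b * z) in z0 *; set D := cdot (_ - _) _.
have D0 : 0 < D.
  rewrite lt_neqAle cdot_ge0 andbT eq_sym; apply: contraNneq aN => /cdot_eq0 ->.
  by [].
rewrite (energy_norm_chi b X) (energy_norm_source b Y).
set a := fun j => ip (chi (sg b) X j) (chi (sg b) X j).
set q := fun j => ip (chi (- sg b) X j) (chi (- sg b) X j).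
set A := fun j => ip (fun t => sg b * chi (sg b) Y j t) (fun t => sg b * chi (sg b) Y j t).
set B := fun j => ip (fun t => - sg b * chi (- sg b) Y j t) (fun t => - sg b * chi (- sg b) Y j t).
pose p j := cdot (P0 j) (P0 j); pose w j := cdot (Q0 j) (Q0 j).
have hA j : r * a j + p j <= r^-1 * A j.
  exact: backward_bound z0 (sqint_scaled_chi _ _ _ _) (HP j).
have hB j : r * q j <= r^-1 * B j + w j.
  exact: forward_bound z0 (sqint_scaled_chi _ _ _ _) (HQ j).
(* [|2 c - P0|^2 <= 2 |P0|^2 + 2 |2 c|^2]; this is the origin of the constant 8. *)
have hw j : w j <= 2 * p j + 8 * cdot c c.
  have -> : w j = cdot (2 * c - P0 j) (2 * c - P0 j).
    by rewrite /w (_ : Q0 j = 2 * c - P0 j)// -(PQ j) addrC addKr.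
  rewrite /p; case: (P0 j) => x y; case: (c) => x' y'; rewrite /cdot /=.
  have := (sqr_ge0 (2 * x' + x), sqr_ge0 (2 * y' + y)) => -[h1 h2]; lra.
have hc : D * cdot c c <= 2 ^+ N * \sum_j p j.
  by rewrite -cdot_mul2 bc; exact: cdot_sum_le.
rewrite !big_split/=.
have sA : r * \sum_j a j + \sum_j p j <= r^-1 * \sum_j A j.
  by rewrite !mulr_sumr -big_split/=; apply: ler_sum => j _; exact: hA.
have sB : r * \sum_j q j <= r^-1 * \sum_j B j + \sum_j w j.
  by rewrite !mulr_sumr -big_split/=; apply: ler_sum => j _; exact: hB.
have sw : \sum_j w j <= 2 * \sum_j p j + 8 * N%:R * cdot c c.
  apply: (@le_trans _ _ (\sum_j (2 * p j + 8 * cdot c c))); first exact: ler_sum.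
  rewrite big_split/= -mulr_sumr sumr_const card_ord.
  by have -> : 8 * cdot c c *+ N = 8 * N%:R * cdot c c by rewrite -[LHS]mulr_natr; ring.
have a0 : 0 <= \sum_j a j by apply: sumr_ge0 => j _; exact: ip_ge0.
have A0 : 0 <= \sum_j A j by apply: sumr_ge0 => j _; exact: ip_ge0.
have B0 : 0 <= \sum_j B j by apply: sumr_ge0 => j _; exact: ip_ge0.
have p0 : 0 <= \sum_j p j by apply: sumr_ge0 => j _; exact: cdot_ge0.
apply: resolvent_arith a0 A0 B0 p0 sA sB sw hc => //; exact: mulr_ge0.
Qed.

End Resolvent.

(** * Weyl sequences and eigenvectors *)

Section SpectralParts.
Context {R : realType} (N : nat).
Local Notation Re := (@complex.Re R).
Local Notation Im := (@complex.Im R).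
Local Notation sfun := (@star_fun R N).
Implicit Types (u v F G A B : sfun) (X Y : @energy_space R N) (j : 'I_N) (c d z alpha s : R[i]).
Implicit Types (b : bool) (f g h : R -> R[i]).

Lemma sum_cst_ord (x : R) : \sum_(j < N) x = N%:R * x.
Proof. by rewrite sumr_const card_ord -[LHS]mulr_natl. Qed.

(** The functions of [weyl_pair] at the projection of [z] to the axis are put in one characteristic
    of every edge, the other being 0, so all vertex values vanish. The equation at [z] leaves the
    source [r f + h] with [r = - (Re z + e)], and the relations between [f] and [h] make the ratio
    of squared norms exactly [Re z ^+ 2 + e ^+ 2]. *)
Lemma weyl_sequence alpha z (e : R) : (0 < N)%N -> 0 < e -> exists X Y,
  [/\ resolvent_rel alpha z X Y, 0 < energy_norm X &
      energy_norm Y ^+ 2 = (Re z ^+ 2 + e ^+ 2) * energy_norm X ^+ 2].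
Proof.
move=> N0 e0; pose y : R[i] := 0 +i* Im z.
have [f [h [Hf sh hh fh ff]]] := @weyl_pair R y e erefl e0.
have [sf _ _] := Hf.
pose r := - (Re z + e).
pose a : sfun := fun _ => f; pose q : sfun := fun _ _ => 0.
pose A : sfun := fun _ t => r%:C * f t + h t; pose B : sfun := fun _ _ => 0.
have sA : L2_star A by move=> j; exact: square_integrable_lin.
have sB : L2_star B by move=> j; exact: square_integrable0.
have [||||||X [Y [XY nX nY]]] := @resolvent_exists R N false alpha z a q A B
    (fun=> 0) (fun=> 0) 0.
- move=> j; apply: (eq_H1pair Hf) => // t.
  rewrite /a /A /sg expr0 mul1r addrA -mulrDl; congr (_ * _ + _).
  by rewrite /r /y; case: (z) => x x'; apply: complex_eqP => /=; ring.
- by move=> j; apply: (eq_H1pair (@H1pair0 R)) => // t; rewrite /q /B mulr0 addr0.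
- by move=> j; rewrite mulr0 addr0.
- by rewrite mulr0 big1.
- exact: sA.
- exact: sB.
exists X, Y; split => //.
  rewrite lt_neqAle energy_norm_ge0 andbT eq_sym -sqrf_eq0 nX /a /q.
  have ff0 : ip f f != 0.
    apply/eqP => ff0; have f2 : ip h h = 0 by rewrite -fh -ff ff0 !mulr0.
    by move: hh; rewrite f2 mulr0 => /eqP; rewrite eq_sym oner_eq0.
  by rewrite sum_cst_ord ip00 addr0 !mulf_neq0 ?invr_eq0 ?pnatr_eq0 -?lt0n.
rewrite nX nY /a /q /A /B !sum_cst_ord ip00 !addr0.
have sr := sqintZ r%:C sf.
rewrite ipDl//; last exact: sqintD.
rewrite !ipDr// !ipZl// !ipZr// (ipC h f).
have -> : ip h h = 2 * e * (e * ip f f) by rewrite ff fh.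
by rewrite -ff /r; ring.
Qed.

(** The backward solution has trace minus the integral of [exp(- y s) A(s)], so by Cauchy-Schwarz
    the source [exp(- conj(y) x)] maximises the trace for a given norm. This trace is then amplified
    by the reflection coefficient at the vertex and carried away by the forward characteristic. *)
Lemma resolvent_lower b alpha z : (0 < N)%N -> 0 < Re (sg b * z) ->
  0 < Re (sg b * alpha) -> N%:R - sg b * alpha != 0 ->
  exists X Y, [/\ resolvent_rel alpha z X Y, 0 < energy_norm Y &
    energy_norm Y ^+ 2 <= 4 * Re (sg b * z) ^+ 2 *
      cdot (N%:R - sg b * alpha) (N%:R - sg b * alpha) * energy_norm X ^+ 2].
Proof.
move=> N0 z0 al0 aN; set y := sg b * z; set r := Re y in z0 *.
have y0 : 0 < Re y^* by case: (y) @r z0.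
have [h Hh] := solve_forward 1 y0 (@square_integrable0 R).
have [q0 Hq] := solve_forward 1 z0 (@square_integrable0 R).
have [sh _ _] := Hh; have [sq _ _] := Hq.
have rr : Re y^* = r by rewrite /r; case: (y).
have drop0 w (f : R -> R[i]) : (fun t => - w * f t + 0) = (fun t => - w * f t).
  by apply/funext => t; rewrite addr0.
rewrite drop0 in Hh; rewrite drop0 in Hq.
have nh : 2 * r * ip h h = 1.
  by have := H1pair_energy Hh; rewrite ip_mul_self// ReN rr /cdot /=; lra.
have nq : 2 * r * ip q0 q0 = 1.
  by have := H1pair_energy Hq; rewrite ip_mul_self// ReN -/r /cdot /=; lra.
(* The value for which [k h] solves the backward equation with source [h]: it amounts to
   [- k (conj(y) + y) = 1]. *)
pose k : R[i] := (- (2 * r)^-1)%:C.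
have yk : - k * (y^* + y) = 1.
  rewrite /k /r; move: z0; rewrite /r; case: (y) => x x' /= x0.
  by apply: complex_eqP => /=; field; rewrite ?gt_eqF.
pose c := (N%:R - sg b * alpha)^-1 * (N%:R * k).
pose d := 2 * c - k.
have [||||||X [Y [XY nX nY]]] := @resolvent_exists R N b alpha z
    (fun _ t => k * h t) (fun _ t => d * q0 t) (fun _ => h) (fun _ _ => 0)
    (fun=> k) (fun=> d) c.
- move=> j; apply: (eq_H1pair (H1pairZ k Hh)) => [//|t|]; last by rewrite mulr1.
  transitivity (y * (k * h t) + (- k * (y^* + y)) * h t); first by ring.
  by rewrite yk mul1r.
- move=> j; apply: (eq_H1pair (H1pairZ d Hq)) => [//|t|]; last by rewrite mulr1.
  by rewrite -/y; ring.
- by move=> j; rewrite /d addrC subrK.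
- by rewrite /c mulVKf// sumr_const card_ord -[RHS]mulr_natl.
- by move=> j.
- by move=> j; exact: square_integrable0.
have hN : 0 < N%:R :> R by rewrite ltr0n.
have r20 : 2 * r != 0 by rewrite mulf_neq0 ?gt_eqF.
have h0 : ip h h = (2 * r)^-1 by apply: (mulfI r20); rewrite nh mulfV.
have q00 : ip q0 q0 = (2 * r)^-1 by apply: (mulfI r20); rewrite nq mulfV.
have rV : 0 < (2 * r)^-1 by rewrite invr_gt0 mulr_gt0.
rewrite !sum_cst_ord ip00 addr0 h0 in nY.
rewrite !sum_cst_ord !ip_self_mul2// h0 q00 in nX.
exists X, Y; split => //.
  rewrite lt_neqAle energy_norm_ge0 andbT eq_sym -sqrf_eq0 nY.
  by rewrite gt_eqF// mulr_gt0 ?invr_gt0// mulr_gt0.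
rewrite nX nY; set D := cdot _ _.
(* Reflection at the vertex: [d = k (N + s alpha) / (N - s alpha)]. *)
have dE : (N%:R - sg b * alpha) * d = k * (N%:R + sg b * alpha).
  rewrite /d /c mulrBr mulrCA mulVKf//; ring.
have Dd : D * cabs d ^+ 2 = cdot k k * cdot (N%:R + sg b * alpha) (N%:R + sg b * alpha).
  by rewrite -cdot_mul2 -dE cdot_mul2 cabs_sqr /cdot !expr2.
(* The sign of [Re (s alpha)] enters here: it prevents the numerator of the reflection coefficient
   from being small. *)
have Dl : N%:R ^+ 2 <= cdot (N%:R + sg b * alpha) (N%:R + sg b * alpha).
  have -> : (N%:R : R[i]) = (N%:R : R)%:C by rewrite rmorph_nat.
  move: al0; case: (sg b * alpha) => x x' /= x0; rewrite /cdot /=.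
  have := mulr_gt0 hN x0; have := (sqr_ge0 x, sqr_ge0 x') => -[]; lra.
have kk : cdot k k = (2 * r)^-1 ^+ 2 by rewrite /cdot /k /=; ring.
have N1 : 1 <= (N%:R : R) ^+ 2 by rewrite exprn_ege1// ler1n.
have main : 1 <= 4 * r ^+ 2 * (D * cabs d ^+ 2).
  rewrite Dd kk mulrA (_ : 4 * r ^+ 2 * (2 * r)^-1 ^+ 2 = 1) ?mul1r.
    exact: le_trans Dl.
  by field; rewrite gt_eqF.
have D0 : 0 <= D by exact: cdot_ge0.
have E : 4 * r ^+ 2 * D * (2^-1 * (N%:R * (cabs k ^+ 2 * (2 * r)^-1 + cabs d ^+ 2 * (2 * r)^-1)))
   = 2^-1 * (N%:R * (2 * r)^-1) * (4 * r ^+ 2 * D * cabs k ^+ 2 + 4 * r ^+ 2 * (D * cabs d ^+ 2)).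
  by ring.
have p0 : 0 <= 2^-1 * (N%:R * (2 * r)^-1) by apply: mulr_ge0; [rewrite invr_ge0|apply: mulr_ge0; [exact: ltW|exact: ltW]].
rewrite E (ler_peMr p0)//.
have r4 : 0 <= 4 * r ^+ 2 by rewrite mulr_ge0 ?sqr_ge0.
have := mulr_ge0 (mulr_ge0 r4 D0) (sqr_ge0 (cabs k)).
by move=> H; apply: (le_trans main); rewrite lerDr.
Qed.

Lemma resolvent_rel0_H1pair b alpha z X : resolvent_rel alpha z X 0 -> exists P0 Q0 c,
  [/\ forall j, H1pair (chi (sg b) X j) (fun t => sg b * z * chi (sg b) X j t) (P0 j),
      forall j, H1pair (chi (- sg b) X j) (fun t => - (sg b * z) * chi (- sg b) X j t) (Q0 j)
    & forall j, P0 j + Q0 j = 2 * c].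
Proof.
move=> /(resolvent_relP b)[P0 [Q0 [c [HP HQ PQ bc]]]].
exists P0, Q0, c; split => // j.
  apply: (H1pair_ae (HP j)) => //; [exact: ae_eq_half_line_refl| |exact: sqint_chi|exact: sqint_scaled_chi].
  by apply: filterS (chi0 (sg b) j) => t H /H ->; rewrite mulr0 addr0.
apply: (H1pair_ae (HQ j)) => //; [exact: ae_eq_half_line_refl| |exact: sqint_chi|exact: sqint_scaled_chi].
by apply: filterS (chi0 (- sg b) j) => t H /H ->; rewrite mulr0 addr0.
Qed.

Lemma imaginary_no_kernel alpha z X : Re z = 0 -> resolvent_rel alpha z X 0 -> X = 0.
Proof.
move=> z0 /(@resolvent_rel0_H1pair false)[P0 [Q0 [c [HP HQ _]]]].
have r0 : Re (sg false * z) = 0 by rewrite Re_sgM z0 mulr0.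
apply: (chi_eq (b := false)) => j; split.
  exact: ae_trans (imaginary_kernel r0 (HP j)) (ae_sym (chi0 _ j)).
have r0' : Re (- (sg false * z)) = 0 by rewrite ReN r0 oppr0.
exact: ae_trans (imaginary_kernel r0' (HQ j)) (ae_sym (chi0 _ j)).
Qed.

Lemma ipNN f : ip (fun t => - f t) (fun t => - f t) = ip f f.
Proof. by apply: eq_Rintegral => t _; case: (f t) => x y /=; ring. Qed.

Lemma ae_scale (a : R[i]) f g : ae_eq_half_line f g ->
  ae_eq_half_line (fun t => a * f t) (fun t => a * g t).
Proof. by apply: filterS => t H /H ->. Qed.

(** The characteristics are approximated independently by functions with zero trace, so the vertex
    condition holds with [c = 0] whatever [alpha] is. *)
Lemma dense_range alpha z Y (e : R) : Re z = 0 -> 0 < e ->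
  exists X Y', resolvent_rel alpha z X Y' /\ energy_norm (Y - Y') < e.
Proof.
move=> z0 e0.
have r0 : Re (sg false * z) = 0 by rewrite Re_sgM z0 mulr0.
have r0' : Re (- (sg false * z)) = 0 by rewrite ReN r0 oppr0.
pose s : R[i] := sg false.
pose A0 : sfun := fun j t => s * chi s Y j t.
pose B0 : sfun := fun j t => - s * chi (- s) Y j t.
(* Two errors [eta] on each of [N] edges, halved by the norm formula, add up to
   [e ^+ 2 * N / (N + 1)], which is strictly below [e ^+ 2]. *)
pose eta := e ^+ 2 / N.+1%:R.
have eta0 : 0 < eta by rewrite divr_gt0 ?exprn_gt0.
have /choice[fh Hfh] j : exists fh : (R -> R[i]) * (R -> R[i]), H1pair fh.1 fh.2 0 /\
    ip (fun t => fh.2 t - s * z * fh.1 t - A0 j t) (fun t => fh.2 t - s * z * fh.1 t - A0 j t) < eta.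
  have [f [h H]] := dense_range_imaginary r0 (sqint_scaled_chi s s Y j) eta0.
  by exists (f, h).
have /choice[gk Hgk] j : exists gk : (R -> R[i]) * (R -> R[i]), H1pair gk.1 gk.2 0 /\
    ip (fun t => gk.2 t - - (s * z) * gk.1 t - B0 j t) (fun t => gk.2 t - - (s * z) * gk.1 t - B0 j t) < eta.
  have [f [h H]] := dense_range_imaginary r0' (sqint_scaled_chi (- s) (- s) Y j) eta0.
  by exists (f, h).
pose A : sfun := fun j t => (fh j).2 t - s * z * (fh j).1 t.
pose B : sfun := fun j t => (gk j).2 t - - (s * z) * (gk j).1 t.
have sub (w : R[i]) (f g : R -> R[i]) : square_integrable f -> square_integrable g ->
    square_integrable (fun t => g t - w * f t).
  move=> sf sg'; have := square_integrable_lin (- w) sf sg'.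
  by under eq_fun do rewrite mulNr addrC.
have sA0 : L2_star A0 by move=> j; exact: sqint_scaled_chi.
have sB0 : L2_star B0 by move=> j; exact: sqint_scaled_chi.
have sA : L2_star A by move=> j; have [[sf sh _] _] := Hfh j; exact: sub.
have sB : L2_star B by move=> j; have [[sf sh _] _] := Hgk j; exact: sub.
have sa : L2_star (fun j => (fh j).1) by move=> j; have [[sf sh _] _] := Hfh j.
have sq : L2_star (fun j => (gk j).1) by move=> j; have [[sf sh _] _] := Hgk j.
have [X HX] := chi_exists false sa sq.
have [||Y' HY] := @chi_exists R N false (fun j t => s * A j t) (fun j t => - s * B j t).
- by move=> j; exact: sqintZ.
- by move=> j; exact: sqintZ.
have s1 : s = 1 by rewrite /s /sg expr0.
exists X, Y'; split.
  apply/(resolvent_relP false); exists (fun=> 0), (fun=> 0), 0.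
  apply: (@chi_rel_of_solution _ _ _ _ _ _ _ (fun j => (fh j).1) (fun j => (gk j).1) A B) => //.
  - move=> j; have [H _] := Hfh j; apply: (eq_H1pair H) => // t.
    by rewrite /A -/s; ring.
  - move=> j; have [H _] := Hgk j; apply: (eq_H1pair H) => // t.
    by rewrite /B -/s; ring.
  - by move=> j; rewrite mulr0 addr0.
  - by rewrite mulr0 big1.
  - move=> j; have [h1 h2] := HY j; split.
      by apply: filterS h1 => t H /H ->; rewrite -/s s1; ring.
    by apply: filterS h2 => t H /H ->; rewrite -/s s1; ring.
rewrite -(@ltr_pXn2r _ 2)// ?nnegrE ?energy_norm_ge0 ?ltW//.
have -> : Y - Y' = (-1) *: Y' + Y by rewrite scaleN1r addrC.
rewrite (energy_norm_source false).
apply: (@le_lt_trans _ _ (2^-1 * \sum_(j < N) (eta + eta))).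
  rewrite ler_pM2l ?invr_gt0//; apply: ler_sum => j _; have [h1 h2] := HY j.
  have [_ i1] := Hfh j; have [_ i2] := Hgk j.
  apply: lerD; apply: ltW.
    rewrite (@ae_ip _ _ (fun t => - (A j t - A0 j t)) _ (fun t => - (A j t - A0 j t)))//.
    + by rewrite ipNN.
    + exact: sqint_scaled_chi.
    + by have := sqintZ (-1) (sub 1 _ _ (sA0 j) (sA j)); under eq_fun do rewrite mul1r mulN1r.
    + exact: sqint_scaled_chi.
    + by have := sqintZ (-1) (sub 1 _ _ (sA0 j) (sA j)); under eq_fun do rewrite mul1r mulN1r.
    + apply: (ae_trans (ae_scale s (chi_lin s (-1) Y' Y j))).
      by apply: filterS h1 => t H /H ->; rewrite /A0 -/s s1; ring.
    apply: (ae_trans (ae_scale s (chi_lin s (-1) Y' Y j))).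
    by apply: filterS h1 => t H /H ->; rewrite /A0 -/s s1; ring.
  rewrite (@ae_ip _ _ (fun t => - (B j t - B0 j t)) _ (fun t => - (B j t - B0 j t)))//.
  + by rewrite ipNN.
  + exact: sqint_scaled_chi.
  + by have := sqintZ (-1) (sub 1 _ _ (sB0 j) (sB j)); under eq_fun do rewrite mul1r mulN1r.
  + exact: sqint_scaled_chi.
  + by have := sqintZ (-1) (sub 1 _ _ (sB0 j) (sB j)); under eq_fun do rewrite mul1r mulN1r.
  + apply: (ae_trans (ae_scale (- s) (chi_lin (- s) (-1) Y' Y j))).
    by apply: filterS h2 => t H /H ->; rewrite /B0 -/s s1; ring.
  apply: (ae_trans (ae_scale (- s) (chi_lin (- s) (-1) Y' Y j))).
  by apply: filterS h2 => t H /H ->; rewrite /B0 -/s s1; ring.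
rewrite sum_cst_ord.
have -> : 2^-1 * (N%:R * (eta + eta)) = e ^+ 2 * (N%:R / N.+1%:R).
  by rewrite /eta; field; rewrite addrC natr1 pnatr_eq0.
by rewrite gtr_pMr ?exprn_gt0// ltr_pdivrMr// mul1r ltr_nat.
Qed.

End SpectralParts.

(** * Eigenvectors and Jordan chains at the critical parameter *)

Section Eigenvectors.
Context {R : realType} (N : nat).
Local Notation Re := (@complex.Re R).
Local Notation Im := (@complex.Im R).
Local Notation sfun := (@star_fun R N).
Implicit Types (X Y : @energy_space R N) (j : 'I_N) (c d z alpha s : R[i]).
Implicit Types (b : bool) (f g h : R -> R[i]).

Lemma critical_eq0 b : N%:R - sg b * (sg b * N%:R) = 0 :> R[i].
Proof. by case: (@sgP R b) => ->; ring. Qed.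

(** States with no incoming characteristic and the same outgoing profile [g] on all edges. At
    [alpha = s N] both sides of the vertex condition vanish on them, so the trace of [g] remains
    free. *)
Definition outgoing b g X := forall j,
  ae_eq_half_line (chi (sg b) X j) (fun=> 0) /\ ae_eq_half_line (chi (- sg b) X j) g.

Lemma outgoing_exists b g : square_integrable g -> exists X, outgoing b g X.
Proof.
move=> sg'; have [||X HX] := @chi_exists R N b (fun _ _ => 0) (fun=> g).
- by move=> j; exact: square_integrable0.
- by move=> j.
by exists X.
Qed.

Lemma outgoing_rel b z g f c X Y :
  H1pair g (fun t => - (sg b * z) * g t + - sg b * f t) c ->
  outgoing b g X -> outgoing b f Y -> square_integrable f ->
  resolvent_rel (sg b * N%:R) z X Y.
Proof.
move=> Hg HX HY sf; apply/(resolvent_relP b).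
exists (fun=> 0), (fun=> c), (2^-1 * c).
apply: (@chi_rel_of_solution _ _ _ _ _ _ _ (fun _ _ => 0) (fun=> g)
  (fun _ _ => 0) (fun _ t => - sg b * f t)) => //.
- by move=> j; apply: (eq_H1pair (@H1pair0 R)) => // t; rewrite mulr0 addr0.
- by move=> j; rewrite add0r mulrA mulfV ?mul1r// pnatr_eq0.
- by rewrite critical_eq0 mul0r big1.
move=> j; have [h1 h2] := HY j; split.
  by apply: filterS h1 => t H /H ->; rewrite mulr0.
by apply: filterS h2 => t H /H ->.
Qed.

Lemma outgoing_step b z g Y : 0 < Re (sg b * z) -> square_integrable g ->
  outgoing b g Y -> exists X g', [/\ square_integrable g', outgoing b g' X &
    resolvent_rel (sg b * N%:R) z X Y].
Proof.
move=> z0 sg' HY.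
have [g' Hg'] := solve_forward 0 z0 (sqintZ (- sg b) sg').
have [sg'' _ _] := Hg'.
have [X HX] := outgoing_exists b sg''.
exists X, g'; split => //.
exact: (outgoing_rel Hg' HX HY sg').
Qed.

Lemma outgoing0 b : outgoing b (fun=> 0) (0 : @energy_space R N).
Proof. by move=> j; split; exact: chi0. Qed.

Lemma eigenvector_exists b z : (0 < N)%N -> 0 < Re (sg b * z) -> exists X g,
  [/\ X != 0, outgoing b g X, H1pair g (fun t => - (sg b * z) * g t) 1 &
      resolvent_rel (sg b * N%:R) z X 0].
Proof.
move=> N0 z0.
have [g Hg] := solve_forward 1 z0 (@square_integrable0 R).
have Hg' : H1pair g (fun t => - (sg b * z) * g t) 1.
  by apply: (eq_H1pair Hg) => // t; rewrite addr0.
have [sg' _ _] := Hg.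
have [X HX] := outgoing_exists b sg'.
exists X, g; split => //.
  apply/eqP => X0; have := energy_norm_ae (b := b)
    (fun=> @square_integrable0 R) (fun=> sg') HX.
  rewrite X0 energy_norm0 expr0n /= ip00 add0r sum_cst_ord => /esym/eqP.
  rewrite !mulf_eq0 invr_eq0 !pnatr_eq0 (gtn_eqF N0) /= => /eqP g0.
  have := H1pair_energy Hg'; rewrite ip_mul_self// g0 !mulr0 /cdot /=.
  by move=> /eqP; rewrite eq_sym oppr_eq0 !mulr0 addr0 mulr1 oner_eq0.
apply: (@outgoing_rel b z g (fun=> 0) 1) => //; last exact: square_integrable0.
  by apply: (eq_H1pair Hg') => // t; rewrite mulr0 addr0.
exact: outgoing0.
Qed.

(** The recursion runs on a state together with its profile, since the next vector is obtained by
    solving with that profile as source. *)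
Lemma eigenvector_chain b z : (0 < N)%N -> 0 < Re (sg b * z) ->
  exists X_ : nat -> @energy_space R N, [/\ X_ 0%N != 0,
    resolvent_rel (sg b * N%:R) z (X_ 0%N) 0 &
    forall k, resolvent_rel (sg b * N%:R) z (X_ k.+1) (X_ k)].
Proof.
move=> N0 z0; have [X [g [X0 HX Hg rX]]] := eigenvector_exists N0 z0.
pose T := {Xg : @energy_space R N * (R -> R[i]) |
  square_integrable Xg.2 /\ outgoing b Xg.2 Xg.1}.
have /choice[F HF] : forall t : T, exists t' : T,
    resolvent_rel (sg b * N%:R) z (sval t').1 (sval t).1.
  move=> [[Y f] [/= sf HY]].
  have [X' [g' [sg' HX' rX']]] := outgoing_step z0 sf HY.
  by exists (exist _ (X', g') (conj sg' HX')).
have sg' : square_integrable g by case: Hg.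
pose t0 : T := exist _ (X, g) (conj sg' HX).
exists (fun k => (sval (iter k F t0)).1).
split; [exact: X0|exact: rX|move=> k; exact: (HF (iter k F t0))].
Qed.

(** Without source, [backward_bound] kills the incoming characteristics and their traces. The
    outgoing traces are then all equal to [2 c], and uniqueness of the forward problem leaves only
    multiples of [X0]. *)
Lemma eigenspace_line b z X X0 g : (0 < N)%N -> 0 < Re (sg b * z) ->
  outgoing b g X0 -> H1pair g (fun t => - (sg b * z) * g t) 1 ->
  resolvent_rel (sg b * N%:R) z X 0 -> exists a : R[i], X = a *: X0.
Proof.
move=> N0 z0 H0 Hg /(@resolvent_rel0_H1pair _ _ b)[P0 [Q0 [c [HP HQ PQ]]]].
have add0 (f : R -> R[i]) : (fun t => f t + (fun=> 0) t) = f.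
  by apply/funext => t; rewrite addr0.
have hP j : ae_eq_half_line (chi (sg b) X j) (fun=> 0) /\ P0 j = 0.
  have Hj : H1pair (chi (sg b) X j) (fun t => sg b * z * chi (sg b) X j t + (fun=> 0) t) (P0 j).
    by rewrite add0.
  have := backward_bound z0 (@square_integrable0 R) Hj; rewrite ip00 mulr0 => h.
  have h1 := cdot_ge0 (P0 j); have h2 := ip_ge0 (chi (sg b) X j).
  have h3 := mulr_ge0 (ltW z0) h2.
  have e1 : cdot (P0 j) (P0 j) = 0 by lra.
  have e2 : Re (sg b * z) * ip (chi (sg b) X j) (chi (sg b) X j) = 0 by lra.
  split; last exact: cdot_eq0.
  apply: ip_eq0; first exact: sqint_chi.
  by apply: (mulfI (lt0r_neq0 z0)); rewrite e2 mulr0.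
exists (2 * c); apply: (chi_eq (b := b)) => j; have [h1 h2] := H0 j; split.
  apply: (ae_trans (hP j).1); apply: ae_sym.
  have := chi_lin (sg b) (2 * c) X0 0 j; rewrite addr0 => E.
  apply: (ae_trans E); apply: filterS2 h1 (chi0 (sg b) j) => t A B Ht.
  by rewrite (A Ht) (B Ht) mulr0 addr0.
have Qc : Q0 j = 2 * c by rewrite -(PQ j) (hP j).2 add0r.
(* The difference with [2 c] times the profile solves the forward equation with zero source and zero
   trace, so [forward_bound] forces it to vanish. *)
have HD : H1pair (fun t => - (2 * c) * g t + chi (- sg b) X j t)
    (fun t => - (sg b * z) * (- (2 * c) * g t + chi (- sg b) X j t) + (fun=> 0) t) 0.
  apply: (eq_H1pair (H1pair_lin (- (2 * c)) Hg (HQ j))) => // [t|].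
    by rewrite addr0; ring.
  by rewrite Qc mulr1 addNr.
have [sD _ _] := HD.
have := forward_bound z0 (@square_integrable0 R) HD; rewrite ip00 mulr0 add0r.
rewrite [cdot 0 0](_ : _ = 0); last by rewrite /cdot !mul0r addr0.
move=> h; have h4 := ip_ge0 (fun t => - (2 * c) * g t + chi (- sg b) X j t).
have h5 := mulr_ge0 (ltW z0) h4.
have e : ip (fun t => - (2 * c) * g t + chi (- sg b) X j t)
  (fun t => - (2 * c) * g t + chi (- sg b) X j t) = 0.
  by apply: (mulfI (lt0r_neq0 z0)); rewrite mulr0; lra.
have E := ip_eq0 sD e.
apply: ae_sym; have := chi_lin (- sg b) (2 * c) X0 0 j; rewrite addr0 => E'.
apply: (ae_trans E'); apply: filterS2 E (filterI h2 (chi0 (- sg b) j)) => t A [B C] Ht.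
rewrite (B Ht) (C Ht) addr0; have := A Ht; rewrite mulNr addrC => /eqP.
by rewrite subr_eq0 => /eqP ->.
Qed.

End Eigenvectors.

(** * The spectrum *)

Section Assembly.
Context {R : realType} (N : nat) (N_gt0 : (0 < N)%N).
Local Notation Re := (@complex.Re R).
Local Notation Im := (@complex.Im R).
Implicit Types (X Y : @energy_space R N) (j : 'I_N) (c d z alpha s : R[i]) (b : bool).
Local Notation shift alpha z := (op_shift (wave_operator N alpha) z).
Local Notation norm := (@energy_norm R N).

Lemma shift_rel alpha z X : op_dom (shift alpha z) X ->
  resolvent_rel alpha z X (op_act (shift alpha z) X).
Proof. by move=> dX; apply/(op_shift_wave _ _ _ _ N_gt0). Qed.

Lemma rel_shift alpha z X Y : resolvent_rel alpha z X Y ->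
  op_dom (shift alpha z) X /\ op_act (shift alpha z) X = Y.
Proof. by move=> /(op_shift_wave _ _ _ _ N_gt0). Qed.

(** Subtracting a known solution from itself spares a direct check of the domain conditions on the
    zero class. *)
Lemma resolvent_rel0 alpha z : resolvent_rel alpha z (0 : @energy_space R N) 0.
Proof.
have [X [Y [H _ _]]] := weyl_sequence alpha z N_gt0 ltr01.
have := resolvent_rel_lin (-1) H H; by rewrite !scaleN1r !addNr.
Qed.

Lemma resolvent_relB alpha z X Y X' Y' : resolvent_rel alpha z X Y ->
  resolvent_rel alpha z X' Y' -> resolvent_rel alpha z (X' - X) (Y' - Y).
Proof.
move=> H H'; have := resolvent_rel_lin (-1) H H'.
by rewrite !scaleN1r (addrC _ X') (addrC _ Y').
Qed.

Lemma resolvent_relZ (a : R[i]) alpha z X Y : resolvent_rel alpha z X Y ->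
  resolvent_rel alpha z (a *: X) (a *: Y).
Proof.
by move=> H; have := resolvent_rel_lin a H (resolvent_rel0 alpha z); rewrite !addr0.
Qed.

Definition resolvent_injective alpha z := forall X X' Y,
  resolvent_rel alpha z X Y -> resolvent_rel alpha z X' Y -> X = X'.

(** [op_inv] selects a preimage by choice, with default value 0; exhibiting one solution rules out
    the default. *)
Lemma op_inv_spec alpha z X Y : resolvent_rel alpha z X Y ->
  resolvent_rel alpha z (op_inv (shift alpha z) Y) Y.
Proof.
move=> /rel_shift XY.
have [dX aX] := @xgetPex _ 0 [set x | op_dom (shift alpha z) x /\
  op_act (shift alpha z) x = Y] (ex_intro _ X XY).
by apply/(op_shift_wave _ _ _ _ N_gt0); split; [exact: dX|exact: aX].
Qed.

Lemma op_inv_rel alpha z X Y : resolvent_injective alpha z ->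
  resolvent_rel alpha z X Y -> op_inv (shift alpha z) Y = X.
Proof. by move=> inj XY; exact: (inj _ _ Y (op_inv_spec XY) XY). Qed.

Lemma op_norm_ge alpha z X Y : resolvent_injective alpha z ->
  resolvent_rel alpha z X Y -> 0 < norm Y ->
  ((norm X / norm Y)%:E <= op_norm norm (op_inv (shift alpha z)))%E.
Proof.
move=> inj XY Y0; pose a : R[i] := ((norm Y)^-1)%:C.
have ca : cabs a = (norm Y)^-1.
  by rewrite /cabs /= expr0n addr0 sqrtr_sqr ger0_norm ?invr_ge0 ?ltW.
apply: ereal_sup_ubound; exists (a *: Y).
  by rewrite /= energy_normZ ca mulVf// gt_eqF.
by rewrite (op_inv_rel inj (resolvent_relZ a XY)) energy_normZ ca mulrC.
Qed.

(** The square root of [Re z ^+ 2 + e ^+ 2] is bounded by [|Re z| + e]. The shift [e] also keeps the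
    bound meaningful on the imaginary axis. *)
Lemma weyl_norm_ge alpha z (e : R) : resolvent_injective alpha z -> 0 < e ->
  ((`|Re z| + e)^-1%:E <= op_norm norm (op_inv (shift alpha z)))%E.
Proof.
move=> inj e0; have [X [Y [XY X0 YX]]] := weyl_sequence alpha z N_gt0 e0.
have q0 : 0 < Re z ^+ 2 + e ^+ 2 by rewrite ltr_wpDl ?sqr_ge0 ?exprn_gt0.
have Y0 : 0 < norm Y.
  by rewrite lt_neqAle energy_norm_ge0 andbT eq_sym -sqrf_eq0 YX mulf_neq0 ?sqrf_eq0 ?gt_eqF.
apply: (le_trans _ (op_norm_ge inj XY Y0)); rewrite lee_fin.
have re0 : 0 < `|Re z| + e by rewrite ltr_wpDl.
rewrite ler_pdivlMr// mulrC ler_pdivrMr//.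
have Xr := mulr_ge0 (ltW X0) (ltW re0).
rewrite -(@ler_pXn2r _ 2) ?nnegrE ?energy_norm_ge0//.
rewrite YX exprMn mulrC ler_wpM2l ?sqr_ge0// sqrrD real_normK ?num_real//.
by rewrite addrAC lerDl mulrn_wge0// mulr_ge0// ltW.
Qed.

(** Let [e] tend to 0 in [weyl_norm_ge]; the limit is replaced by a contradiction for a finite norm
    [m < 1 / |Re z|]. *)
Lemma norm_ge_inv_Re alpha z : resolvent_injective alpha z -> Re z != 0 ->
  ((`|Re z|^-1)%:E <= op_norm norm (op_inv (shift alpha z)))%E.
Proof.
move=> inj z0; have r0 : 0 < `|Re z| by rewrite normr_gt0.
have := fun e => @weyl_norm_ge alpha z e inj.
case: (op_norm _ _) => [m H| |H]; [|by rewrite leey|]; last first.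
  by have := H 1 ltr01.
rewrite lee_fin leNgt; apply/negP => mr.
have m0 : 0 < m.
  have := H 1 ltr01; rewrite lee_fin; apply: lt_le_trans.
  by rewrite invr_gt0 ltr_wpDl.
(* With this [e], [|Re z| + e] is the midpoint of [|Re z|] and [1 / m], so its inverse exceeds
   [m]. *)
have e0 : 0 < (m^-1 - `|Re z|) / 2.
  by rewrite divr_gt0// subr_gt0 -[ltLHS]invrK ltf_pV2 ?posrE ?invr_gt0.
have := H _ e0; rewrite lee_fin leNgt => /negP; apply.
rewrite -[ltLHS]invrK ltf_pV2 ?posrE ?invr_gt0 ?addr_gt0//.
move: e0; set x := m^-1; lra.
Qed.

(** If the inverse had a finite norm [m], the approximate eigenvector with [e = 1 / (m + 1)] would
    give [m + 1 <= m]. *)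
Lemma imaginary_spectrum alpha z : Re z = 0 -> spectrum norm (wave_operator N alpha) z.
Proof.
move=> z0 [[_ inj _]].
have inj' : resolvent_injective alpha z.
  move=> X X' Y /rel_shift[dX aX] /rel_shift[dX' aX'].
  apply: inj; [exact/mem_set|exact/mem_set|by rewrite aX aX'].
have := fun e => @weyl_norm_ge alpha z e inj'.
case: (op_norm _ _) => [m H _|//|H _]; last by have := H 1 ltr01.
have m0 : 0 < m.
  have := H 1 ltr01; rewrite lee_fin; apply: lt_le_trans.
  by rewrite invr_gt0 ltr_wpDl.
have := H (m + 1)^-1; rewrite invr_gt0 addr_gt0// => /(_ isT).
by rewrite z0 normr0 add0r invrK lee_fin gerDl leNgt ltr01.
Qed.

Lemma resolvent_inj b alpha z : 0 < Re (sg b * z) -> N%:R - sg b * alpha != 0 ->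
  resolvent_injective alpha z.
Proof.
move=> z0 aN X X' Y XY X'Y; apply/eqP; rewrite -subr_eq0; apply/eqP.
have D := resolvent_relB X'Y XY; rewrite subrr in D.
have := resolvent_bound_sqr z0 aN D; rewrite energy_norm0 expr0n mulr0 => h.
apply: energy_norm_eq0; apply/eqP; rewrite -sqrf_eq0 eq_le sqr_ge0 andbT.
by rewrite -(pmulr_rle0 _ (exprn_gt0 2 z0)).
Qed.

(** Write [K = 8 N 2^N] and [e = 1 / |alpha - s N|]. The squared estimate has the factor
    [3 + K e^2], which is at most the square of [(3 + K)(1 + e)]; this avoids a square root in the
    constant. *)
Definition resolvent_const : R := 3 + 8 * N%:R * 2 ^+ N.

Lemma normB_sg b alpha :
  cdot (N%:R - sg b * alpha) (N%:R - sg b * alpha) = cabs (alpha - sg b * N%:R) ^+ 2.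
Proof.
have -> : N%:R - sg b * alpha = - sg b * (alpha - sg b * N%:R).
  by case: (@sgP R b) => ->; ring.
rewrite cdot_mul2 cabs_sqr /cdot -!expr2.
by case: (@sgP R b) => -> /=; ring.
Qed.

Lemma half_planeP b z : half_plane b z <-> 0 < Re (sg b * z).
Proof. by rewrite Re_sgM. Qed.

Lemma normr_Re_sg b z : half_plane b z -> Re (sg b * z) = `|Re z|.
Proof.
rewrite half_planeP Re_sgM => z0; rewrite -(gtr0_norm z0) normrM normrX normrN1.
by rewrite expr1n mul1r.
Qed.

Lemma neq_sg b alpha : alpha <> sg b * N%:R -> N%:R - sg b * alpha != 0.
Proof.
move=> aN; apply/eqP => h; apply: aN.
have -> : alpha = sg b * N%:R - sg b * (N%:R - sg b * alpha).
  by case: (@sgP R b) => ->; ring.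
by rewrite h mulr0 subr0.
Qed.

Lemma resolvent_bound b alpha z X Y : half_plane b z ->
  N%:R - sg b * alpha != 0 -> resolvent_rel alpha z X Y ->
  norm X <= resolvent_const / `|Re z| * (1 + (cabs (alpha - sg b * N%:R))^-1) * norm Y.
Proof.
move=> hz aN XY; have z0 := (half_planeP b z).1 hz.
have := resolvent_bound_sqr z0 aN XY; rewrite normB_sg (normr_Re_sg hz).
set r := `|Re z|; set d := cabs _; set K := 8 * N%:R * 2 ^+ N.
have r0 : 0 < r by rewrite /r -(normr_Re_sg hz).
have K0 : 0 <= K by rewrite !mulr_ge0 ?exprn_ge0.
have d0 : 0 <= d^-1 by rewrite invr_ge0 cabs_ge0.
have n0 := energy_norm_ge0 Y; have x0 := energy_norm_ge0 X.
have CE : resolvent_const = 3 + K by [].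
have C0 : 0 <= resolvent_const by rewrite CE addr_ge0.
move=> h; rewrite -(@ler_pXn2r _ 2)// ?nnegrE//; last first.
  apply: mulr_ge0 n0; apply: mulr_ge0; last by rewrite addr_ge0.
  by rewrite divr_ge0// ltW.
rewrite -(ler_pM2l (exprn_gt0 2 r0)); apply: (le_trans h).
rewrite -exprVn; move: (d^-1) d0 => e e0.
have -> : r ^+ 2 * (resolvent_const / r * (1 + e) * norm Y) ^+ 2 =
    (resolvent_const * (1 + e)) ^+ 2 * norm Y ^+ 2.
  by field; rewrite gt_eqF.
rewrite ler_wpM2r ?sqr_ge0// CE.
have p1 := mulr_ge0 K0 (sqr_ge0 e); have p2 := mulr_ge0 K0 e0.
have p3 := mulr_ge0 (sqr_ge0 K) (sqr_ge0 e); have p4 := mulr_ge0 (sqr_ge0 K) e0.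
have p5 := sqr_ge0 K; have p6 := sqr_ge0 e.
rewrite exprMn !sqrrD; lra.
Qed.

Lemma upper_bound b alpha z : half_plane b z -> N%:R - sg b * alpha != 0 ->
  (op_norm norm (op_inv (shift alpha z)) <=
    (resolvent_const / `|Re z| * (1 + (cabs (alpha - sg b * N%:R))^-1))%:E)%E.
Proof.
move=> hz aN; have z0 := (half_planeP b z).1 hz.
apply: ge_ereal_sup => _ [Y /= Y1 <-]; rewrite lee_fin.
have [X XY] := resolvent_surjective Y z0 aN.
apply: (le_trans (resolvent_bound hz aN (op_inv_spec XY))).
apply: ler_piMr => //; apply: mulr_ge0; last by rewrite addr_ge0 ?invr_ge0 ?cabs_ge0.
by rewrite divr_ge0// addr_ge0// !mulr_ge0 ?exprn_ge0.
Qed.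

Lemma in_resolvent_set b alpha z : half_plane b z -> N%:R - sg b * alpha != 0 ->
  resolvent_set norm (wave_operator N alpha) z.
Proof.
move=> hz aN; have z0 := (half_planeP b z).1 hz; split.
  split.
  - by [].
  - move=> X X' /set_mem dX /set_mem dX' E; have rX := @shift_rel alpha z X dX.
    rewrite E in rX; exact: (resolvent_inj z0 aN rX (@shift_rel alpha z X' dX')).
  - move=> Y _; have [X XY] := resolvent_surjective Y z0 aN.
    by have [dX aX] := rel_shift XY; exists X.
exact: (le_lt_trans (upper_bound hz aN) (ltry _)).
Qed.

(** [resolvent_lower] yields [1 / (2 |Re z| |alpha - s N|)], where the 2 is the square root of its
    factor 4. Replacing [|Re z|] by the larger [|z|] gives the stated form. *)
Lemma lower_bound b alpha z : half_plane b z -> half_plane b alpha ->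
  N%:R - sg b * alpha != 0 ->
  ((2^-1 / (cabs z * cabs (alpha - sg b * N%:R)))%:E <=
    op_norm norm (op_inv (shift alpha z)))%E.
Proof.
move=> hz ha aN; have z0 := (half_planeP b z).1 hz.
have a0 := (half_planeP b alpha).1 ha.
have [X [Y [XY Y0 YX]]] := resolvent_lower N_gt0 z0 a0 aN.
apply: (le_trans _ (op_norm_ge (resolvent_inj z0 aN) XY Y0)); rewrite lee_fin.
rewrite normB_sg in YX.
set d := cabs _ in YX *; set r := Re _ in z0 YX.
have d0 : 0 <= d by exact: cabs_ge0.
have zr : r ^+ 2 <= cabs z ^+ 2.
  by rewrite /r Re_sgM exprMn -exprM mulnC exprM sqrrN expr1n expr1n mul1r cabs_sqr lerDl sqr_ge0.
have cz0 : 0 < cabs z.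
  rewrite lt_neqAle cabs_ge0 andbT eq_sym -sqrf_eq0 gt_eqF//.
  by rewrite (lt_le_trans _ zr)// exprn_gt0.
have n0 : 0 <= norm X := energy_norm_ge0 X.
have d1 : 0 < d.
  rewrite lt_neqAle d0 andbT eq_sym; apply/eqP => dz.
  move: YX; rewrite dz expr0n /= mulr0 mul0r leNgt => /negP; apply.
  by rewrite exprn_gt0.
have cd : 0 < cabs z * d by rewrite mulr_gt0.
rewrite ler_pdivrMr// mulrAC ler_pdivlMr//.
have p1 : 0 <= 2^-1 * norm Y by rewrite mulr_ge0 ?invr_ge0// ltW.
have p2 := mulr_ge0 n0 (ltW cd).
rewrite -(@ler_pXn2r _ 2)//.
have h : 4 * r ^+ 2 * d ^+ 2 * norm X ^+ 2 <= 4 * (norm X * (cabs z * d)) ^+ 2.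
  have -> : 4 * (norm X * (cabs z * d)) ^+ 2 = cabs z ^+ 2 * (4 * d ^+ 2 * norm X ^+ 2) by ring.
  have -> : 4 * r ^+ 2 * d ^+ 2 * norm X ^+ 2 = r ^+ 2 * (4 * d ^+ 2 * norm X ^+ 2) by ring.
  by rewrite ler_wpM2r// !mulr_ge0 ?sqr_ge0.
have {}h := le_trans YX h.
rewrite exprMn; lra.
Qed.

End Assembly.

(** * Determination of the spectrum *)

Section Spectrum.
Context {R : realType} (N : nat) (N_gt0 : (0 < N)%N).
Local Notation Re := (@complex.Re R).
Local Notation Im := (@complex.Im R).
Implicit Types (X Y : @energy_space R N) (j : 'I_N) (c d z alpha s : R[i]) (b : bool).
Local Notation W := (wave_operator N).
Local Notation shift alpha z := (op_shift (wave_operator N alpha) z).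
Local Notation norm := (@energy_norm R N).

Lemma closure_half_plane b : closure (half_plane b : set R[i]^o) =
  [set z : R[i]^o | 0 <= (-1) ^+ b * Re z].
Proof.
apply/seteqP; split => z /=.
  move=> cz; rewrite leNgt; apply/negP => z0.
  (* The distance from [z] to the half-plane. Radii of balls are complex numbers here, and
     positivity of such a number means that it is real and positive. *)
  pose e : R[i] := (- ((-1) ^+ b * Re z))%:C.
  have e0 : 0 < e by rewrite ltcE /= eqxx oppr_gt0.
  have [w [hw]] := cz _ (nbhsx_ballx (z : R[i]^o) e e0).
  rewrite /ball /= => zw.
  have := le_lt_trans (normc_ge_Re (z - w)) zw; rewrite ltcR.
  rewrite Defs.ReD ReN; move: hw z0; rewrite /half_plane /=.
  case: b {e e0 zw cz} => /=; rewrite ?expr1 ?expr0 ?mulN1r ?mul1r => w0 z0.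
    have := ler_norm (Re z - Re w); lra.
  have := ler_norm (- (Re z - Re w)); rewrite normrN; lra.
move=> z0 B /nbhs_ballP[e /= e0 eB].
have [Ime Ree] : Im e = 0 /\ 0 < Re e by move: e0; rewrite ltcE /= => /andP[/eqP -> ->].
(* Moving inward by half the radius reaches the open half-plane without leaving the ball. *)
pose w : R[i] := z + sg b * (Re e / 2)%:C; exists w; split.
  rewrite /half_plane /= Defs.ReD Re_sgM mulrDr mulrA -expr2 sqrr_sign mul1r /=.
  by rewrite ltr_wpDl// divr_gt0.
apply: eB; rewrite /ball /= /w opprD addrA subrr add0r normrN normrM.
have -> : `|sg b| = 1 :> R[i] by case: (@sgP R b) => ->; rewrite ?normrN normr1.
rewrite mul1r ger0_norm; last by rewrite ler0c divr_ge0// ltW.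
by rewrite ltcE /= Ime eqxx /= ltr_pdivrMr// ltr_pMr// ltr1n.
Qed.

(** The [k]-th power of the shifted operator lowers the index by [k], with every intermediate vector
    in the domain; one more application kills [X_ 0], so [X_ n] lies in the kernel of the power
    [n + 1]. *)
Lemma generalized_eigenvector alpha z (X_ : nat -> @energy_space R N) :
  resolvent_rel alpha z (X_ 0%N) 0 ->
  (forall k, resolvent_rel alpha z (X_ k.+1) (X_ k)) ->
  forall n, op_gen_eigenspace (W alpha) z (X_ n).
Proof.
move=> h0 hS n.
have pow k i : op_dom (op_pow (shift alpha z) k) (X_ (i + k)%N) /\
    op_act (op_pow (shift alpha z) k) (X_ (i + k)%N) = X_ i.
  elim: k i => [|k IH] i; first by rewrite addn0.
  rewrite addnS -addSn; have [dk ak] := IH i.+1.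
  have [d1 a1] := rel_shift N_gt0 (hS i).
  rewrite [op_pow _ _.+1]/(op_comp (shift alpha z) (op_pow (shift alpha z) k)).
  by split; [split; rewrite ?ak|rewrite /op_comp /= ak].
have [dn an] := pow n 0%N; rewrite add0n in dn an.
have [d1 a1] := rel_shift N_gt0 h0.
exists n.+1 => //.
rewrite [op_pow _ _.+1]/(op_comp (shift alpha z) (op_pow (shift alpha z) n)).
by split; [split; rewrite ?an|rewrite /op_comp /= an].
Qed.

(** Applying the shifted operator to a vanishing combination drops the term of index 0 and lowers
    the others, so induction kills all coefficients but the first; that one vanishes because [X_ 0]
    is nonzero. *)
Lemma chain_lin_indep alpha z (X_ : nat -> @energy_space R N) : X_ 0%N != 0 ->
  resolvent_rel alpha z (X_ 0%N) 0 ->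
  (forall k, resolvent_rel alpha z (X_ k.+1) (X_ k)) ->
  forall n, lin_indep (fun i : 'I_n => X_ i).
Proof.
move=> X0 h0 hS; elim=> [|n IH] a; first by move=> _ [].
rewrite big_ord_recl /= => S0.
have rS : resolvent_rel alpha z (\sum_(i < n) a (lift ord0 i) *: X_ i.+1)
    (\sum_(i < n) a (lift ord0 i) *: X_ i).
  apply: (big_ind2 (fun x y => resolvent_rel alpha z x y)).
  - exact: resolvent_rel0.
  - move=> x1 y1 x2 y2 r1 r2; have := resolvent_rel_lin 1 r1 r2.
    by rewrite !scale1r.
  - by move=> i _; apply: (resolvent_relZ N_gt0); exact: hS.
have := resolvent_rel_lin (a ord0) h0 rS; rewrite scaler0 add0r.
have -> : a ord0 *: X_ 0%N + \sum_(i < n) a (lift ord0 i) *: X_ i.+1 = 0 by exact: S0.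
move=> /(rel_shift N_gt0)[_ E].
have [_ E0] := rel_shift N_gt0 (resolvent_rel0 N_gt0 alpha z).
have H := IH (fun i => a (lift ord0 i)) (etrans (esym E) E0).
have a0 : a ord0 = 0.
  move: S0; rewrite big1 => [|i _]; last by rewrite H scale0r.
  by rewrite addr0 => /eqP; rewrite scaler_eq0 (negbTE X0) orbF => /eqP.
by move=> i; case: (unliftP ord0 i) => [k ->|->].
Qed.

Lemma critical_eigenvalue b z : half_plane b z ->
  [/\ point_spectrum (W (sg b * N%:R)) z,
      has_dim (op_eigenspace (W (sg b * N%:R)) z) 1 &
      infinite_dim (op_gen_eigenspace (W (sg b * N%:R)) z)].
Proof.
move=> /half_planeP z0; split.
- have [X [g [X0 _ _ rX]]] := eigenvector_exists N_gt0 z0.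
  by exists X => //; exact: (rel_shift N_gt0 rX).
- have [X [g [X0 HX Hg rX]]] := eigenvector_exists N_gt0 z0.
  exists (fun=> X); split.
  + by move=> _; exact: (rel_shift N_gt0 rX).
  + move=> a; rewrite big_ord1 => /eqP; rewrite scaler_eq0 (negbTE X0) orbF => /eqP a0 i.
    by rewrite (ord1 i).
  + move=> Y [dY aY]; have rY := @shift_rel R N N_gt0 _ z Y dY; rewrite aY in rY.
    have [a ->] := eigenspace_line N_gt0 z0 HX Hg rY.
    by exists (fun=> a); rewrite big_ord1.
- move=> n; have [X_ [X0 h0 hS]] := eigenvector_chain N_gt0 z0.
  exists (fun i => X_ i); split; last exact: chain_lin_indep X0 h0 hS n.
  by move=> i; exact: generalized_eigenvector h0 hS i.
Qed.

Lemma point_spectrum_sub alpha z : point_spectrum (W alpha) z ->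
  spectrum norm (W alpha) z.
Proof.
move=> [X X0 [dX aX]] [[_ inj _] _].
have [d0 a0] := rel_shift N_gt0 (resolvent_rel0 N_gt0 alpha z).
move/eqP: X0; apply; apply: inj; [exact/mem_set|exact/mem_set|].
by rewrite aX a0.
Qed.

Lemma sgN b : sg (~~ b) = - sg b :> R[i].
Proof. by case: b; rewrite /sg ?expr1 ?expr0 ?opprK. Qed.

(** The closed half-plane splits into the axis, always in the spectrum, and the open half-plane of
    eigenvalues. On the opposite side the resolvent estimate for the other sign applies. *)
Lemma critical_spectrum b : spectrum norm (W (sg b * N%:R)) =
  closure (half_plane b : set R[i]^o).
Proof.
rewrite closure_half_plane; apply/seteqP; split => z /=.
  move=> sz; rewrite leNgt; apply/negP => z0; apply: sz.
  apply: (@in_resolvent_set R N N_gt0 (~~ b)).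
    rewrite half_planeP sgN; move: z0; rewrite -Re_sgM mulNr.
    by case: (sg b * z) => x y /=; rewrite oppr_gt0.
  (* For the opposite sign the vertex factor [N - s alpha] equals [2 N], which is nonzero. *)
  rewrite sgN (_ : _ - _ = 2 * N%:R); last by case: (@sgP R b) => ->; ring.
  by rewrite mulf_neq0// pnatr_eq0 -?lt0n.
rewrite le_eqVlt => /predU1P[z0|z0].
  apply: imaginary_spectrum => //; apply/eqP; move/esym/eqP: z0.
  by rewrite mulf_eq0 signr_eq0.
by apply: point_spectrum_sub; have [] := critical_eigenvalue (z0 : half_plane b z).
Qed.

Lemma noncritical_spectrum alpha : alpha <> N%:R -> alpha <> - N%:R ->
  spectrum norm (W alpha) = imaginary_axis.
Proof.
move=> aN aN'; apply/seteqP; split => z /=; last exact: imaginary_spectrum.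
move=> sz; apply/eqP/negPn/negP => z0; apply: sz.
have [r0|r0] : half_plane false z \/ half_plane true z.
  rewrite /half_plane /= expr0 expr1 mul1r mulN1r oppr_gt0.
  by move: z0; rewrite neq_lt => /orP[]; [right|left].
  apply: (in_resolvent_set N_gt0 r0); apply: neq_sg.
  by rewrite /sg expr0 mul1r.
apply: (in_resolvent_set N_gt0 r0); apply: neq_sg.
by rewrite /sg expr1 mulN1r.
Qed.

Lemma imaginary_axis_spectrum alpha z : imaginary_axis z ->
  ~ point_spectrum (W alpha) z /\ ~ residual_spectrum norm (W alpha) z.
Proof.
move=> z0; split.
  move=> [X X0 [dX aX]]; move/eqP: X0; apply.
  have rX := @shift_rel R N N_gt0 _ z X dX; rewrite aX in rX.
  exact: imaginary_no_kernel z0 rX.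
move=> [_ _]; apply; apply/seteqP; split => // Y _ e e0.
have [X [Y' [rX YY']]] := dense_range alpha Y z0 e0.
exists Y' => //; have [dX aX] := rel_shift N_gt0 rX.
by exists X.
Qed.

End Spectrum.

Local Close Scope complex_scope.

Theorem theorem2p3 (R : realType) (N : nat) (N_gt0 : (0 < N)%N) :
  let W := @wave_operator R N in
  let norm := @energy_norm R N in
  [/\ (forall alpha : R[i], alpha <> N%:R -> alpha <> - N%:R ->
         spectrum norm (W alpha) = imaginary_axis),
      spectrum norm (W N%:R) = closure (half_plane false : set R[i]^o),
      spectrum norm (W (- N%:R)) = closure (half_plane true : set R[i]^o) &
      [/\ (forall alpha z : R[i], imaginary_axis z ->
             ~ point_spectrum (W alpha) z /\
             ~ residual_spectrum norm (W alpha) z),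
          (forall (b : bool) (z : R[i]), half_plane b z ->
             [/\ point_spectrum (W ((-1) ^+ b * N%:R)) z,
                 has_dim (op_eigenspace (W ((-1) ^+ b * N%:R)) z) 1 &
                 infinite_dim (op_gen_eigenspace (W ((-1) ^+ b * N%:R)) z)]) &
          (exists c0 C : R, [/\ 0 < c0, 0 < C &
             forall (b : bool) (alpha z : R[i]),
               half_plane b alpha -> alpha <> (-1) ^+ b * N%:R ->
               half_plane b z ->
               ((Num.max (`|complex.Re z|^-1)
                         (c0 / (cabs z * cabs (alpha - (-1) ^+ b * N%:R))))%:E
                <= op_norm norm (op_inv (op_shift (W alpha) z)))%E /\
               (op_norm norm (op_inv (op_shift (W alpha) z))
                <= (C / `|complex.Re z| *
                    (1 + (cabs (alpha - (-1) ^+ b * N%:R))^-1))%:E)%E])]].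
Proof.
move=> W norm; split.
- by move=> alpha; exact: noncritical_spectrum.
- have := @critical_spectrum R N N_gt0 false.
  have -> : sg false = 1 :> R[i] by rewrite /sg expr0.
  by rewrite mul1r.
- have := @critical_spectrum R N N_gt0 true.
  have -> : sg true = -1 :> R[i] by rewrite /sg expr1.
  by rewrite mulN1r.
split.
- by move=> alpha z; exact: imaginary_axis_spectrum.
- by move=> b z; exact: critical_eigenvalue.
(* Both constants are uniform in [alpha], [z] and the sign; only the second one depends on the
   number of edges. *)
exists 2^-1, (resolvent_const N); split.
- by rewrite invr_gt0.
- by rewrite /resolvent_const ltr_pwDl// !mulr_ge0 ?exprn_ge0.
move=> b alpha z ha aN hz; have aN' := neq_sg aN; split; last exact: upper_bound.
have z0 := (half_planeP b z).1 hz.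
have inj := resolvent_inj z0 aN'.
rewrite EFin_max ge_max; apply/andP; split; last exact: lower_bound.
apply: norm_ge_inv_Re => //; rewrite -normr_eq0 -(normr_Re_sg hz).
by rewrite gt_eqF.
Qed.
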